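(* Let $B_1\subset\mathbb{R}^2$ be the unit ball centered at the origin, and let $u\in C^{1,1}(B_1)$ be a convex function satisfying $u\ge0$ in $B_1$ and $u=0$ on $S:=\{(x_1,0):-1<x_1<0\}$. Let $a\in(0,\pi/2)$, and in polar coordinates let $$D:=\{(r,\theta):-\pi+a<\theta<\pi-a\}.$$ Assume that $\Delta u=1$ in $D\cap B_1$. Then $$u(x)=\frac{x_2^2}{2}\qquad\text{in }D\cap B_1.$$ In particular, $u$ cannot be strictly convex in $D\cap B_1$.
   Context: $(r,\theta)$ are polar coordinates in $\mathbb{R}^2$, $x=(x_1,x_2)=(r\cos\theta,r\sin\theta)$ with $r>0$, so $D$ is an open sector containing the positive $x_1$-axis. $u\in C^{1,1}(B_1)$ means that $u\in C^1(B_1)$ and $Du$ is globally Lipschitz in $B_1$. *)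

(* Defs.v *)
From HB Require Import structures.
From mathcomp Require Import all_boot all_order all_algebra.
From mathcomp Require Import all_classical all_reals all_analysis.

Set Implicit Arguments.
Unset Strict Implicit.
Unset Printing Implicit Defensive.

Import Order.TTheory GRing.Theory Num.Theory.
Import numFieldNormedType.Exports.

Local Open Scope classical_set_scope.
Local Open Scope ring_scope.

(* The plane is the product type R * R. Its library norm is the sup norm,
   which induces the same topology and the same Lipschitz functions as the
   Euclidean norm; the Euclidean ball therefore has to be defined here. *)

Definition unit_ball (R : realType) : set (R * R) :=
  [set x | Num.sqrt (x.1 ^+ 2 + x.2 ^+ 2) < 1].

Definition slit (R : realType) : set (R * R) :=
  [set x | -1 < x.1 < 0 /\ x.2 = 0].

Definition sector (R : realType) (a : R) : set (R * R) :=
  [set x | exists r theta : R,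
    [/\ 0 < r, - pi + a < theta, theta < pi - a
      & x = (r * cos theta, r * sin theta)]].

Definition partial1 (R : realType) (f : R * R -> R) : R * R -> R :=
  fun x => 'D_((1, 0) : R * R) f x.

Definition partial2 (R : realType) (f : R * R -> R) : R * R -> R :=
  fun x => 'D_((0, 1) : R * R) f x.

Definition gradient (R : realType) (f : R * R -> R) : R * R -> R * R :=
  fun x => (partial1 f x, partial2 f x).

(* Differentiability and continuity are in the sense of the whole plane, so
   C1_on and C11_on are meant for open sets A. *)
Definition C1_on (R : realType) (A : set (R * R)) (f : R * R -> R) : Prop :=
  {in A, forall x, differentiable f x} /\ {in A, continuous (gradient f)}.

Definition C11_on (R : realType) (A : set (R * R)) (f : R * R -> R) : Prop :=
  C1_on A f /\ [lipschitz gradient f x | x in A].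

Definition laplacian (R : realType) (f : R * R -> R) : R * R -> R :=
  fun x => partial1 (partial1 f) x + partial2 (partial2 f) x.

(* 'D_v f x has a default value when the derivative does not exist, so the
   existence of the second derivatives is recorded separately. *)
Definition has_laplacian (R : realType) (f : R * R -> R) (x : R * R) (l : R) :
    Prop :=
  [/\ derivable (partial1 f) x ((1, 0) : R * R),
      derivable (partial2 f) x ((0, 1) : R * R)
    & laplacian f x = l].

Definition lebesgue_measure2 (R : realType) :=
  (@lebesgue_measure R \x @lebesgue_measure R)%E.

(* The second derivatives of a C^{1,1} function exist, in general, only almost
   everywhere (Rademacher), so the equation is read almost everywhere; an
   equation holding at every point of A is a special case. *)
Definition laplacian_eq_on (R : realType) (A : set (R * R)) (f : R * R -> R)
    (l : R) : Prop :=
  {ae @lebesgue_measure2 R, forall x, A x -> has_laplacian f x l}.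

(* The set A need not be convex: the strict inequality is only required along
   the nondegenerate segments contained in A. *)
Definition strictly_convex_on (R : realType) (A : set (R * R))
    (f : R * R -> R) : Prop :=
  forall x y : R * R, x != y ->
    (forall t : R, 0 <= t <= 1 -> A (t *: x + (1 - t) *: y)) ->
    forall t : R, 0 < t < 1 ->
      f (t *: x + (1 - t) *: y) < t * f x + (1 - t) * f y.

(* Main.v *)
(**
Let [P_h] be the second difference of [u] in direction [e1], nonnegative by convexity,
and [V_h] the first difference, corrected by a multiple of [h x2^2] so as to be
nonnegative as well; [V_h] and [P_h] have constant, respectively zero, Laplacian where
[u] does. Integrating [V_h] against the Laplacian of a compactly supported function
built from a barrier of the form [(x1 - d) r^(- 1 - b) + e r^(- b)], with [b] slightly
less than [1], bounds the integral of [V_h] near the boundary of the sector at scale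
[rho]; a second barrier then bounds the integral of [P_h] near a fixed point of the
positive axis by [C h^2 rho^s], [s > 0], for all [h] small in terms of [rho].

As [P_(2 h)] is a sum of four translates of [P_h], the same bound with the same constant
holds for every step [t], now for all [rho], so [P_t] vanishes near that point. A radial
subharmonic test function propagates the vanishing (strong maximum principle) through the
whole sector. So [u] is affine on short horizontal segments; convexity forces its slope
to be locally constant, and since the gradient is [O (|x|)] the slope is zero. Thus [u]
depends on [x2] only, with second derivative [1], and [u = x2^2 / 2].
*)
From HB Require Import structures.
From mathcomp Require Import all_boot all_order all_algebra.
From mathcomp Require Import all_classical all_reals all_analysis.
From mathcomp Require Import measurable_realfun ring lra.
Require Import Defs.
Set Implicit Arguments.
Unset Strict Implicit.
Unset Printing Implicit Defensive.
Import Order.TTheory GRing.Theory Num.Theory.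
Import numFieldNormedType.Exports.
Local Open Scope classical_set_scope.
Local Open Scope ring_scope.

(** * Integration of compactly supported continuous functions on the plane *)

Section PlaneIntegral.
Context {R : realType}.
Local Notation mu := (@lebesgue_measure R).
Local Notation mu2 := (@lebesgue_measure R \x @lebesgue_measure R)%E.
Local Notation plane := (measurableTypeR R * measurableTypeR R)%type.
Implicit Types (f g : R * R -> R) (x y v : R * R).

(** The engine is a Phragmen-Lindelof effect: a homogeneous positive harmonic function vanishing on
    the sides of a sector of opening [2 (pi - a) > pi] has degree below [1], while the Lipschitz
    gradient gives [V_h = O(h r)]. So [V_h] has to be smaller than that. Trivially its integral at
    scale [rho] is [O(h rho^3)]; the first barrier improves this to [O(h rho^4)]. As [P_h] is a
    difference of [V_h], moving that difference onto a cutoff of scale [rho] bounds the integral of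
    [P_h] there by [O(h^2 rho^3)], again one power better than the trivial size. The second barrier
    has Laplacian at least [- C rho^(- 2 - b)] there, which leaves [rho^(1 - b)]: the exponent [s]
    is [1 - b = k / 16], with [k = cos a]. The obstacle is the tip: at distance [O(h)] the first
    barrier is not subharmonic, and this core costs [O(A h^(2 - b))], acceptable only for [h] small
    in terms of [rho]. The doubling argument removes that restriction. Since [u] has second
    derivatives only almost everywhere, everything is tested against explicit C^2 functions, and
    integration by parts is reduced to translation invariance. *)

Lemma open_plane_measurable (A : set (R * R)) : open A -> measurable (A : set plane).
Proof.
move=> oA.
(* The sigma-algebra is the product one, so an open set is written as a countable union of squares
   with rational centres and radii. *)
pose B (k : rat * rat * rat) : set plane :=
  (`]ratr k.1.1 - ratr k.2, ratr k.1.1 + (ratr k.2 : R)[ : set R) `*`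
  (`]ratr k.1.2 - ratr k.2, ratr k.1.2 + (ratr k.2 : R)[ : set R).
have -> : A = \bigcup_k (if `[< B k `<=` A >] then B k else set0).
  apply/seteqP; split => [x Ax|x [k _ /=]]; last by case: asboolP => // BA; exact: BA.
  have /nbhs_ballP[e /= e0 eA] : nbhs x A by exact: open_nbhs_nbhs.
  have [d dP] : exists d : rat, 0 < (ratr d : R) < e / 2.
    have /(@rat_in_itvoo R) [d dP] : 0 < e / 2 by rewrite divr_gt0.
    by exists d; move: dP; rewrite in_itv.
  move/andP: dP => [d0 de].
  have h z : exists p : rat, ratr p - ratr d < (z : R) < ratr p + ratr d.
    have /(@rat_in_itvoo R) [p] : z - ratr d < z + ratr d by lra.
    by rewrite in_itv/= => /andP[p1 p2]; exists p; apply/andP; split; lra.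
  have [p1 p1P] := h x.1; have [p2 p2P] := h x.2.
  exists ((p1, p2), d) => //=; case: asboolP => [_|]; first by split; rewrite /= in_itv.
  case=> y [/=]; rewrite !in_itv/= => /andP[y1 y1'] /andP[y2 y2'].
  move/andP: p1P => [? ?]; move/andP: p2P => [? ?].
  by apply: eA; split; rewrite -ball_normE/= /ball_/= ltr_norml; apply/andP; split; lra.
apply: countable_bigcupT_measurable; first exact: countableP.
by move=> k; case: asboolP => // _; apply: measurableX; exact: measurable_itv.
Qed.

Lemma continuous_plane_measurable f :
  continuous f -> measurable_fun [set: plane] (f : plane -> R).
Proof.
move=> /continuousP cf; apply: (measurability _ (RGenOpens.measurableE R)).
move=> _ [_ [a [b ->] <-]]; rewrite setTI; apply: open_plane_measurable.
exact/cf/interval_open.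
Qed.

Lemma plane_norm_le x (M : R) : (`|x| <= M) = (`|x.1| <= M) && (`|x.2| <= M).
Proof. by rewrite prod_normE/= ge_max. Qed.

Definition box (M : R) : set plane := `[- M, M]%classic `*` `[- M, M]%classic.

Lemma boxP M x : box M x <-> `|x| <= M.
Proof.
rewrite plane_norm_le /box /= !in_itv/= !ler_norml; split.
  by move=> [-> ->].
by move=> /andP[].
Qed.

Lemma measurable_box M : measurable (box M).
Proof. by apply: measurableX; exact: measurable_itv. Qed.

Lemma mu2_box M : 0 <= M -> mu2 (box M) = ((2 * M) ^+ 2)%:E.
Proof.
move=> M0; pose I := `[- M, M]%classic; transitivity (mu I * mu I)%E.
  by apply: product_measure1E; exact: measurable_itv.
rewrite /I lebesgue_measure_itv/= lte_fin.
case: ifPn => [_|]; first by rewrite -EFinB -EFinM expr2; congr (_%:E); ring.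
rewrite -leNgt => MM; have -> : M = 0 by lra.
by rewrite mule0 mulr0 expr0n.
Qed.

(** Continuous functions of bounded support: on this class [I2] is linear, monotone and translation
    invariant without further integrability conditions. *)
Definition cc f := continuous f /\ exists M, forall x, M < `|x| -> f x = 0.

Definition I2 f := \int[mu2]_x f x.

Lemma cc_cont f : cc f -> continuous f. Proof. by case. Qed.

Lemma cc_pos f : cc f -> exists2 M, 0 <= M & forall x, M < `|x| -> f x = 0.
Proof.
case=> _ [M fM]; exists `|M| => // x Mx; apply: fM; apply: le_lt_trans Mx.
exact: ler_norm.
Qed.

Lemma box_compact M : compact (box M : set (R * R)).
Proof. by apply: compact_setX; exact: segment_compact. Qed.

Lemma cc_bounded f : cc f -> exists2 K, 0 <= K & forall x, `|f x| <= K.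
Proof.
move=> cf; have [M M0 fM] := cc_pos cf.
have /compact_bounded[K [Kr KP]] : compact (f @` (box M : set (R * R))).
  apply: continuous_compact (@box_compact M).
  exact/continuous_subspaceT/(cc_cont cf).
exists (`|K| + 1); first by rewrite addr_ge0.
move=> x; have [xM|xM] := leP `|x| M; last by rewrite fM// normr0 addr_ge0.
apply: KP; first by rewrite (le_lt_trans (ler_norm _))// ltrDl.
by exists x => //; exact/boxP.
Qed.

Lemma cc_integrable f : cc f -> mu2.-integrable setT (EFin \o f).
Proof.
move=> cf; have [M M0 fM] := cc_pos cf; have [K K0 fK] := cc_bounded cf.
have -> : EFin \o f = (EFin \o f) \_ (box M).
  apply/funext => x; rewrite /patch; case: ifPn => //; rewrite notin_setE => nx /=.
  by rewrite fM// ltNge; apply/negP => /boxP.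
apply/(integrable_mkcond _ (measurable_box M)).
apply: measurable_bounded_integrable; first exact: measurable_box.
- by rewrite [ltLHS](mu2_box M0) ltry.
- apply: measurable_funTS; exact: continuous_plane_measurable (cc_cont cf).
- exists K; split; first exact: num_real.
  by move=> k Kk x _ /=; exact: le_trans (fK x) (ltW Kk).
Qed.

Lemma I2D f g : cc f -> cc g -> I2 (fun x => f x + g x) = I2 f + I2 g.
Proof. by move=> cf cg; rewrite /I2 RintegralD//; exact: cc_integrable. Qed.

Lemma I2B f g : cc f -> cc g -> I2 (fun x => f x - g x) = I2 f - I2 g.
Proof. by move=> cf cg; rewrite /I2 RintegralB//; exact: cc_integrable. Qed.

Lemma I2Z (k : R) f : cc f -> I2 (fun x => k * f x) = k * I2 f.
Proof. by move=> cf; rewrite /I2 RintegralZl//; exact: cc_integrable. Qed.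

Lemma le_I2 f g : cc f -> cc g -> (forall x, f x <= g x) -> I2 f <= I2 g.
Proof. by move=> cf cg fg; apply: le_Rintegral => //; exact: cc_integrable. Qed.

Lemma ccD f g : cc f -> cc g -> cc (fun x => f x + g x).
Proof.
move=> cf cg; split=> [x|]; first by apply: cvgD; [exact: cc_cont cf x|exact: cc_cont cg x].
have [M M0 fM] := cc_pos cf; have [N N0 gN] := cc_pos cg.
exists (M + N) => x MN; rewrite fM ?gN ?addr0//; lra.
Qed.

Lemma ccMl f g : continuous f -> cc g -> cc (fun x => f x * g x).
Proof.
move=> cf cg; split=> [x|]; first by apply: cvgM; [exact: cf|exact: cc_cont cg x].
by have [M M0 gM] := cc_pos cg; exists M => x /gM ->; rewrite mulr0.
Qed.

Lemma ccZ (k : R) f : cc f -> cc (fun x => k * f x).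
Proof. by move=> cf; apply: ccMl => //; exact: cst_continuous. Qed.

Lemma ccB f g : cc f -> cc g -> cc (fun x => f x - g x).
Proof.
move=> cf cg; have := ccD cf (ccZ (-1) cg).
by congr cc; apply/funext => x /=; rewrite mulN1r.
Qed.

Lemma cc_shift v f : cc f -> cc (fun x => f (x + v)).
Proof.
move=> cf; split=> [x|].
  apply: (@cvg_comp _ _ _ (fun x => x + v) f (nbhs x) (nbhs (x + v))); last exact: (cc_cont cf).
  by apply: cvgD => //; exact: cvg_cst.
have [M M0 fM] := cc_pos cf; exists (M + `|v|) => x Mx; apply: fM.
have := ler_normB (x + v) v; rewrite addrK => ?; lra.
Qed.

(** A measure agreeing with Lebesgue measure on half-open intervals is Lebesgue measure, and a shift
    preserves the length of an interval. *)
Lemma pushforward_shift1 (t : R) (A : set (measurableTypeR R)) : measurable A ->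
  mu A = pushforward mu (fun z : measurableTypeR R => z + t : measurableTypeR R) A.
Proof.
move=> mA; have mt : measurable_fun setT (fun z : measurableTypeR R => z + t : measurableTypeR R).
  by apply: continuous_measurable_fun => z; apply: cvgD => //; exact: cvg_cst.
have mu_t := isMeasurableFun.Build _ _ _ _ _ mt.
pose phi : {mfun measurableTypeR R >-> measurableTypeR R} := HB.pack (fun z : measurableTypeR R => z + t : measurableTypeR R) mu_t.
apply: (lebesgue_measure_unique (mu := pushforward mu phi)) => // _ [[a b]] _ <-.
rewrite [RHS](_ : _ = mu `](a - t), (b - t)]%classic); last first.
  congr (mu _); apply/seteqP; split => z /=; rewrite !in_itv/= => /andP[? ?];
    by apply/andP; split; lra.
rewrite !lebesgue_measure_itv/= !lte_fin ltrD2r; case: ifP => // _.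
by rewrite -!EFinB; congr (_%:E); ring.
Qed.

Lemma measurable_shift1 (t : R) :
  measurable_fun setT (fun z : measurableTypeR R => z + t : measurableTypeR R).
Proof. by apply: continuous_measurable_fun => z; apply: cvgD => //; exact: cvg_cst. Qed.

Lemma measurable_shift v : measurable_fun setT (fun x : plane => (x + v : plane)).
Proof.
apply/measurable_fun_pairP; split => /=.
  exact: (measurableT_comp (measurable_shift1 v.1) measurable_fst).
exact: (measurableT_comp (measurable_shift1 v.2) measurable_snd).
Qed.

(** By uniqueness of the product measure, comparison on rectangles suffices. *)
Lemma pushforward_shift v (A : set plane) : measurable A ->
  pushforward mu2 (fun x : plane => (x + v : plane)) A = mu2 A.
Proof.
move=> mA; have mt := measurable_shift v.
have mu_t := isMeasurableFun.Build _ _ _ _ _ mt.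
pose phi : {mfun plane >-> plane} := HB.pack (fun x : plane => (x + v : plane)) mu_t.
apply/esym.
apply: (@product_measure_unique _ _ _ _ R mu mu (pushforward mu2 phi)) => // B C mB mC.
transitivity (mu2 ((fun z : measurableTypeR R => z + v.1 : measurableTypeR R) @^-1` B `*`
                   (fun z : measurableTypeR R => z + v.2 : measurableTypeR R) @^-1` C)) => //.
rewrite product_measure1E.
- by congr (_ * _)%E; apply/esym; exact: pushforward_shift1.
- by rewrite -[X in measurable X]setTI; exact: measurable_shift1.
- by rewrite -[X in measurable X]setTI; exact: measurable_shift1.
Qed.

(** Translation invariance is the source of all integration by parts below: it makes integrals of
    difference quotients vanish and moves horizontal differences onto the cutoffs. *)
Lemma I2_shift v f : cc f -> I2 (fun x => f (x + v)) = I2 f.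
Proof.
move=> cf; rewrite /I2 /Rintegral; congr fine.
pose phi : plane -> plane := fun x => x + v.
transitivity (\int[pushforward mu2 phi]_x (f x)%:E)%E.
  rewrite (integral_pushforward (measurable_shift v)) ?preimage_setT//.
  - by apply/measurable_EFinP; apply: continuous_plane_measurable; exact: cc_cont.
  - exact: cc_integrable (cc_shift v cf).
apply: eq_measure_integral => [|? A mA _]; first exact: measurable_shift.
exact: pushforward_shift.
Qed.

Lemma box_cst_integrable (c M : R) : 0 <= M ->
  mu2.-integrable setT (EFin \o (cst c \_ (box M))).
Proof.
move=> M0.
have -> : EFin \o (cst c \_ (box M)) = ((EFin \o cst c) \_ (box M) : plane -> \bar R).
  by apply/funext => x /=; rewrite /patch; case: ifP.
apply/(integrable_mkcond _ (measurable_box M)).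
apply: measurable_bounded_integrable; first exact: measurable_box.
- by rewrite [ltLHS](mu2_box M0) ltry.
- by [].
- exists `|c|; split; first exact: num_real.
  by move=> k Kk x _ /=; exact: ltW.
Qed.

Lemma I2_box_cst (c M : R) : 0 <= M -> I2 (cst c \_ (box M)) = c * (2 * M) ^+ 2.
Proof.
move=> M0; have mubox : fine (mu2 (box M)) = (2 * M) ^+ 2 by rewrite [mu2 _]mu2_box.
by rewrite /I2 -Rintegral_mkcond Rintegral_cst ?mubox//; exact: measurable_box.
Qed.

Lemma I2_le_box f (c M : R) : cc f -> 0 <= M ->
  (forall x, `|x| <= M -> f x <= c) -> (forall x, M < `|x| -> f x <= 0) ->
  I2 f <= c * (2 * M) ^+ 2.
Proof.
move=> cf M0 fc f0; rewrite -I2_box_cst//; apply: le_Rintegral => //.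
- exact: cc_integrable.
- exact: box_cst_integrable.
- move=> x _; rewrite /patch; case: ifPn; rewrite ?inE ?notin_setE => xM.
    by apply: fc; apply/boxP.
  by apply: f0; rewrite ltNge; apply/negP => /boxP.
Qed.

Lemma I2_ge_box f (c M : R) : cc f -> 0 <= M -> (forall x, 0 <= f x) ->
  (forall x, `|x| <= M -> c <= f x) -> c * (2 * M) ^+ 2 <= I2 f.
Proof.
move=> cf M0 f0 fc; rewrite -I2_box_cst//; apply: le_Rintegral => //.
- exact: box_cst_integrable.
- exact: cc_integrable.
- move=> x _; rewrite /patch; case: ifPn; rewrite ?inE ?notin_setE => xM; last exact: f0.
  by apply: fc; apply/boxP.
Qed.

Lemma I2_eq0 f : cc f -> (forall x, 0 <= f x) -> I2 f <= 0 -> forall x, f x = 0.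
Proof.
move=> cf f0 If x; apply/eqP; rewrite eq_le f0 andbT leNgt; apply/negP => fx.
have : \forall y \near x, f x / 2 < f y.
  have : f @ x --> f x by exact: cc_cont.
  by move/cvgr_gt; apply; lra.
move/nbhs_ballP => [e /= e0 eP].
(* The point is translated to the origin, where the boxes of [I2_ge_box] are centred. *)
have := @I2_ge_box (fun y => f (y + x)) (f x / 2) (e / 2) (cc_shift x cf).
rewrite I2_shift//.
have e2 : 0 <= e / 2 by lra.
move=> /(_ e2 (fun y => f0 _)).
have H y : `|y| <= e / 2 -> f x / 2 <= f (y + x).
  move=> ye; apply/ltW/eP; rewrite -ball_normE/= opprD addrCA subrr addr0 normrN; lra.
move=> /(_ H); have : 0 < f x / 2 * (2 * (e / 2)) ^+ 2.
  by apply: mulr_gt0; [lra|apply: exprn_gt0; lra].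
lra.
Qed.

(** The majorant depends on [x.1] only, so Tonelli reduces the bound to a one-dimensional
    antiderivative; this takes the place of polar coordinates. *)
Lemma I2_le_slab f (F dF : R -> R) (M : R) : cc f -> 0 < M ->
  continuous dF -> (forall z : R, is_derive z (1 : R) F (dF z)) -> (forall z, 0 <= dF z) ->
  (forall x, `|x| <= M -> f x <= dF x.1) -> (forall x, M < `|x| -> f x <= 0) ->
  I2 f <= 2 * M * (F M - F (- M)).
Proof.
move=> cf M0 cdF FdF dF0 fdF f0.
pose J : set (measurableTypeR R) := `[- M, M]%classic.
have mJ : measurable J by exact: measurable_itv.
pose g : plane -> R := (fun x => dF x.1) \_ (box M).
have gint : (\int[mu2]_x (g x)%:E)%E = (2 * M * (F M - F (- M)))%:E.
  transitivity (\int[mu]_x ((((EFin \o dF) \_ J) x) * (2 * M)%:E))%E.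
    rewrite fubini_tonelli1; last 2 first.
    - apply/measurable_EFinP; apply/(measurable_restrictT _ (measurable_box M)).
      apply: measurable_funTS.
      exact: (measurableT_comp (continuous_measurable_fun cdF) measurable_fst).
    - by move=> x; rewrite lee_fin /g /patch; case: ifP.
    apply: eq_integral => z _; rewrite /fubini_F.
    transitivity (\int[mu]_y ((((EFin \o dF) \_ J) z)%E * (\1_J y)%:E))%E.
      apply: eq_integral => y _; rewrite /g /patch /= indicE.
      case: ifPn; rewrite ?inE ?notin_setE.
        by case=> /= zJ yJ; rewrite !mem_set//= mule1.
      move=> nzy; case: ifPn; rewrite ?inE => zJ; last by rewrite mul0e.
      by rewrite memNset ?mule0// => yJ; apply: nzy.
    rewrite ge0_integralZl//.
    - rewrite integral_indic// setIT; congr (_ * _)%E.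
      transitivity (mu `[- M, M]%classic) => //.
      rewrite lebesgue_measure_itv/= lte_fin.
      by rewrite ifT; [rewrite -EFinB; congr (_%:E); ring|lra].
    - by apply/measurable_EFinP; exact: measurable_indic.
    - by rewrite /patch; case: ifP => //= _; rewrite lee_fin.
  rewrite ge0_integralZr//; last 3 first.
  - apply/(measurable_restrictT _ mJ); apply/measurable_EFinP.
    by apply: measurable_funTS; exact: continuous_measurable_fun.
  - by move=> z _; rewrite /patch; case: ifP => //= _; rewrite lee_fin.
  - by rewrite lee_fin; lra.
  rewrite -integral_mkcond (@continuous_FTC2 _ dF F).
  - by rewrite -EFinB -EFinM; congr (_%:E); ring.
  - lra.
  - exact: continuous_subspaceT.
  - have cF : continuous F.
      by move=> z; apply: differentiable_continuous; apply/derivable1_diffP; exact: ex_derive.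
    split; first by move=> z _; exact: ex_derive.
    + by apply: cvg_at_right_filter; exact: cF.
    + by apply: cvg_at_left_filter; exact: cF.
  - by move=> z _; rewrite derive1E; exact: derive_val.
have <- : I2 g = 2 * M * (F M - F (- M)) by rewrite /I2 /Rintegral gint.
apply: le_Rintegral => //.
- exact: cc_integrable.
- have -> : EFin \o g = ((EFin \o (fun x => dF x.1)) \_ (box M) : plane -> \bar R).
    by apply/funext => x /=; rewrite /g /patch; case: ifP.
  apply/(integrable_mkcond _ (measurable_box M)).
  have /compact_bounded[K [Kr KP]] : compact (dF @` `[- M, M]).
    by apply: continuous_compact; [exact: continuous_subspaceT|exact: segment_compact].
  apply: measurable_bounded_integrable; first exact: measurable_box.
  + by rewrite [ltLHS](mu2_box (ltW M0)) ltry.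
  + apply: measurable_funTS.
    exact: (measurableT_comp (continuous_measurable_fun cdF) measurable_fst).
  + exists K; split => // k Kk x [xM _] /=.
    by apply: (KP _ Kk); exists x.1.
- move=> x _; rewrite /g /patch; case: ifPn; rewrite ?inE ?notin_setE => xM.
    by apply: fdF; apply/boxP.
  by apply: f0; rewrite ltNge; apply/negP => /boxP.
Qed.

(** Controls a singularity of order [r^(- b)]. The majorant is integrable across the line [x.1 = 0]
    because [b < 1], and the bound is uniform in the regularisation [s]. *)
Lemma I2_le_pow f (b c s M : R) : cc f -> 0 < M -> 0 < s -> 0 <= b < 1 -> 0 <= c ->
  (forall x, `|x| <= M -> f x <= c * (x.1 ^+ 2 + s ^+ 2) `^ (- (b / 2))) ->
  (forall x, M < `|x| -> f x <= 0) ->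
  I2 f <= 4 * c / (1 - b) * M ^+ 2 * (M ^+ 2) `^ (- (b / 2)).
Proof.
move=> cf M0 s0 /andP[b0 b1] c0 fc f0.
have zs z : 0 < z ^+ 2 + s ^+ 2 :> R by apply: ltr_wpDl; rewrite ?sqr_ge0// exprn_gt0.
have dq (z : R) : is_derive z (1 : R) (fun z => z ^+ 2 + s ^+ 2) (2 * z).
  by apply: is_derive_eq; rewrite /GRing.scale/=; ring.
have dpow (p z : R) : is_derive z (1 : R) (fun z => (z ^+ 2 + s ^+ 2) `^ p)
    (p * (z ^+ 2 + s ^+ 2) `^ (p - 1) * (2 * z)).
  exact: (@is_derive1_comp R (@powR R ^~ p) (fun z => z ^+ 2 + s ^+ 2) z _ _
    (is_derive1_powR p (zs z)) (dq z)).
pose F z : R := c / (1 - b) * (z * (z ^+ 2 + s ^+ 2) `^ (- (b / 2))).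
pose dF z : R := c / (1 - b) * ((z ^+ 2 + s ^+ 2) `^ (- (b / 2)) +
  z * ((- (b / 2)) * (z ^+ 2 + s ^+ 2) `^ (- (b / 2) - 1) * (2 * z))).
have dFE (z : R) : is_derive z (1 : R) F (dF z).
  by apply: is_derive_eq; rewrite /dF /GRing.scale/=; ring.
have cpow p : continuous (fun z : R => (z ^+ 2 + s ^+ 2) `^ p).
  move=> z; apply: differentiable_continuous; apply/derivable1_diffP.
  exact: ex_derive.
have cid : continuous (fun z : R => z) by move=> z; exact: cvg_id.
have cdF : continuous dF.
  move=> z; apply: cvgM; first exact: cvg_cst.
  apply: cvgD; first exact: cpow.
  apply: cvgM; first exact: cid.
  apply: cvgM; last by apply: cvgM; [exact: cvg_cst|exact: cid].
  by apply: cvgM; [exact: cvg_cst|exact: cpow].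
have qS z : (z ^+ 2 + s ^+ 2) `^ (- (b / 2)) =
    (z ^+ 2 + s ^+ 2) `^ (- (b / 2) - 1) * (z ^+ 2 + s ^+ 2).
  have := @powRD _ (z ^+ 2 + s ^+ 2) (- (b / 2) - 1) 1.
  by rewrite subrK (gt_eqF (zs z)) implybT powRr1 ?ltW// => ->.
(* [F] regularises [c / (1 - b) * z^(1 - b)]; its derivative exceeds the majorant by a nonnegative
   multiple of [b * s ^+ 2]. *)
have dFge z : c * (z ^+ 2 + s ^+ 2) `^ (- (b / 2)) <= dF z.
  rewrite -subr_ge0 /dF qS; set Q := _ `^ _.
  have Q0 : 0 <= Q by exact: powR_ge0.
  have -> : c / (1 - b) * (Q * (z ^+ 2 + s ^+ 2) + z * (- (b / 2) * Q * (2 * z))) -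
     c * (Q * (z ^+ 2 + s ^+ 2)) = c / (1 - b) * (Q * (b * s ^+ 2)).
    by field; rewrite subr_eq0 gt_eqF.
  apply: mulr_ge0; first by apply: divr_ge0; lra.
  by apply: mulr_ge0 => //; apply: mulr_ge0 => //; exact: sqr_ge0.
apply: le_trans (I2_le_slab cf M0 cdF dFE _ _ f0) _.
- by move=> z; apply: le_trans (dFge z); rewrite mulr_ge0 ?powR_ge0.
- by move=> x /fc h; exact: le_trans (dFge _).
rewrite /F sqrrN.
have -> : 2 * M * (c / (1 - b) * (M * (M ^+ 2 + s ^+ 2) `^ (- (b / 2))) -
   c / (1 - b) * (- M * (M ^+ 2 + s ^+ 2) `^ (- (b / 2)))) =
   4 * c / (1 - b) * M ^+ 2 * (M ^+ 2 + s ^+ 2) `^ (- (b / 2)) by ring.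
have M2 : 0 < M ^+ 2 by rewrite exprn_gt0.
apply: ler_wpM2l; first by apply: mulr_ge0; [apply: divr_ge0; lra|exact: sqr_ge0].
rewrite !powRN lef_pV2 ?posrE ?powR_gt0//.
apply: ge0_ler_powR; [lra|by rewrite nnegrE ltW|by rewrite nnegrE ltW|].
by rewrite lerDl sqr_ge0.
Qed.
End PlaneIntegral.

(** * Green's formula *)

Section Divergence.
Context {R : realType}.
Local Notation mu2 := (@lebesgue_measure R \x @lebesgue_measure R)%E.
Local Notation plane := (measurableTypeR R * measurableTypeR R)%type.
Local Notation e1 := ((1, 0) : R * R).
Local Notation e2 := ((0, 1) : R * R).
Implicit Types (f g : R * R -> R) (x y v : R * R).

Lemma is_derive_cvg f x v d : is_derive x v f d ->
  h^-1 * (f (x + h *: v) - f x) @[h --> 0^'] --> d.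
Proof.
move=> fd; have := @ex_derive _ _ _ _ _ _ _ fd; rewrite /derivable => /cvg_ex[l hl].
have -> : d = l.
  by rewrite -(@derive_val _ _ _ _ _ _ _ fd) /derive; exact/cvg_lim.
rewrite (_ : (fun h => _) = (fun h => h^-1 *: (f (h *: v + x) - f x)))//.
by apply/funext => h; rewrite /GRing.scale/= [h *: v + x]addrC.
Qed.

Lemma ae_mono (P Q : plane -> Prop) : (forall x, P x -> Q x) ->
  {ae mu2, forall x, P x} -> {ae mu2, forall x, Q x}.
Proof.
move=> PQ [A [mA A0 PA]]; exists A; split => // x /= nQ; apply: PA => /= Px.
exact/nQ/PQ.
Qed.

(* The difference quotients of [H1] and [H2] have integral zero by translation
   invariance, are bounded by [L], and converge almost everywhere. *)
Lemma I2_divergence H1 H2 G (L tau : R) : cc H1 -> cc H2 -> cc G -> 0 < tau ->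
  (forall x (t : R), `|t| < tau -> `|H1 (x + t *: e1) - H1 x| <= L * `|t|) ->
  (forall x (t : R), `|t| < tau -> `|H2 (x + t *: e2) - H2 x| <= L * `|t|) ->
  {ae mu2, forall x, exists d1 d2,
    [/\ is_derive x e1 H1 d1, is_derive x e2 H2 d2 & d1 + d2 = G x]} ->
  I2 G = 0.
Proof.
move=> cH1 cH2 cG tau0 L1 L2 aeG.
(* With [n.+2] the steps are strictly below [tau] already at [n = 0], as the Lipschitz hypotheses
   require. *)
pose t (n : nat) : R := tau / n.+2%:R.
have t0 n : 0 < t n by rewrite divr_gt0.
have ttau n : t n < tau.
  by rewrite ltr_pdivrMr// -[ltLHS]mulr1 ltr_pM2l// (ltr_nat _ 1).
have ct : t @ \oo --> (0 : R).
  rewrite -(mulr0 tau); apply: cvgM; first exact: cvg_cst.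
  by have := @cvg_harmonic R; rewrite -cvg_shiftS.
have ct' : t @ \oo --> 0^'.
  move=> A /= hA; have h : \forall n \near \oo, t n != 0 -> A (t n) := ct _ hA.
  exact: filterS (fun n (h : t n != 0 -> A (t n)) => h (lt0r_neq0 (t0 n))) h.
pose K n x := (t n)^-1 * ((H1 (x + t n *: e1) - H1 x) + (H2 (x + t n *: e2) - H2 x)).
have cK n : cc (K n).
  by apply: ccZ; apply: ccD; apply: ccB => //; exact: cc_shift.
have IK n : I2 (K n) = 0.
  rewrite I2Z; last by apply: ccD; apply: ccB => //; exact: cc_shift.
  rewrite I2D; try by apply: ccB => //; exact: cc_shift.
  rewrite !I2B//; try exact: cc_shift.
  by rewrite !I2_shift// !subrr addr0 mulr0.
have [M1 M10 H1M] := cc_pos cH1; have [M2 M20 H2M] := cc_pos cH2.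
pose M := M1 + M2 + tau.
have M0 : 0 <= M by rewrite /M; lra.
have far x n : M < `|x| -> K n x = 0.
  move=> xM; have xt (v : R * R) : `|v| <= 1 -> M1 + M2 < `|x + t n *: v|.
    move=> v1; have := ler_normB (x + t n *: v) (t n *: v).
    rewrite addrK normrZ (gtr0_norm (t0 n)) => h.
    have : t n * `|v| <= tau by rewrite -[leRHS]mulr1 ler_pM// ltW.
    by move: xM; rewrite /M; lra.
  have e11 : `|e1| <= 1 by rewrite plane_norm_le/= normr1 normr0 ler01 lexx.
  have e21 : `|e2| <= 1 by rewrite plane_norm_le/= normr1 normr0 ler01 lexx.
  have := xt _ e11; have := xt _ e21; move: xM; rewrite /M => ? ? ?.
  rewrite /K !H1M ?H2M; [ring|lra..].
have Kle n x : `|K n x| <= 2 * L.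
  rewrite /K normrM normfV (gtr0_norm (t0 n)) ler_pdivrMl//.
  apply: le_trans (ler_normD _ _) _.
  have tn : `|t n| < tau by rewrite gtr0_norm.
  have := L1 x _ tn; have := L2 x _ tn; rewrite (gtr0_norm (t0 n)); lra.
have L0 : 0 <= 2 * L by apply: le_trans (Kle 0 0).
have H : (EFin \o I2 \o K) @ \oo --> (I2 G)%:E.
  have [] := @dominated_convergence _ _ _ mu2 setT measurableT
    (fun n => EFin \o K n) (EFin \o G) (EFin \o (cst (2 * L) \_ (box M))).
  - by move=> n; apply/measurable_EFinP; apply: continuous_plane_measurable; exact: cc_cont.
  - by apply/measurable_EFinP; apply: continuous_plane_measurable; exact: cc_cont.
  - apply: ae_mono aeG => x [d1 [d2 [h1 h2 dG]]] _; rewrite /= -dG.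
    have C1 : (fun n => (t n)^-1 * (H1 (x + t n *: e1) - H1 x)) @ \oo --> d1.
      exact: (cvg_comp t (fun h => h^-1 * (H1 (x + h *: e1) - H1 x)) ct'
        (is_derive_cvg h1)).
    have C2 : (fun n => (t n)^-1 * (H2 (x + t n *: e2) - H2 x)) @ \oo --> d2.
      exact: (cvg_comp t (fun h => h^-1 * (H2 (x + h *: e2) - H2 x)) ct'
        (is_derive_cvg h2)).
    apply/fine_cvgP; split; first by apply: nearW.
    have E : K ^~ x = (fun n => (t n)^-1 * (H1 (x + t n *: e1) - H1 x)) \+
        (fun n => (t n)^-1 * (H2 (x + t n *: e2) - H2 x)).
      by apply/funext => n; rewrite /K mulrDr.
    have C3 : K ^~ x @ \oo --> d1 + d2 by rewrite E; exact: cvgD.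
    exact: C3.
  - exact: box_cst_integrable.
  - apply: aeW => x n _ /=; rewrite lee_fin /patch.
    case: ifPn; rewrite ?inE ?notin_setE => xM; first exact: Kle.
    by rewrite far ?normr0// ltNge; apply/negP => /boxP.
  move=> _ _.
  rewrite (_ : [sequence _]_n = EFin \o I2 \o K); last first.
    apply/funext => n /=; rewrite /I2 /Rintegral fineK//.
    by apply: integrable_fin_num => //; exact: (cc_integrable (cK n)).
  rewrite (_ : (\int[mu2]_x _)%E = (I2 G)%:E)//.
  rewrite /I2 /Rintegral fineK//.
  by apply: integrable_fin_num => //; exact: (cc_integrable cG).
have H0 : (EFin \o I2 \o K) @ \oo --> (0 : R)%:E.
  by apply: cvg_near_cst; apply: nearW => n /=; rewrite IK.
by apply: EFin_inj; exact: (cvg_unique (@ereal_hausdorff R) H H0).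
Qed.
End Divergence.

Section Green.
Context {R : realType}.
Local Notation mu2 := (@lebesgue_measure R \x @lebesgue_measure R)%E.
Local Notation e1 := ((1, 0) : R * R).
Local Notation e2 := ((0, 1) : R * R).
Implicit Types (f g : R * R -> R) (x y v : R * R).

Lemma is_derive_line f x v (c d : R) : is_derive (x + c *: v) v f d ->
  is_derive c (1 : R) (fun s => f (x + s *: v)) d.
Proof.
move=> fd.
have E : (fun h : R => h^-1 *: (((fun s => f (x + s *: v)) \o shift c) (h *: (1 : R)) - f (x + c *: v)))
       = (fun h : R => h^-1 *: ((f \o shift (x + c *: v)) (h *: v) - f (x + c *: v))).
  apply/funext => h /=; congr (_ *: (f _ - _)).
  by rewrite /GRing.scale/= mulr1 addrCA -scalerDl.
split; first by rewrite /derivable E; exact: ex_derive.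
by rewrite /derive E; exact: (@derive_val _ _ _ _ _ _ _ fd).
Qed.

Lemma dir_MVT_ge0 f df x v (t : R) : 0 <= t ->
  (forall s, 0 <= s <= t -> is_derive (x + s *: v) v f (df (x + s *: v))) ->
  exists2 c, 0 <= c <= t & f (x + t *: v) - f x = df (x + c *: v) * t.
Proof.
move=> t0 fd; pose g s := f (x + s *: v).
have gd s : 0 <= s <= t -> is_derive s (1 : R) g (df (x + s *: v)).
  by move=> st; apply: is_derive_line; exact: fd.
have [||c ct gc] := @MVT_segment R g (fun s => df (x + s *: v)) 0 t t0.
- by move=> s /subset_itv_oo_cc; rewrite in_itv/=; exact: gd.
- apply: derivable_within_continuous => s; rewrite in_itv/= => st.
  by have := gd s st => ?; exact: ex_derive.
exists c; first by move: ct; rewrite in_itv.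
by move: gc; rewrite /g scale0r addr0 subr0.
Qed.

Lemma dir_MVT f df x v (t : R) :
  (forall s, `|s| <= `|t| -> is_derive (x + s *: v) v f (df (x + s *: v))) ->
  exists2 c, `|c| <= `|t| & f (x + t *: v) - f x = df (x + c *: v) * t.
Proof.
move=> fd; have [t0|t0] := leP 0 t.
  have [s /andP[s0 st]|c /andP[c0 ct] ->] := @dir_MVT_ge0 f df x v t t0.
    by apply: fd; rewrite !ger0_norm.
  by exists c => //; rewrite !ger0_norm.
have nt0 : 0 <= - t by rewrite oppr_ge0 ltW.
have E s : x + t *: v + s *: v = x + (t + s) *: v by rewrite -addrA scalerDl.
have [s /andP[s0 st]|c /andP[c0 ct]] := @dir_MVT_ge0 f df (x + t *: v) v (- t) nt0.
  by rewrite E; apply: fd; rewrite (ltr0_norm t0) ler_norml; apply/andP; split; lra.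
rewrite !E subrr scale0r addr0 => h.
exists (t + c); first by rewrite (ltr0_norm t0) ler_norml; apply/andP; split; lra.
by rewrite -[LHS]opprB h mulrN opprK.
Qed.

Lemma dir_lip f df x v (t L : R) :
  (forall s, `|s| <= `|t| -> is_derive (x + s *: v) v f (df (x + s *: v)) /\
     `|df (x + s *: v)| <= L) ->
  `|f (x + t *: v) - f x| <= L * `|t|.
Proof.
move=> h; have [|c ct ->] := @dir_MVT f df x v t; first by move=> s /h[].
by rewrite normrM ler_wpM2r//; have [] := h c ct.
Qed.

(** The support lies in [O] with a uniform margin [tau], so translates by less than [tau] stay in
    [O]; this quantifies compact support. *)
Definition sptd (O : set (R * R)) f := exists M tau : R, 0 < tau /\
  forall x, f x != 0 -> `|x| <= M /\ forall y, `|y - x| < tau -> O y.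

(** [f] is controlled only on [O]; at a point outside [O] the margin makes [g], hence the product,
    vanish in a whole neighbourhood. *)
Lemma cc_mul (O : set (R * R)) f g : (forall x, O x -> {for x, continuous f}) ->
  continuous g -> sptd O g -> cc (fun x => f x * g x).
Proof.
move=> cf cg [M [tau [tau0 gs]]]; split; last first.
  exists M => x xM; have [->|/gs[]] := eqVneq (g x) 0; first by rewrite mulr0.
  by rewrite leNgt xM.
move=> x; have [Ox|nOx] := pselect (O x); first by apply: cvgM; [exact: cf|exact: cg].
have : \forall y \near x, f y * g y = 0.
  apply/nbhs_ballP; exists tau => //= y; rewrite -ball_normE/= => xy.
  have [->|/gs[_ gO]] := eqVneq (g y) 0; first by rewrite mulr0.
  by exfalso; apply: nOx; exact: gO.
move=> h0; move: (nbhs_singleton h0) => /= h1; rewrite /continuous_at h1.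
by apply: cvg_near_cst.
Qed.

(** The derivatives are explicit data, with the pure second ones only, since only the Laplacian of
    [T] is tested. A single set [S] carries the support of all five functions. *)
Record test_fun (O : set (R * R)) (T T1 T2 T11 T22 : R * R -> R) : Prop := TestFun {
  tf_d1 : forall x, is_derive x e1 T (T1 x) ;
  tf_d2 : forall x, is_derive x e2 T (T2 x) ;
  tf_d11 : forall x, is_derive x e1 T1 (T11 x) ;
  tf_d22 : forall x, is_derive x e2 T2 (T22 x) ;
  tf_c : continuous T ; tf_c1 : continuous T1 ; tf_c2 : continuous T2 ;
  tf_c11 : continuous T11 ; tf_c22 : continuous T22 ;
  tf_supp : exists (S : set (R * R)) (M tau : R),
   [/\ 0 < tau, forall x, ~ S x -> [/\ T x = 0, T1 x = 0, T2 x = 0, T11 x = 0 & T22 x = 0]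
     & forall x, S x -> `|x| <= M /\ forall y, `|y - x| < tau -> O y] }.

Lemma tf_sptd O T T1 T2 T11 T22 : test_fun O T T1 T2 T11 T22 ->
  [/\ sptd O T, sptd O T1, sptd O T2, sptd O T11 & sptd O T22].
Proof.
move=> tf; have [S [M [tau [tau0 S0 SO]]]] := tf_supp tf.
have h f : (forall x, ~ S x -> f x = 0) -> sptd O f.
  move=> f0; exists M, tau; split => // x fx; apply: SO; apply: contrapT => /f0 fx0.
  by move: fx; rewrite fx0 eqxx.
by split; apply: h => x /S0[].
Qed.

Lemma sptd_cc (O : set (R * R)) f : continuous f -> sptd O f -> cc f.
Proof.
move=> cf sf; have h : cc (fun x => 1 * f x).
  by apply: (@cc_mul O (cst 1)) => // x _; exact: cst_continuous.
by have -> : f = (fun x => 1 * f x) by apply/funext => x; rewrite mul1r.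
Qed.

Lemma is_derive_near0 f x v (tau : R) : 0 < tau ->
  (forall y, `|y - x| < tau -> f y = 0) -> is_derive x v f 0.
Proof.
move=> tau0 f0.
have : is_derive x v (cst 0 : R * R -> R) 0 by exact: is_derive_cst.
apply: near_eq_is_derive => //; apply/nbhs_ballP; exists tau => //= y.
by rewrite -ball_normE/= distrC => /f0 ->.
Qed.

(** The bracket [f g' - f' g] is one component of the field in Green's identity; its Lipschitz bound
    along [v] supplies the domination for the difference quotients. If one endpoint lies in [S], the
    whole segment lies in [O]; otherwise both values vanish. *)
Lemma green_lip O f f' g g' (S : set (R * R)) v (K Kg tau : R) : 0 <= K -> 0 <= Kg -> `|v| <= 1 ->
  (forall x, O x -> is_derive x v f (f' x)) ->
  (forall x, O x -> `|f x| <= K /\ `|f' x| <= K) ->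
  (forall x y, O x -> O y -> `|f' x - f' y| <= K * `|x - y|) ->
  (forall x t, `|g (x + t *: v) - g x| <= Kg * `|t|) ->
  (forall x t, `|g' (x + t *: v) - g' x| <= Kg * `|t|) ->
  (forall x, `|g x| <= Kg /\ `|g' x| <= Kg) ->
  (forall x, ~ S x -> g x = 0 /\ g' x = 0) ->
  (forall x, S x -> forall y, `|y - x| < tau -> O y) ->
  forall x (t : R), `|t| < tau ->
  `|(f (x + t *: v) * g' (x + t *: v) - f' (x + t *: v) * g (x + t *: v)) -
    (f x * g' x - f' x * g x)| <= 4 * (K * Kg) * `|t|.
Proof.
move=> K0 Kg0 v1 fd fK f'K gl g'l gK gS SO.
have main x (t : R) : `|t| < tau -> S x ->
  `|(f (x + t *: v) * g' (x + t *: v) - f' (x + t *: v) * g (x + t *: v)) -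
    (f x * g' x - f' x * g x)| <= 4 * (K * Kg) * `|t|.
  move=> tt Sx.
  have Os s : `|s| <= `|t| -> O (x + s *: v).
    move=> st; apply: (SO x Sx); rewrite addrC addKr normrZ.
    apply: le_lt_trans tt; apply: le_trans st.
    by rewrite ler_piMr.
  have Ox : O x by have := Os 0; rewrite scale0r addr0 normr0; apply.
  have Oy := Os t (lexx _).
  have fl : `|f (x + t *: v) - f x| <= K * `|t|.
    apply: (@dir_lip f f') => s st; split; first exact/fd/Os.
    by have [] := fK _ (Os s st).
  have f'l : `|f' (x + t *: v) - f' x| <= K * `|t|.
    apply: le_trans (f'K _ _ Oy Ox) _; rewrite ler_wpM2l// addrC addKr normrZ.
    by rewrite ler_piMr.
  have [fy f'y] := fK _ Oy; have [gx g'x] := gK x.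
  have gt := gl x t; have g't := g'l x t.
  set A := f (x + t *: v); set B := g' (x + t *: v).
  set C := f' (x + t *: v); set D := g (x + t *: v).
  have -> : A * B - C * D - (f x * g' x - f' x * g x) =
    A * (B - g' x) + (A - f x) * g' x - C * (D - g x) - (C - f' x) * g x by ring.
  have t0 : 0 <= `|t| by [].
  have b1 : `|A * (B - g' x)| <= K * (Kg * `|t|) by rewrite normrM ler_pM.
  have b2 : `|(A - f x) * g' x| <= (K * `|t|) * Kg by rewrite normrM ler_pM.
  have b3 : `|C * (D - g x)| <= K * (Kg * `|t|) by rewrite normrM ler_pM.
  have b4 : `|(C - f' x) * g x| <= (K * `|t|) * Kg by rewrite normrM ler_pM.
  have -> : 4 * (K * Kg) * `|t| =
    K * (Kg * `|t|) + (K * `|t|) * Kg + K * (Kg * `|t|) + (K * `|t|) * Kg by ring.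
  apply: le_trans (ler_normB _ _) _; apply: lerD => //.
  apply: le_trans (ler_normB _ _) _; apply: lerD => //.
  by apply: le_trans (ler_normD _ _) _; apply: lerD.
move=> x t tt; have [Sx|nSx] := pselect (S x); first exact: main.
(* Only the translated point may lie in [S]: the two endpoints are exchanged. *)
have [Sy|nSy] := pselect (S (x + t *: v)).
  have := main (x + t *: v) (- t); rewrite normrN scaleNr addrK distrC.
  exact.
have [-> ->] := gS _ nSx; have [-> ->] := gS _ nSy.
by rewrite !mulr0 !subr0 normr0 !mulr_ge0.
Qed.

(** The field [(f T1 - f1 T, f T2 - f2 T)] has divergence [f (T11 + T22) - l T] almost everywhere,
    because the products of first derivatives cancel; its integral is zero by [I2_divergence]. *)
Lemma green (O : set (R * R)) f f1 f2 (l K : R) T T1 T2 T11 T22 :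
  test_fun O T T1 T2 T11 T22 ->
  (forall x, O x -> [/\ is_derive x e1 f (f1 x), is_derive x e2 f (f2 x) &
     [/\ {for x, continuous f}, {for x, continuous f1} & {for x, continuous f2}]]) ->
  (forall x, O x -> [/\ `|f x| <= K, `|f1 x| <= K & `|f2 x| <= K]) ->
  (forall x y, O x -> O y ->
     `|f1 x - f1 y| <= K * `|x - y| /\ `|f2 x - f2 y| <= K * `|x - y|) ->
  {ae mu2, forall x, O x -> exists d1 d2,
    [/\ is_derive x e1 f1 d1, is_derive x e2 f2 d2 & d1 + d2 = l]} ->
  I2 (fun x => f x * (T11 x + T22 x)) = l * I2 T.
Proof.
move=> tf fd fK fl aef.
have [sT sT1 sT2 sT11 sT22] := tf_sptd tf.
have [S [M [tau [tau0 S0 SO]]]] := tf_supp tf.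
have [K' [K0 KK']] : exists K', 0 <= K' /\ K <= K' by exists `|K|; rewrite normr_ge0 ler_norm.
have cT : cc T := sptd_cc (tf_c tf) sT.
have cT1 : cc T1 := sptd_cc (tf_c1 tf) sT1.
have cT2 : cc T2 := sptd_cc (tf_c2 tf) sT2.
have cT11 : cc T11 := sptd_cc (tf_c11 tf) sT11.
have cT22 : cc T22 := sptd_cc (tf_c22 tf) sT22.
have [k k0 kT] := cc_bounded cT. have [k1 k10 kT1] := cc_bounded cT1.
have [k2 k20 kT2] := cc_bounded cT2. have [k3 k30 kT11] := cc_bounded cT11.
have [k4 k40 kT22] := cc_bounded cT22.
have [Kg [Kg0 bT]] : exists Kg, 0 <= Kg /\ forall x,
    [/\ `|T x| <= Kg, `|T1 x| <= Kg, `|T2 x| <= Kg, `|T11 x| <= Kg & `|T22 x| <= Kg].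
  exists (k + k1 + k2 + k3 + k4); split=> [|x]; first lra.
  by have := (kT x, kT1 x, kT2 x, kT11 x, kT22 x) => -[[[[? ?] ?] ?] ?]; split; lra.
have cfO x : O x -> {for x, continuous f} by move=> /fd[_ _ []].
have cf1O x : O x -> {for x, continuous f1} by move=> /fd[_ _ []].
have cf2O x : O x -> {for x, continuous f2} by move=> /fd[_ _ []].
have e11 : `|e1| <= 1 by rewrite plane_norm_le/= normr1 normr0 ler01 lexx.
have e21 : `|e2| <= 1 by rewrite plane_norm_le/= normr1 normr0 ler01 lexx.
have cF : cc (fun x => f x * (T11 x + T22 x)).
  have -> : (fun x => f x * (T11 x + T22 x)) = (fun x => f x * T11 x + f x * T22 x).
    by apply/funext => x; rewrite mulrDr.
  by apply: ccD; [exact: (cc_mul cfO (tf_c11 tf) sT11)|exact: (cc_mul cfO (tf_c22 tf) sT22)].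
apply/eqP; rewrite -subr_eq0 -I2Z// -I2B//; last exact: ccZ.
apply/eqP.
  apply: (@I2_divergence _ (fun x => f x * T1 x - f1 x * T x)
      (fun x => f x * T2 x - f2 x * T x) _ (4 * (K' * Kg)) tau) => //.
  - by apply: ccB; [exact: (cc_mul cfO (tf_c1 tf) sT1)|exact: (cc_mul cf1O (tf_c tf) sT)].
  - by apply: ccB; [exact: (cc_mul cfO (tf_c2 tf) sT2)|exact: (cc_mul cf2O (tf_c tf) sT)].
  - by apply: ccB => //; exact: ccZ.
  - apply: (@green_lip O f f1 T T1 S) => //.
    + by move=> x /fd[].
    + by move=> x /fK[h0 h1 h2]; split; exact: le_trans KK'.
    + move=> x y Ox Oy; have [l1 l2] := fl x y Ox Oy.
      by apply: le_trans (ler_wpM2r _ KK').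
    + move=> x t; apply: (@dir_lip T T1) => s _; split; [exact: (tf_d1 tf)|by case: (bT (x + s *: e1))].
    + move=> x t; apply: (@dir_lip T1 T11) => s _; split; [exact: (tf_d11 tf)|by case: (bT (x + s *: e1))].
    + by move=> x; case: (bT x).
    + by move=> x /S0[].
    + by move=> x /SO[].
  - apply: (@green_lip O f f2 T T2 S) => //.
    + by move=> x /fd[].
    + by move=> x /fK[h0 h1 h2]; split; exact: le_trans KK'.
    + move=> x y Ox Oy; have [l1 l2] := fl x y Ox Oy.
      by apply: le_trans (ler_wpM2r _ KK').
    + move=> x t; apply: (@dir_lip T T2) => s _; split; [exact: (tf_d2 tf)|by case: (bT (x + s *: e2))].
    + move=> x t; apply: (@dir_lip T2 T22) => s _; split; [exact: (tf_d22 tf)|by case: (bT (x + s *: e2))].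
    + by move=> x; case: (bT x).
    + by move=> x /S0[].
    + by move=> x /SO[].
  - apply: ae_mono aef => x h.
    have [Ox|nOx] := pselect (O x).
      have [d1 [d2 [h1 h2 dl]]] := h Ox; have [g1 g2 _] := fd x Ox.
      exists (f x * T11 x - d1 * T x), (f x * T22 x - d2 * T x); split.
      + have hT := tf_d1 tf x; have hT1 := tf_d11 tf x.
        by apply: is_derive_eq; rewrite /GRing.scale/=; ring.
      + have hT := tf_d2 tf x; have hT1 := tf_d22 tf x.
        by apply: is_derive_eq; rewrite /GRing.scale/=; ring.
      + by rewrite -dl; ring.
    (* Near a point outside [O] the test function and its derivatives are identically zero, so the
       field has zero derivatives there although [f] is unknown. *)
    have nS y : `|y - x| < tau -> ~ S y.
      by move=> yx Sy; apply: nOx; apply: (SO y Sy).2; rewrite distrC.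
    have nSx : ~ S x by apply: nS; rewrite subrr normr0.
    exists 0, 0; have [-> _ _ -> ->] := S0 x nSx.
    split; last by rewrite !addr0 !mulr0 subr0.
    + by apply: is_derive_near0 tau0 _ => y /nS /S0[-> -> _ _ _]; rewrite !mulr0 subr0.
    + by apply: is_derive_near0 tau0 _ => y /nS /S0[-> _ -> _ _]; rewrite !mulr0 subr0.
Qed.
End Green.

(** * Test functions *)

Section Spline.
Context {R : realType}.
Implicit Types s t : R.

Definition pos s := Num.max s 0.

Lemma pos_ge0 s : 0 <= pos s. Proof. by rewrite le_max lexx orbT. Qed.
Lemma pos_id s : 0 <= s -> pos s = s. Proof. by move=> s0; rewrite /pos max_l. Qed.
Lemma pos_eq0 s : s <= 0 -> pos s = 0. Proof. by move=> s0; rewrite /pos max_r. Qed.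

Lemma pos_cont : continuous pos.
Proof. by move=> s; apply: continuous_max; [exact: cvg_id|exact: cvg_cst]. Qed.

(** The exponent is at least [2], which makes the truncated power differentiable at its corner. *)
Lemma is_derive_pos n s :
  is_derive s (1 : R) (fun t => pos t ^+ n.+2) (n.+2%:R * pos s ^+ n.+1).
Proof.
have [s0|s0|->] := ltgtP s 0.
- rewrite (pos_eq0 (ltW s0)) expr0n mulr0.
  have : is_derive s (1 : R) (cst 0 : R -> R) 0 by exact: is_derive_cst.
  apply: near_eq_is_derive => //.
  near=> t; rewrite pos_eq0 ?expr0n//; apply/ltW; near: t.
  exact: lt_nbhsl.
- rewrite (pos_id (ltW s0)).
  have : is_derive s (1 : R) (fun t : R => t ^+ n.+2) (n.+2%:R * s ^+ n.+1).
    by split; [exact: exprn_derivable|rewrite exp_derive /GRing.scale/= mulr1].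
  apply: near_eq_is_derive => //.
  near=> t; rewrite pos_id//; apply/ltW; near: t.
  exact: lt_nbhsr.
- rewrite pos_eq0// expr0n mulr0.
  have H : h^-1 *: (((fun t => pos t ^+ n.+2) \o shift 0) (h *: (1 : R)) - pos 0 ^+ n.+2)
     @[h --> 0^'] --> (0 : R).
    apply/cvgr0Pnorm_lt => e e0.
    near=> h.
    have h0 : h != 0 by near: h; exact: nbhs_dnbhs_neq.
    rewrite /= addr0 (pos_eq0 (lexx 0)) expr0n subr0 /GRing.scale/= mulr1.
    rewrite normrM normfV ltr_pdivrMl ?normr_gt0//.
    have ph : `|pos h| <= `|h|.
      rewrite ger0_norm ?pos_ge0// /pos ge_max ler_norm; exact: normr_ge0.
    apply: (@le_lt_trans _ _ (`|h| * `|h| ^+ n.+1)).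
      by rewrite normrX -exprS lerXn2r ?nnegrE.
    rewrite ltr_pM2l ?normr_gt0//.
    have he : `|h| < e by near: h; exact: dnbhs0_lt.
    have h1 : `|h| < 1 by near: h; exact: dnbhs0_lt.
    apply: le_lt_trans he; rewrite exprS ler_piMr// exprn_ile1//; exact: ltW.
  apply: DeriveDef; first by apply/cvg_ex; exists 0; exact: H.
  by apply: cvg_lim => //; exact: H.
Unshelve. all: by end_near. Qed.

(* [G0] is convex, nondecreasing and C^2, vanishes for [s <= 0] and is affine for
   [2 <= s]; hence [G0 \o w] is a compactly supported C^2 function wherever [w] is
   positive only on a compact set, and it is subharmonic where [w] is. *)
Definition G0 s := pos s ^+ 3 - 2 * pos (s - 1) ^+ 3 + pos (s - 2) ^+ 3.
Definition G1 s := 3 * (pos s ^+ 2 - 2 * pos (s - 1) ^+ 2 + pos (s - 2) ^+ 2).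
Definition G2 s := 6 * (pos s - 2 * pos (s - 1) + pos (s - 2)).

Lemma pos_shift_derive n (c s : R) :
  is_derive s (1 : R) (fun t => pos (t - c) ^+ n.+2) (n.+2%:R * pos (s - c) ^+ n.+1).
Proof.
have h : is_derive s (1 : R) (fun t : R => t - c) 1.
  by apply: is_derive_eq; rewrite subr0.
have := @is_derive1_comp R (fun t => pos t ^+ n.+2) (fun t => t - c) s _ _
  (is_derive_pos n (s - c)) h.
by rewrite mulr1.
Qed.

Lemma is_derive_G0 s : is_derive s (1 : R) G0 (G1 s).
Proof.
have h0 := is_derive_pos 1 s; have h1 := pos_shift_derive 1 1 s.
have h2 := pos_shift_derive 1 2 s.
by apply: is_derive_eq; rewrite /G1 /GRing.scale/=; ring.
Qed.

Lemma is_derive_G1 s : is_derive s (1 : R) G1 (G2 s).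
Proof.
have h0 := is_derive_pos 0 s; have h1 := pos_shift_derive 0 1 s.
have h2 := pos_shift_derive 0 2 s.
by apply: is_derive_eq; rewrite /G2 /GRing.scale/=; ring.
Qed.

Lemma pos_shift_cont c : continuous (fun s => pos (s - c)).
Proof.
move=> s; apply: (@cvg_comp _ _ _ (fun s => s - c) pos (nbhs s) (nbhs (s - c))); last exact: pos_cont.
by apply: cvgB; [exact: cvg_id|exact: cvg_cst].
Qed.

Lemma G2_cont : continuous G2.
Proof.
move=> s; apply: cvgM; first exact: cvg_cst.
apply: cvgD; last exact: pos_shift_cont.
apply: cvgB; first exact: pos_cont.
apply: cvgM; [exact: cvg_cst|exact: pos_shift_cont].
Qed.

Lemma derive_cont (g dg : R -> R) : (forall s, is_derive s (1 : R) g (dg s)) -> continuous g.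
Proof.
move=> gd s; apply: differentiable_continuous; apply/derivable1_diffP.
by have := gd s => ?; exact: ex_derive.
Qed.

Lemma G_le0 s : s <= 0 -> [/\ G0 s = 0, G1 s = 0 & G2 s = 0].
Proof.
by move=> s0; rewrite /G0 /G1 /G2 !pos_eq0; [split; ring|lra..].
Qed.

Lemma G_bounds s : [/\ 0 <= G0 s, G0 s <= 6 * pos s, 0 <= G1 s <= 6 & 0 <= G2 s].
Proof.
rewrite /G0 /G1 /G2.
have [s0|s0] := leP s 0; first by rewrite !pos_eq0; [split; lra|lra..].
have [s1|s1] := leP s 1.
  rewrite (pos_id (ltW s0)) ![pos (_ - _)]pos_eq0; [|lra..].
  by split; [nra|nra|apply/andP; split; nra|nra].
have [s2|s2] := leP s 2.
  rewrite (pos_id (ltW s0)) (@pos_id (s - 1)) ?(@pos_eq0 (s - 2)); [|lra..].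
  by split; [nra|nra|apply/andP; split; nra|nra].
rewrite !pos_id; [|lra..].
by split; [nra|nra|apply/andP; split; nra|nra].
Qed.

Lemma G1_gt0 s : 0 < s -> 0 < G1 s.
Proof.
move=> s0; rewrite /G1.
have [s1|s1] := leP s 1.
  by rewrite (pos_id (ltW s0)) ![pos (_ - _)]pos_eq0; [nra|lra..].
have [s2|s2] := leP s 2.
  by rewrite (pos_id (ltW s0)) (@pos_id (s - 1)) ?(@pos_eq0 (s - 2)); [nra|lra..].
by rewrite !pos_id; [nra|lra..].
Qed.

Lemma G1_ge3 s : 1 <= s -> 3 <= G1 s.
Proof.
move=> s0; rewrite /G1.
have [s2|s2] := leP s 2.
  have [h h1 h2] : [/\ 0 <= s, 0 <= s - 1 & s - 2 <= 0] by split; lra.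
  by rewrite (pos_id h) (pos_id h1) (pos_eq0 h2); nra.
by rewrite !pos_id; [nra|lra..].
Qed.
End Spline.

Section TestFunctions.
Context {R : realType}.
Local Notation e1 := ((1, 0) : R * R).
Local Notation e2 := ((0, 1) : R * R).
Implicit Types (f g w : R * R -> R) (x y v : R * R).

Lemma is_derive_of_line f x v (d : R) :
  is_derive (0 : R) (1 : R) (fun s => f (x + s *: v)) d -> is_derive x v f d.
Proof.
move=> fd.
have E : (fun h : R => h^-1 *: (((fun s => f (x + s *: v)) \o shift 0) (h *: (1 : R)) - f (x + 0 *: v)))
       = (fun h : R => h^-1 *: ((f \o shift x) (h *: v) - f x)).
  apply/funext => h /=; congr (_ *: (f _ - f _)); last by rewrite scale0r addr0.
  by rewrite /GRing.scale/= mulr1 addr0 addrC.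
apply: DeriveDef; first by rewrite /derivable -E; exact: ex_derive.
by rewrite /derive -E; exact: (@derive_val _ _ _ _ _ _ _ fd).
Qed.

Lemma is_derive_plane_comp (g : R -> R) w x v (a b : R) :
  is_derive (w x) (1 : R) g a -> is_derive x v w b ->
  is_derive x v (fun y => g (w y)) (a * b).
Proof.
move=> ga wb; apply: is_derive_of_line.
have h : is_derive (0 : R) (1 : R) (fun s => w (x + s *: v)) b.
  by apply: is_derive_line; rewrite scale0r addr0.
have := @is_derive1_comp R g (fun s => w (x + s *: v)) 0 a b.
by rewrite scale0r addr0; apply.
Qed.

Definition C2_at w w1 w2 w11 w22 x : Prop :=
  [/\ is_derive x e1 w (w1 x), is_derive x e2 w (w2 x),
        is_derive x e1 w1 (w11 x), is_derive x e2 w2 (w22 x) &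
     [/\ {for x, continuous w}, {for x, continuous w1}, {for x, continuous w2},
         {for x, continuous w11} & {for x, continuous w22}]].

(** [G0] vanishes on nonpositive arguments, so smoothness of [w] matters only where [w] can be
    positive; the first alternative absorbs the singularity of the barrier. The Laplacian of the
    composition is [G2 (w) |grad w|^2 + G1 (w) Lap w], whose first term is nonnegative. *)
Lemma compose_test_fun (O : set (R * R)) w w1 w2 w11 w22 (M tau : R) :
  0 < tau ->
  (forall x, (exists2 t : R, 0 < t & forall y, `|y - x| < t -> w y <= 0) \/
    C2_at w w1 w2 w11 w22 x) ->
  (forall x, 0 < w x -> `|x| <= M /\ forall y, `|y - x| < tau -> O y) ->
  test_fun O (fun x => G0 (w x)) (fun x => G1 (w x) * w1 x) (fun x => G1 (w x) * w2 x)
    (fun x => G2 (w x) * w1 x ^+ 2 + G1 (w x) * w11 x)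
    (fun x => G2 (w x) * w2 x ^+ 2 + G1 (w x) * w22 x).
Proof.
move=> tau0 hw hS.
have loc (F : R * R -> R) x (t : R) : 0 < t -> (forall y, `|y - x| < t -> w y <= 0) ->
    (forall y, w y <= 0 -> F y = 0) -> {for x, continuous F}.
  move=> t0 wt F0; have F0x : F x = 0 by apply/F0/wt; rewrite subrr normr0.
  have h : \forall y \near x, F y = 0.
    by apply/nbhs_ballP; exists t => //= y; rewrite -ball_normE/= distrC => /wt /F0.
  change (F @ x --> F x); rewrite F0x; exact: cvg_near_cst.
have cG0 := derive_cont (@is_derive_G0 R); have cG1 := derive_cont (@is_derive_G1 R).
have cG2 := @G2_cont R.
have cc x (g : R -> R) : continuous g -> {for x, continuous w} ->
    {for x, continuous (fun y => g (w y))}.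
  by move=> cg cw; apply: continuous_comp; [exact: cw|exact: cg].
have z0 y : w y <= 0 -> G0 (w y) = 0 by move=> /G_le0[].
have z1 y : w y <= 0 -> G1 (w y) = 0 by move=> /G_le0[].
have z2 y : w y <= 0 -> G2 (w y) = 0 by move=> /G_le0[].
split.
- move=> x; case: (hw x) => [[t t0 wt]|[d1 _ _ _ _]].
    rewrite z1 ?mul0r; last by apply: wt; rewrite subrr normr0.
    by apply: is_derive_near0 t0 _ => y /wt /z0.
  by apply: is_derive_plane_comp d1; exact: is_derive_G0.
- move=> x; case: (hw x) => [[t t0 wt]|[_ d1 _ _ _]].
    rewrite z1 ?mul0r; last by apply: wt; rewrite subrr normr0.
    by apply: is_derive_near0 t0 _ => y /wt /z0.
  by apply: is_derive_plane_comp d1; exact: is_derive_G0.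
- move=> x; case: (hw x) => [[t t0 wt]|[d1 _ d11 _ _]].
    rewrite z1 ?z2 ?mul0r ?addr0; try by apply: wt; rewrite subrr normr0.
    by apply: is_derive_near0 t0 _ => y /wt /z1 ->; rewrite mul0r.
  have h := is_derive_plane_comp (is_derive_G1 (w x)) d1.
  by apply: is_derive_eq; rewrite /GRing.scale/=; ring.
- move=> x; case: (hw x) => [[t t0 wt]|[_ d1 _ d11 _]].
    rewrite z1 ?z2 ?mul0r ?addr0; try by apply: wt; rewrite subrr normr0.
    by apply: is_derive_near0 t0 _ => y /wt /z1 ->; rewrite mul0r.
  have h := is_derive_plane_comp (is_derive_G1 (w x)) d1.
  by apply: is_derive_eq; rewrite /GRing.scale/=; ring.
- move=> x; case: (hw x) => [[t t0 wt]|[_ _ _ _ [? ? ? ? ?]]]; first exact: loc t0 wt z0.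
  exact: cc.
- move=> x; case: (hw x) => [[t t0 wt]|[_ _ _ _ [? ? ? ? ?]]].
    by apply: loc t0 wt _ => y /z1 ->; rewrite mul0r.
  by apply: cvgM => //; exact: cc.
- move=> x; case: (hw x) => [[t t0 wt]|[_ _ _ _ [? ? ? ? ?]]].
    by apply: loc t0 wt _ => y /z1 ->; rewrite mul0r.
  by apply: cvgM => //; exact: cc.
- move=> x; case: (hw x) => [[t t0 wt]|[_ _ _ _ [? c1 ? ? ?]]].
    by apply: loc t0 wt _ => y wy; rewrite z1 ?z2// !mul0r addr0.
  apply: cvgD; apply: cvgM => //; try exact: cc.
  by apply: (@continuous_comp _ _ _ w1 (fun t => t ^+ 2)) => //; exact: exprn_continuous.
- move=> x; case: (hw x) => [[t t0 wt]|[_ _ _ _ [? ? c1 ? ?]]].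
    by apply: loc t0 wt _ => y wy; rewrite z1 ?z2// !mul0r addr0.
  apply: cvgD; apply: cvgM => //; try exact: cc.
  by apply: (@continuous_comp _ _ _ w2 (fun t => t ^+ 2)) => //; exact: exprn_continuous.
- exists [set x | 0 < w x], M, tau; split => // x /= /negP; rewrite -leNgt => wx.
  by rewrite z0 ?z1 ?z2// !mul0r addr0.
Qed.

Definition sqn x := x.1 ^+ 2 + x.2 ^+ 2.
Definition nrm x := Num.sqrt (sqn x).

Lemma is_derive_addl (c : R) : is_derive (0 : R) (1 : R) (fun s : R => c + s) 1.
Proof.
have := is_deriveD (is_derive_cst c (0 : R) (1 : R)) (is_derive_id (0 : R) (1 : R)).
by rewrite add0r.
Qed.

Lemma is_derive_fst1 x : is_derive x e1 (fun y => y.1) (1 : R).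
Proof.
apply: is_derive_of_line => /=; rewrite (_ : (fun _ => _) = (fun s : R => x.1 + s)).
  exact: is_derive_addl.
by apply/funext => s; rewrite /GRing.scale/= mulr1.
Qed.
Lemma is_derive_fst2 x : is_derive x e2 (fun y => y.1) (0 : R).
Proof.
apply: is_derive_of_line => /=; rewrite (_ : (fun _ => _) = (cst x.1)).
  exact: is_derive_cst.
by apply/funext => s; rewrite /GRing.scale/= mulr0 addr0.
Qed.
Lemma is_derive_snd1 x : is_derive x e1 (fun y => y.2) (0 : R).
Proof.
apply: is_derive_of_line => /=; rewrite (_ : (fun _ => _) = (cst x.2)).
  exact: is_derive_cst.
by apply/funext => s; rewrite /GRing.scale/= mulr0 addr0.
Qed.
Lemma is_derive_snd2 x : is_derive x e2 (fun y => y.2) (1 : R).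
Proof.
apply: is_derive_of_line => /=; rewrite (_ : (fun _ => _) = (fun s : R => x.2 + s)).
  exact: is_derive_addl.
by apply/funext => s; rewrite /GRing.scale/= mulr1.
Qed.

Lemma is_derive_sqn1 x : is_derive x e1 sqn (2 * x.1).
Proof.
have h1 := is_derive_fst1 x; have h2 := is_derive_snd1 x.
by apply: is_derive_eq; rewrite /GRing.scale/=; ring.
Qed.
Lemma is_derive_sqn2 x : is_derive x e2 sqn (2 * x.2).
Proof.
have h1 := is_derive_fst2 x; have h2 := is_derive_snd2 x.
by apply: is_derive_eq; rewrite /GRing.scale/=; ring.
Qed.

Lemma sqn_cont : continuous sqn.
Proof.
move=> x; apply: cvgD.
  by apply: (@continuous_comp _ _ _ fst (fun t : R => t ^+ 2)); [exact: cvg_fst|exact: exprn_continuous].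
by apply: (@continuous_comp _ _ _ snd (fun t : R => t ^+ 2)); [exact: cvg_snd|exact: exprn_continuous].
Qed.

Lemma is_derive_sqnpow1 (s : R) x : 0 < sqn x ->
  is_derive x e1 (fun y => sqn y `^ s) (s * sqn x `^ (s - 1) * (2 * x.1)).
Proof.
move=> q0; apply: (is_derive_plane_comp (g := fun t => @powR R t s)); last exact: is_derive_sqn1.
exact: is_derive1_powR.
Qed.
Lemma is_derive_sqnpow2 (s : R) x : 0 < sqn x ->
  is_derive x e2 (fun y => sqn y `^ s) (s * sqn x `^ (s - 1) * (2 * x.2)).
Proof.
move=> q0; apply: (is_derive_plane_comp (g := fun t => @powR R t s)); last exact: is_derive_sqn2.
exact: is_derive1_powR.
Qed.

Lemma sqnpow_cont (s : R) x : 0 < sqn x -> {for x, continuous (fun y => sqn y `^ s)}.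
Proof.
move=> q0; apply: (@continuous_comp _ _ _ sqn (fun t => @powR R t s)); first exact: sqn_cont.
apply: differentiable_continuous; apply/derivable1_diffP.
by have := is_derive1_powR s q0 => ?; exact: ex_derive.
Qed.
End TestFunctions.

(** * The Euclidean norm and its comparison with the sup norm *)

Section Norm.
Context {R : realType}.
Implicit Types (x y : R * R).

Lemma ler_norm_sqr (s t : R) : `|s| <= `|t| -> s ^+ 2 <= t ^+ 2.
Proof.
move=> st; rewrite -[s ^+ 2]real_normK ?num_real// -[t ^+ 2]real_normK ?num_real//.
by rewrite ler_pXn2r ?nnegrE.
Qed.

Lemma sqn_ge0 x : 0 <= sqn x. Proof. by rewrite addr_ge0// sqr_ge0. Qed.
Lemma nrm_ge0 x : 0 <= nrm x. Proof. exact: sqrtr_ge0. Qed.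
Lemma nrm_sqr x : nrm x ^+ 2 = sqn x. Proof. by rewrite sqr_sqrtr// sqn_ge0. Qed.

Lemma nrm_le x (c : R) : 0 <= c -> (nrm x <= c) = (sqn x <= c ^+ 2).
Proof. by move=> c0; rewrite -nrm_sqr ler_pXn2r// nnegrE ?nrm_ge0. Qed.

Lemma nrm_ge1 x : `|x.1| <= nrm x.
Proof.
by rewrite -sqrtr_sqr ler_wsqrtr// /sqn lerDl sqr_ge0.
Qed.
Lemma nrm_ge2 x : `|x.2| <= nrm x.
Proof. by rewrite -sqrtr_sqr ler_wsqrtr// /sqn lerDr sqr_ge0. Qed.

Lemma fst_le_nrm x : x.1 <= nrm x.
Proof. exact: le_trans (ler_norm _) (nrm_ge1 x). Qed.

Lemma norm_le_nrm x : `|x| <= nrm x.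
Proof. by rewrite plane_norm_le nrm_ge1 nrm_ge2. Qed.

Lemma norm_fst x : `|x.1| <= `|x|.
Proof. by have := lexx `|x|; rewrite {1}plane_norm_le => /andP[]. Qed.
Lemma norm_snd x : `|x.2| <= `|x|.
Proof. by have := lexx `|x|; rewrite {1}plane_norm_le => /andP[]. Qed.

Lemma nrm_le_norm x : nrm x <= 2 * `|x|.
Proof.
rewrite nrm_le ?mulr_ge0// /sqn.
have h1 : x.1 ^+ 2 <= `|x| ^+ 2 by apply: ler_norm_sqr; rewrite normr_id norm_fst.
have h2 : x.2 ^+ 2 <= `|x| ^+ 2 by apply: ler_norm_sqr; rewrite normr_id norm_snd.
have := sqr_ge0 `|x|; rewrite exprMn; lra.
Qed.

Lemma nrm_mono x y : `|x.1| <= `|y.1| -> `|x.2| <= `|y.2| -> nrm x <= nrm y.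
Proof.
by move=> h1 h2; rewrite nrm_le ?nrm_ge0// nrm_sqr; apply: lerD; exact: ler_norm_sqr.
Qed.

Lemma nrmD x y : nrm (x + y) <= nrm x + nrm y.
Proof.
have [x0 y0] := (nrm_ge0 x, nrm_ge0 y).
rewrite nrm_le ?addr_ge0//.
(* Cauchy-Schwarz through Lagrange's identity. *)
have cs : x.1 * y.1 + x.2 * y.2 <= nrm x * nrm y.
  have [h|h] := leP (x.1 * y.1 + x.2 * y.2) 0; first by apply: le_trans h _; rewrite mulr_ge0.
  rewrite -(@ler_pXn2r _ 2) ?nnegrE ?(ltW h) ?mulr_ge0//.
  rewrite exprMn !nrm_sqr /sqn -subr_ge0.
  rewrite (_ : _ - _ = (x.1 * y.2 - x.2 * y.1) ^+ 2) ?sqr_ge0//; ring.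
have := nrm_sqr x; have := nrm_sqr y.
rewrite sqrrD /sqn /= => -> ->; move: cs; nra.
Qed.

Lemma nrmN x : nrm (- x) = nrm x. Proof. by rewrite /nrm /sqn /= !sqrrN. Qed.

Lemma nrm_lip x y : `|nrm y - nrm x| <= 2 * `|y - x|.
Proof.
have h (a c : R * R) : nrm a - nrm c <= 2 * `|a - c|.
  have := nrmD c (a - c); rewrite addrC subrK => h1.
  by have := nrm_le_norm (a - c); lra.
rewrite ler_norml; apply/andP; split; last exact: h.
by have := h x y; rewrite -normrN opprB; lra.
Qed.

Lemma nrm_gt0 x : (0 < nrm x) = (0 < sqn x). Proof. by rewrite sqrtr_gt0. Qed.

Lemma nrm0 : nrm (0 : R * R) = 0.
Proof. by rewrite /nrm /sqn /= expr0n addr0 sqrtr0. Qed.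

Lemma nrm_cont : continuous (@nrm R).
Proof.
move=> x; apply: (@continuous_comp _ _ _ sqn (@Num.sqrt R)); first exact: sqn_cont.
exact: sqrt_continuous.
Qed.

Lemma sqn_pow x (s t : R) : t = 2 * s -> sqn x `^ s = nrm x `^ t.
Proof.
by move=> ->; rewrite powRrM -nrm_sqr (@powR_mulrn _ _ 2)// nrm_ge0.
Qed.

Lemma powR_split (r s t : R) : 0 < r -> r `^ (s + t) = r `^ s * r `^ t.
Proof. by move=> r0; rewrite powRD// (gt_eqF r0) implybT. Qed.
End Norm.

(** * The singular barrier at the tip of the sector *)

Section Barrier.
Context {R : realType}.
Local Notation e1 := ((1, 0) : R * R).
Local Notation e2 := ((0, 1) : R * R).
Variables (ep b dl A : R).
Implicit Types x y : R * R.

(* With [r = nrm x] these are the derivatives of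
   [w = A ((x.1 - dl) r^(- 1 - b) + ep r^(- b)) - 1]. For [b = 1] the first summand is
   the Poisson kernel of the half plane shifted by [dl]; for [b] slightly less than
   [1], [w] is subharmonic away from the origin although it is positive in a sector
   of opening larger than [pi]. *)
Let p : R := (1 + b) / 2.
Let c : R := 1 / 2 - p.
Let P (s : R) x := sqn x `^ s.

Let w x := A * ((x.1 - dl) * P (- p) x + ep * P c x) - 1.
Let w1 x := A * (P (- p) x + (x.1 - dl) * (- p * P (- p - 1) x * (2 * x.1))
   + ep * (c * P (c - 1) x * (2 * x.1))).
Let w2 x := A * ((x.1 - dl) * (- p * P (- p - 1) x * (2 * x.2))
   + ep * (c * P (c - 1) x * (2 * x.2))).
Let w11 x := A * (2 * (- p * P (- p - 1) x * (2 * x.1))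
   + (x.1 - dl) * (- p * ((- p - 1) * P (- p - 1 - 1) x * (2 * x.1) * (2 * x.1) + 2 * P (- p - 1) x))
   + ep * (c * ((c - 1) * P (c - 1 - 1) x * (2 * x.1) * (2 * x.1) + 2 * P (c - 1) x))).
Let w22 x := A * (
   (x.1 - dl) * (- p * ((- p - 1) * P (- p - 1 - 1) x * (2 * x.2) * (2 * x.2) + 2 * P (- p - 1) x))
   + ep * (c * ((c - 1) * P (c - 1 - 1) x * (2 * x.2) * (2 * x.2) + 2 * P (c - 1) x))).

Lemma barrier_derivs x : 0 < sqn x ->
  C2_at w w1 w2 w11 w22 x.
Proof.
move=> q0.
have f1 := is_derive_fst1 x; have f2 := is_derive_fst2 x.
have s1 := is_derive_snd1 x; have s2 := is_derive_snd2 x.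
have P1 s : is_derive x e1 (P s) (s * P (s - 1) x * (2 * x.1)) := is_derive_sqnpow1 s q0.
have P2 s : is_derive x e2 (P s) (s * P (s - 1) x * (2 * x.2)) := is_derive_sqnpow2 s q0.
have conts : [/\ {for x, continuous w}, {for x, continuous w1}, {for x, continuous w2},
         {for x, continuous w11} & {for x, continuous w22}].
  pose C (f : R * R -> R) : Prop := {for x, continuous f}.
  have cP s : C (P s) := @sqnpow_cont R s x q0.
  have cf : C (fun y : R * R => y.1) by exact: cvg_fst.
  have cs : C (fun y : R * R => y.2) by exact: cvg_snd.
  have ck (k : R) : C (fun y : R * R => k) by exact: cvg_cst.
  have cM (f g : R * R -> R) : C f -> C g -> C (fun y => f y * g y) by exact: cvgM.
  have cD (f g : R * R -> R) : C f -> C g -> C (fun y => f y + g y) by exact: cvgD.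
  have CE f : C f -> {for x, continuous f} by [].
  split; apply: CE; move: C cP cf cs ck cM cD => C cP cf cs ck cM cD;
    rewrite /w /w1 /w2 /w11 /w22;
    repeat first [apply ck | apply cf | apply cs | apply cP | apply cD | apply cM].
split.
- by apply: is_derive_eq; rewrite /w1 /GRing.scale/=; ring.
- by apply: is_derive_eq; rewrite /w2 /GRing.scale/=; ring.
- by apply: is_derive_eq; rewrite /w11 /GRing.scale/=; ring.
- by apply: is_derive_eq; rewrite /w22 /GRing.scale/=; ring.
- exact: conts.
Qed.

Lemma barrier_E x : 0 < nrm x ->
  w x = A * nrm x `^ (- (1 + b)) * (x.1 + ep * nrm x - dl) - 1.
Proof.
move=> r0; rewrite /w /P (@sqn_pow _ _ (- p) (- (1 + b))); last by rewrite /p; lra.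
rewrite (@sqn_pow _ _ c (- (1 + b) + 1)); last by rewrite /c /p; lra.
by rewrite powR_split// powRr1 ?(ltW r0)//; ring.
Qed.

(** In polar coordinates [r^m cos theta] has Laplacian [(m^2 - 1) r^(m - 2) cos theta] and [r^m] has
    [m^2 r^(m - 2)]. With [m = - b] the first summand costs [1 - b ^+ 2] and the [ep] term pays
    [ep * b ^+ 2]; the shift [dl], with [m = - (1 + b)], costs [(1 + b) ^+ 2 * dl]. *)
Lemma barrier_laplacian x : 0 < nrm x ->
  w11 x + w22 x = A * nrm x `^ (- (3 + b)) *
    (- (1 - b ^+ 2) * x.1 + ep * b ^+ 2 * nrm x - (1 + b) ^+ 2 * dl).
Proof.
move=> r0; rewrite /w11 /w22 /P.
set X := nrm x `^ (- (3 + b)).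
have E2 : sqn x `^ (- p - 1) = X by apply: sqn_pow; rewrite /p; lra.
have E3 : sqn x * sqn x `^ (- p - 1 - 1) = X.
  rewrite (@sqn_pow _ _ (- p - 1 - 1) (- (3 + b) - 2)); last by rewrite /p; lra.
  rewrite powR_split// -/X powRN (@powR_mulrn _ _ 2) ?(ltW r0)// nrm_sqr.
  by field; rewrite gt_eqF// -nrm_gt0.
have E4 : sqn x `^ (c - 1) = nrm x * X.
  rewrite (@sqn_pow _ _ (c - 1) (- (3 + b) + 1)); last by rewrite /c /p; lra.
  by rewrite powR_split// powRr1 ?(ltW r0)// mulrC.
have E5 : sqn x * sqn x `^ (c - 1 - 1) = nrm x * X.
  rewrite (@sqn_pow _ _ (c - 1 - 1) (- (3 + b) + 1 - 2)); last by rewrite /c /p; lra.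
  rewrite powR_split// powR_split// -/X powRr1 ?(ltW r0)// powRN (@powR_mulrn _ _ 2) ?(ltW r0)// nrm_sqr.
  by field; rewrite gt_eqF// -nrm_gt0.
set Y := sqn x `^ (- p - 1 - 1) in E3 *; set Z := sqn x `^ (c - 1 - 1) in E5 *.
rewrite E2 E4.
transitivity (A * (- p * (4 * X * x.1 + (x.1 - dl) * ((- p - 1) * 4 * (sqn x * Y) + 4 * X)) +
   ep * c * ((c - 1) * 4 * (sqn x * Z) + 4 * (nrm x * X)))); first by rewrite /sqn; ring.
by rewrite E3 E5 /c /p; field.
Qed.

Hypotheses (ep01 : 0 < ep <= 1) (b01 : 15 / 16 <= b < 1).
Hypotheses (bep : 1 + ep / 4 <= b ^+ 2 * (1 + ep)) (dl0 : 0 < dl) (A0 : 0 < A).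

(** A power of [0] with nonzero exponent is [0] by convention, so [w] takes the harmless value [- 1]
    at its singularity. *)
Lemma barrier_at0 x : nrm x = 0 -> w x = - 1.
Proof.
move=> r0; have q0 : sqn x = 0 by rewrite -nrm_sqr r0 expr0n.
rewrite /w /P q0 !powR0; first by ring.
- by rewrite lt_eqF// /c /p; case/andP: b01; lra.
- by rewrite lt_eqF// /p; case/andP: b01; lra.
Qed.

(** Since [x.1 + ep * nrm x - dl <= 2 * nrm x], positivity of [w] forces [1 < 2 A r^(- b)], hence
    [r < R0]. The factor [x.1 + ep * nrm x - dl] must be positive too, which keeps the support away
    from the tip and the sides. *)
Lemma barrier_support (R0 : R) x : 0 < R0 -> 2 * A <= R0 `^ b -> 0 < w x ->
  [/\ 0 < nrm x, dl < x.1 + ep * nrm x & nrm x < R0].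
Proof.
move=> R00 AR wx.
have r0 : 0 < nrm x.
  rewrite lt_neqAle nrm_ge0 andbT eq_sym; apply/eqP => /barrier_at0 wE.
  by move: wx; rewrite wE; lra.
have X0 : 0 < nrm x `^ (- (1 + b)) by exact: powR_gt0.
have px : 1 < A * nrm x `^ (- (1 + b)) * (x.1 + ep * nrm x - dl).
  by move: wx; rewrite barrier_E//; lra.
have Ax0 : 0 < A * nrm x `^ (- (1 + b)) by exact: mulr_gt0.
have dlx : dl < x.1 + ep * nrm x.
  rewrite -subr_gt0 -(pmulr_rgt0 _ Ax0); lra.
split => //.
have x1r : x.1 + ep * nrm x - dl <= 2 * nrm x.
  have := dl0; have := fst_le_nrm x.
  move=> xr1 dl0'; have : ep * nrm x <= 1 * nrm x.
    by rewrite ler_wpM2r ?nrm_ge0//; case/andP: ep01.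
  lra.
have h : 1 < 2 * A * nrm x `^ (- b).
  move: px; rewrite (_ : - b = - (1 + b) + 1); last by ring.
  rewrite powR_split// powRr1 ?(ltW r0)//.
  have : A * nrm x `^ (- (1 + b)) * (x.1 + ep * nrm x - dl) <=
         A * nrm x `^ (- (1 + b)) * (2 * nrm x).
    by apply: ler_wpM2l => //; exact: ltW.
  lra.
have rb : nrm x `^ b < R0 `^ b.
  apply: lt_le_trans AR; move: h; rewrite powRN ltr_pdivlMr ?powR_gt0//.
  by rewrite mul1r.
rewrite ltNge; apply/negP => R0r; move: rb; rewrite ltNge => /negP; apply.
have b0 : 0 <= b by case/andP: b01; lra.
by apply: ge0_ler_powR => //; rewrite nnegrE ?nrm_ge0 ?(ltW R00).
Qed.

(** The hypothesis [bep] says [ep * b ^+ 2 - (1 - b ^+ 2) >= ep / 4]: even at [x.1 = nrm x], the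
    worst case, the [ep] term outweighs the loss due to [b < 1]. *)
Lemma barrier_laplacian_ge x : 0 < nrm x ->
  A * nrm x `^ (- (3 + b)) * (ep * nrm x / 4 - 4 * dl) <= w11 x + w22 x.
Proof.
move=> r0; rewrite barrier_laplacian// ler_wpM2l ?mulr_ge0 ?powR_ge0 ?(ltW A0)//.
move: ep01 b01 => /andP[ep0 ep1] /andP[b0 b1].
have x1r := fst_le_nrm x.
have b2 : 0 <= 1 - b ^+ 2 by rewrite subr_ge0 exprn_ile1//; lra.
have h1 : (1 - b ^+ 2) * x.1 <= (1 - b ^+ 2) * nrm x by rewrite ler_wpM2l.
have h2 : (1 + b) ^+ 2 * dl <= 4 * dl by rewrite ler_wpM2r ?(ltW dl0)// (_ : 4 = 2 ^+ 2) ?ler_pXn2r ?nnegrE//; lra.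
have h3 : (ep / 4) * nrm x <= (b ^+ 2 * (1 + ep) - 1) * nrm x.
  by rewrite ler_wpM2r ?(ltW r0)//; have := bep; lra.
lra.
Qed.

(** The test function is [G0 (w)], with Laplacian at least [G1 (w) (w11 + w22)]. From radius
    [32 * dl / ep] on, half of the gain [ep * nrm x / 4] absorbs [4 * dl]; inside this core the
    Laplacian may be negative, but the support stays at distance [dl / 2] from the tip, which bounds
    the deficit. The last estimate concerns [w >= 1], where [G1 >= 3]. *)
Lemma barrier (O : set (R * R)) (R0 tau : R) :
  0 < R0 -> 0 < tau -> 2 * A <= R0 `^ b ->
  (forall x, dl < x.1 + ep * nrm x -> nrm x < R0 -> forall y, `|y - x| < tau -> O y) ->
  exists T T1 T2 T11 T22, [/\ test_fun O T T1 T2 T11 T22,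
    forall x, [/\ 0 <= T x, T x <= 12 * A * nrm x `^ (- b) &
      ~ (dl < x.1 + ep * nrm x /\ nrm x < R0) -> T x = 0 /\ T11 x + T22 x = 0],
    forall x, 32 * dl / ep <= nrm x -> 0 <= T11 x + T22 x,
    forall x, - (24 * A * dl * (dl / 2) `^ (- (3 + b))) <= T11 x + T22 x &
    forall x, 32 * dl / ep <= nrm x ->
      2 <= A * nrm x `^ (- (1 + b)) * (x.1 + ep * nrm x - dl) ->
      3 / 8 * ep * A * nrm x `^ (- (2 + b)) <= T11 x + T22 x].
Proof.
move=> R00 tau0 AR SO; have supp x := @barrier_support R0 x R00 AR.
have ep0 : 0 < ep by case/andP: ep01.
have tf : test_fun O (fun x => G0 (w x)) (fun x => G1 (w x) * w1 x) (fun x => G1 (w x) * w2 x)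
    (fun x => G2 (w x) * w1 x ^+ 2 + G1 (w x) * w11 x)
    (fun x => G2 (w x) * w2 x ^+ 2 + G1 (w x) * w22 x).
  apply: (@compose_test_fun _ O w w1 w2 w11 w22 R0 tau tau0); last first.
    move=> x /supp[_ dx xR]; split; last exact: SO.
    by apply: le_trans (norm_le_nrm x) (ltW xR).
  move=> x; have [q0|q0] := ltP 0 (sqn x); first by right; exact: barrier_derivs.
  (* At sup distance below [dl / 4] from the origin, [x.1 + ep * nrm x <= 2 * nrm x < dl], so [w]
     cannot be positive. *)
  left; exists (dl / 4); first by rewrite divr_gt0.
  move=> y yx; rewrite leNgt; apply/negP => /supp[ry dy _].
  have rx : nrm x = 0.
    by apply/eqP; rewrite eq_le nrm_ge0 andbT nrm_le ?expr0n.
  have := nrm_lip x y; rewrite rx subr0 (gtr0_norm ry) => h.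
  have : y.1 <= nrm y by apply: le_trans (ler_norm _) (nrm_ge1 y).
  have : ep * nrm y <= 1 * nrm y by rewrite ler_wpM2r ?nrm_ge0//; case/andP: ep01.
  lra.
have lap x : G1 (w x) * (w11 x + w22 x) <= (G2 (w x) * w1 x ^+ 2 + G1 (w x) * w11 x) +
    (G2 (w x) * w2 x ^+ 2 + G1 (w x) * w22 x).
  have [_ _ _ g2] := G_bounds (w x).
  have := mulr_ge0 g2 (sqr_ge0 (w1 x)); have := mulr_ge0 g2 (sqr_ge0 (w2 x)); lra.
have far x : 32 * dl / ep <= nrm x -> 0 < nrm x /\
    A * nrm x `^ (- (2 + b)) * ep / 8 <= w11 x + w22 x.
  move=> xr; have r0 : 0 < nrm x by apply: lt_le_trans xr; rewrite divr_gt0// mulr_gt0.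
  split => //; apply: le_trans (barrier_laplacian_ge r0).
  rewrite (_ : - (2 + b) = - (3 + b) + 1); last by ring.
  rewrite powR_split// powRr1 ?(ltW r0)//.
  have : A * nrm x `^ (- (3 + b)) * (nrm x * ep / 8) <=
         A * nrm x `^ (- (3 + b)) * (ep * nrm x / 4 - 4 * dl).
    apply: ler_wpM2l; first by rewrite mulr_ge0 ?powR_ge0 ?(ltW A0).
    by move: xr; rewrite ler_pdivrMr//; lra.
  lra.
do 5 eexists; split; first exact: tf.
- move=> x; have [g0 g0' _ _] := G_bounds (w x); split => //.
    have [wx|wx] := leP (w x) 0.
      by have [-> _ _] := G_le0 wx; rewrite !mulr_ge0 ?powR_ge0// ltW.
    have [r0 dx _] := supp x wx.
    apply: le_trans g0' _; rewrite pos_id ?(ltW wx)// barrier_E//.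
    rewrite (_ : - b = - (1 + b) + 1); last by ring.
    rewrite powR_split// powRr1 ?(ltW r0)//.
    have x1r : x.1 + ep * nrm x - dl <= 2 * nrm x.
      have := dl0; have := fst_le_nrm x.
  move=> xr1 dl0'; have : ep * nrm x <= 1 * nrm x.
        by rewrite ler_wpM2r ?nrm_ge0//; case/andP: ep01.
      lra.
    have : A * nrm x `^ (- (1 + b)) * (x.1 + ep * nrm x - dl) <=
           A * nrm x `^ (- (1 + b)) * (2 * nrm x).
      by rewrite ler_wpM2l ?mulr_ge0 ?powR_ge0 ?(ltW A0).
    lra.
  move=> nsupp; have wx : w x <= 0 by rewrite leNgt; apply/negP => /supp[_ ? ?]; apply: nsupp.
  by have [-> -> ->] := G_le0 wx; rewrite !mul0r !addr0.
- move=> x /far[r0 h]; apply: le_trans (lap x).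
  have [_ _ /andP[g1 _] _] := G_bounds (w x); apply: mulr_ge0 => //.
  by apply: le_trans h; rewrite !mulr_ge0 ?powR_ge0 ?invr_ge0// ltW.
- move=> x; apply: le_trans (lap x).
  have D0 : 0 <= A * dl * (dl / 2) `^ (- (3 + b)).
    by rewrite !mulr_ge0 ?powR_ge0// ltW.
  have [wx|wx] := leP (w x) 0.
    by have [_ -> _] := G_le0 wx; rewrite mul0r; lra.
  have [r0 dx _] := supp x wx.
  have r2 : dl / 2 < nrm x.
    have := dl0; have := fst_le_nrm x.
  move=> xr1 dl0'; have : ep * nrm x <= 1 * nrm x.
      by rewrite ler_wpM2r ?nrm_ge0//; case/andP: ep01.
    lra.
  have rp : nrm x `^ (- (3 + b)) <= (dl / 2) `^ (- (3 + b)).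
    rewrite !powRN lef_pV2 ?posrE ?powR_gt0 ?divr_gt0//.
    have b0 : 0 <= 3 + b by case/andP: b01; lra.
    have d0 : 0 <= dl / 2 by have := dl0; lra.
    by apply: ge0_ler_powR => //; rewrite ?nnegrE ?nrm_ge0 ?(ltW r2).
  have l1 : - (4 * A * dl * (dl / 2) `^ (- (3 + b))) <= w11 x + w22 x.
    apply: le_trans (barrier_laplacian_ge r0).
    have h1 : A * nrm x `^ (- (3 + b)) * (- (4 * dl)) <=
        A * nrm x `^ (- (3 + b)) * (ep * nrm x / 4 - 4 * dl).
      rewrite ler_wpM2l ?mulr_ge0 ?powR_ge0 ?(ltW A0)//.
      have := mulr_ge0 (ltW ep0) (ltW r0); lra.
    have h2 : A * nrm x `^ (- (3 + b)) * (4 * dl) <= A * (dl / 2) `^ (- (3 + b)) * (4 * dl).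
      by rewrite ler_wpM2r ?mulr_ge0 ?(ltW dl0)// ler_wpM2l// ltW.
    lra.
  have [_ _ /andP[g1 g6] _] := G_bounds (w x).
  have [l0|l0] := leP 0 (w11 x + w22 x).
    by apply: le_trans (mulr_ge0 g1 l0); lra.
  (* Where [w] is superharmonic the worst factor is the maximum [6] of [G1]; with the [4] of the
     Laplacian bound this gives [24]. *)
  have : (6 - G1 (w x)) * (w11 x + w22 x) <= 0 by apply: mulr_ge0_le0; [lra|exact: ltW].
  lra.
- move=> x /far[r0 h] wx; apply: le_trans (lap x).
  have g3 : 3 <= G1 (w x) by apply: G1_ge3; rewrite barrier_E//; lra.
  have h0 : 0 <= A * nrm x `^ (- (2 + b)) * ep / 8.
    by rewrite !mulr_ge0 ?powR_ge0 ?invr_ge0// ltW.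
  apply: (@le_trans _ _ (3 * (A * nrm x `^ (- (2 + b)) * ep / 8))); first lra.
  by apply: ler_pM.
Qed.
End Barrier.

(** * The solution near the slit *)

Section SlitSolution.
Context {R : realType}.
Local Notation mu2 := (@lebesgue_measure R \x @lebesgue_measure R)%E.
Local Notation e1 := ((1, 0) : R * R).
Local Notation e2 := ((0, 1) : R * R).
Implicit Types x y v : R * R.

(* The part of the unit disc in the sector: [cos theta > - cos a] with [k = cos a]. *)
Definition Om (k : R) : set (R * R) := [set x | - k * nrm x < x.1 /\ nrm x < 1].

(** The working form of the hypotheses: [k] is the cosine of [a], [L] a sup-norm Lipschitz constant
    of the gradient, and [u1], [u2] are the partial derivatives. *)
Record slit_solution (k L : R) (u u1 u2 : R * R -> R) : Prop := SlitSolution {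
  ss_k : 0 < k < 1 ;
  ss_L : 0 < L ;
  ss_d : forall x, nrm x < 1 ->
    [/\ is_derive x e1 u (u1 x), is_derive x e2 u (u2 x) &
     [/\ {for x, continuous u}, {for x, continuous u1} & {for x, continuous u2}]] ;
  ss_lip : forall x y, nrm x < 1 -> nrm y < 1 ->
     `|u1 x - u1 y| <= L * `|x - y| /\ `|u2 x - u2 y| <= L * `|x - y| ;
  ss_conv : forall x y (t : R), nrm x < 1 -> nrm y < 1 -> 0 <= t <= 1 ->
     u (t *: x + (1 - t) *: y) <= t * u x + (1 - t) * u y ;
  ss_ge0 : forall x, nrm x < 1 -> 0 <= u x ;
  ss_zero : forall t, -1 < t < 0 -> u (t, 0) = 0 ;
  ss_lap : {ae mu2, forall x, Om k x -> exists d1 d2,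
    [/\ is_derive x e1 u1 d1, is_derive x e2 u2 d2 & d1 + d2 = 1]} }.

Lemma nrmZ (t : R) x : nrm (t *: x) = `|t| * nrm x.
Proof.
rewrite /nrm /sqn /= /GRing.scale/= !exprMn -mulrDr sqrtrM ?sqr_ge0//.
by rewrite sqrtr_sqr.
Qed.

Lemma nrm_e1 (h : R) : nrm (h *: e1) = `|h|.
Proof. by rewrite nrmZ /nrm /sqn /= expr1n expr0n addr0 sqrtr1 mulr1. Qed.

Lemma nrm_e2 (h : R) : nrm (h *: e2) = `|h|.
Proof. by rewrite nrmZ /nrm /sqn /= expr1n expr0n add0r sqrtr1 mulr1. Qed.

Lemma norm_e1 : `|e1| = 1.
Proof. by rewrite prod_normE/= normr1 normr0 max_l. Qed.
Lemma norm_e2 : `|e2| = 1.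
Proof. by rewrite prod_normE/= normr1 normr0 max_r. Qed.

Lemma norm_e1D (s : R) x : `|x + s *: e1| <= `|x| + `|s|.
Proof. by apply: le_trans (ler_normD _ _) _; rewrite normrZ norm_e1 mulr1. Qed.
Lemma norm_e2D (s : R) x : `|x + s *: e2| <= `|x| + `|s|.
Proof. by apply: le_trans (ler_normD _ _) _; rewrite normrZ norm_e2 mulr1. Qed.

Section Facts.
Variables (k L : R) (u u1 u2 : R * R -> R).
Hypothesis ss : slit_solution k L u u1 u2.

(** A shift to the right by [h] adds [h] to [x.1] and lowers [k * nrm x] by at most [k * h < h]. *)
Lemma Om_shift x (h : R) : 0 <= h -> Om k x -> nrm x + h < 1 -> Om k (x + h *: e1).
Proof.
move=> h0 [x1 xn] xh; have /andP[k0 k1] := ss_k ss; split; last first.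
  by apply: le_lt_trans (nrmD _ _) _; rewrite nrm_e1 ger0_norm.
rewrite /= /GRing.scale/= mulr1.
have := nrmD (x + h *: e1) (- (h *: e1)); rewrite addrK nrmN nrm_e1 ger0_norm// => hn.
have : k * nrm x <= k * (nrm (x + h *: e1) + h) by rewrite ler_wpM2l// ltW.
have : k * h <= 1 * h by rewrite ler_wpM2r// ltW.
rewrite /= /GRing.scale/=; lra.
Qed.

(** A zero of the nonnegative [u] is an interior minimum. *)
Lemma u_zero_grad x : nrm x < 1 -> u x = 0 -> u1 x = 0 /\ u2 x = 0.
Proof.
move=> xn ux.
have aux v (d : R * R -> R) : (forall t : R, nrm (t *: v) = `|t|) ->
   (forall y, nrm y < 1 -> is_derive y v u (d y)) -> d x = 0.
  move=> vn ud; pose t := 1 - nrm x.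
  have t0 : 0 < t by rewrite subr_gt0.
  have inB s : `|s| < t -> nrm (x + s *: v) < 1.
    by move=> st; apply: le_lt_trans (nrmD _ _) _; rewrite vn; move: st; rewrite /t; lra.
  have dx : is_derive (0 : R) (1 : R) (fun s => u (x + s *: v)) (d x).
    by apply: is_derive_line; rewrite scale0r addr0; exact: ud.
  have := @derive1_at_min R (fun s => u (x + s *: v)) (- t) t 0.
  move=> h; have {h} : is_derive (0 : R) (1 : R) (fun s => u (x + s *: v)) 0.
    apply: h; first by lra.
    - move=> s; rewrite in_itv/= -ltr_norml => st.
      have h : is_derive s (1 : R) (fun s => u (x + s *: v)) (d (x + s *: v)).
        by apply: is_derive_line; exact/ud/inB.
      exact: ex_derive.
    - by rewrite in_itv/= oppr_lt0 t0.
    - move=> s; rewrite in_itv/= -ltr_norml => st.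
      by rewrite scale0r addr0 ux; apply: (ss_ge0 ss); exact: inB.
  by move=> [_ <-]; rewrite (@derive_val _ _ _ _ _ _ _ dx).
split; [apply: (aux e1 u1)|apply: (aux e2 u2)].
- exact: nrm_e1.
- by move=> y /(ss_d ss)[].
- exact: nrm_e2.
- by move=> y /(ss_d ss)[].
Qed.

(** The origin is only an endpoint of the open slit, so its value comes from continuity. *)
Lemma u_at0 : u 0 = 0.
Proof.
have nrm01 : nrm (0 : R * R) < 1 by rewrite nrm0.
have [_ _ [cu _ _]] := ss_d ss nrm01.
have [->//|un0] := eqVneq (u 0) 0; exfalso.
have u0 : 0 < u 0 by rewrite lt_neqAle eq_sym un0 (ss_ge0 ss).
have : \forall y \near (0 : R * R), 0 < u y by move/cvgr_gt: cu; exact.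
move=> /nbhs_ballP[e /= e0 eP].
pose t : R := - Num.min (e / 2) (1 / 2).
have m0 : 0 < Num.min (e / 2) (1 / 2) by rewrite lt_min !divr_gt0.
have m1 : Num.min (e / 2) (1 / 2) <= 1 / 2 by rewrite ge_min lexx orbT.
have m2 : Num.min (e / 2) (1 / 2) <= e / 2 by rewrite ge_min lexx.
have := eP (t, 0); rewrite (ss_zero ss) ?ltxx; last by rewrite /t; apply/andP; split; lra.
move=> h; suff: false by []; apply: h; rewrite -ball_normE/= sub0r normrN.
apply: (@le_lt_trans _ _ (e / 2)); last lra.
by rewrite plane_norm_le/= normr0 /t normrN gtr0_norm// m2; lra.
Qed.

Lemma u_grad_le x : nrm x < 1 -> `|u1 x| <= L * `|x| /\ `|u2 x| <= L * `|x|.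
Proof.
move=> xn; have nrm01 : nrm (0 : R * R) < 1 by rewrite nrm0.
have [g1 g2] := u_zero_grad nrm01 u_at0.
by have := ss_lip ss xn nrm01; rewrite g1 g2 !subr0.
Qed.

Lemma u_bounds x : nrm x < 1 -> [/\ `|u x| <= 2 * L, `|u1 x| <= 2 * L & `|u2 x| <= 2 * L].
Proof.
move=> xn; have [g1 g2] := u_grad_le xn; have L0 := ss_L ss.
have nx1 y : nrm y < 1 -> `|y| <= 1 by move=> yn; apply: le_trans (norm_le_nrm y) (ltW yn).
have gL y : nrm y < 1 -> `|u1 y| <= L /\ `|u2 y| <= L.
  move=> yn; have [h1 h2] := u_grad_le yn.
  have : L * `|y| <= L by rewrite ler_piMr ?nx1// ltW.
  by move=> yL; split; exact: le_trans yL.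
have [l1 l2] := gL _ xn.
split; [|lra|lra].
have s1 (s : R) : `|s| <= `|x.1| -> nrm ((0 : R * R) + s *: e1) < 1.
  by move=> sx; rewrite add0r nrm_e1; apply: le_lt_trans sx _; exact: le_lt_trans (nrm_ge1 x) xn.
have s2 (s : R) : `|s| <= `|x.2| -> nrm (x.1 *: e1 + s *: e2) < 1.
  move=> sx; apply: le_lt_trans xn; rewrite nrm_le ?nrm_ge0// nrm_sqr /sqn /= /GRing.scale/=.
  by rewrite !mulr1 !mulr0 addr0 add0r lerD2l ler_norm_sqr.
have a1 : `|u (0 + x.1 *: e1) - u 0| <= L * `|x.1|.
  apply: (@dir_lip _ u u1) => s /s1 sn; split; last by have [] := gL _ sn.
  by have [] := ss_d ss sn.
have a2 : `|u (x.1 *: e1 + x.2 *: e2) - u (x.1 *: e1)| <= L * `|x.2|.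
  apply: (@dir_lip _ u u2) => s /s2 sn; split; last by have [] := gL _ sn.
  by have [] := ss_d ss sn.
have xE : x.1 *: e1 + x.2 *: e2 = x.
  by apply: injective_projections; rewrite /= /GRing.scale/=; ring.
move: a1 a2; rewrite xE add0r u_at0 subr0 => a1 a2.
have b1 : L * `|x.1| <= L.
  by rewrite ler_piMr ?(ltW L0)//; apply: le_trans (nrm_ge1 x) (ltW xn).
have b2 : L * `|x.2| <= L.
  by rewrite ler_piMr ?(ltW L0)//; apply: le_trans (nrm_ge2 x) (ltW xn).
have := ler_normD (u x - u (x.1 *: e1)) (u (x.1 *: e1)); rewrite subrK; lra.
Qed.

(** The point [x] lies on the horizontal segment from [(- 3 / 4, x.2)] to [x + h *: e1]. At the left
    end [u] is at most [L * x.2 ^+ 2], because [u] and its gradient vanish on the slit below or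
    above it; convexity then bounds [u x - u (x + h *: e1)]. *)
Lemma u_slope_ge x (h : R) : nrm x < 1 / 2 -> 0 < h < 1 / 4 ->
  0 <= u (x + h *: e1) - u x + h * (4 * L) * x.2 ^+ 2.
Proof.
move=> xn /andP[h0 h4]; have L0 := ss_L ss.
have x1b : `|x.1| < 1 / 2 := le_lt_trans (nrm_ge1 x) xn.
have x2b : `|x.2| < 1 / 2 := le_lt_trans (nrm_ge2 x) xn.
(* This slit point is at least [1 / 4] to the left of every [x] with [nrm x < 1 / 2], and the
   vertical segment from it to height [x.2] stays in the unit disc. *)
pose p0 : R * R := (- (3 / 4), 0).
have pn (s : R) : `|s| <= `|x.2| -> nrm (p0 + s *: e2) < 1.
  move=> sx; have s2 : `|s| < 1 / 2 by exact: le_lt_trans sx x2b.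
  rewrite -[ltRHS]sqrtr1 ltr_sqrt//.
  have -> : sqn (p0 + s *: e2) = (3 / 4) ^+ 2 + s ^+ 2.
    by rewrite /sqn /p0 /= /GRing.scale/=; ring.
  have : s ^+ 2 <= (1 / 2) ^+ 2.
    by rewrite -[s ^+ 2]real_normK ?num_real// ler_pXn2r ?nnegrE// ltW.
  by rewrite !expr2; lra.
have p0n : nrm p0 < 1 by have := pn 0; rewrite scale0r addr0 normr0; apply.
have up0 : u p0 = 0 by apply: (ss_zero ss); apply/andP; split; lra.
have [_ g2] := u_zero_grad p0n up0.
have [|c cx uc] := @dir_MVT _ u u2 p0 e2 x.2.
  by move=> s sx; have [] := ss_d ss (pn s sx).
have uq : u (p0 + x.2 *: e2) <= L * x.2 ^+ 2.
  have -> : u (p0 + x.2 *: e2) = u2 (p0 + c *: e2) * x.2 by rewrite -uc up0 subr0.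
  apply: le_trans (ler_norm _) _; rewrite normrM -[x.2 ^+ 2]real_normK ?num_real// expr2 mulrA.
  apply: ler_wpM2r => //.
  have [_] := ss_lip ss (pn c cx) p0n; rewrite g2 subr0 [p0 + _ - p0]addrC addKr normrZ norm_e2 mulr1.
  by move=> h'; apply: le_trans h' _; apply: ler_wpM2l => //; exact: ltW.
(* [la] is the weight of the left end; the horizontal gap of at least [1 / 4] gives [la <= 4 * h],
   the origin of the constant in [Vd]. *)
pose la := h / (x.1 + 3 / 4 + h).
have den : 0 < x.1 + 3 / 4 + h by move: x1b; rewrite ltr_norml => /andP[]; lra.
have den4 : 1 / 4 <= x.1 + 3 / 4 + h by move: x1b; rewrite ltr_norml => /andP[]; lra.
have la0 : 0 <= la by rewrite divr_ge0// ltW.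
have la1 : la <= 1 by rewrite ler_pdivrMr// mul1r; lra.
have la4 : la <= 4 * h by rewrite ler_pdivrMr//; nra.
have xE : la *: (p0 + x.2 *: e2) + (1 - la) *: (x + h *: e1) = x.
  have laD : la * (x.1 + 3 / 4 + h) = h by rewrite /la divfK// gt_eqF.
  apply: injective_projections; rewrite /= /GRing.scale/=; last by ring.
  by move: laD; lra.
have xhn : nrm (x + h *: e1) < 1.
  by apply: le_lt_trans (nrmD _ _) _; rewrite nrm_e1 gtr0_norm//; lra.
have la01 : 0 <= la <= 1 by rewrite la0.
have := ss_conv ss (pn _ (lexx _)) xhn la01; rewrite xE => cv.
have u0 := ss_ge0 ss xhn.
have t1 : la * u (p0 + x.2 *: e2) <= 4 * h * (L * x.2 ^+ 2).
  apply: le_trans (ler_wpM2l la0 uq) _; apply: ler_wpM2r => //.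
  by rewrite mulr_ge0 ?sqr_ge0// ltW.
have t2 : 0 <= la * u (x + h *: e1) by exact: mulr_ge0.
lra.
Qed.

Lemma u_slope_le x (h : R) : 0 < h -> nrm x + h < 1 ->
  `|u (x + h *: e1) - u x| <= h * L * (`|x| + h).
Proof.
move=> h0 xh; have L0 := ss_L ss.
rewrite [leRHS](_ : _ = L * (`|x| + h) * `|h|); last by rewrite gtr0_norm//; ring.
apply: (@dir_lip _ u u1) => s; rewrite (gtr0_norm h0) => sh.
have sn : nrm (x + s *: e1) < 1.
  by apply: le_lt_trans (nrmD _ _) _; rewrite nrm_e1; lra.
split; first by have [] := ss_d ss sn.
have [h1 _] := u_grad_le sn; apply: le_trans h1 _; apply: ler_wpM2l; first exact: ltW.
by apply: le_trans (norm_e1D _ _) _; lra.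
Qed.

Lemma u_second_diff_ge0 x (h : R) : 0 <= h -> nrm x + 2 * h < 1 ->
  0 <= u (x + (2 * h) *: e1) - 2 * u (x + h *: e1) + u x.
Proof.
move=> h0 xh; have xn : nrm x < 1 by lra.
have x2n : nrm (x + (2 * h) *: e1) < 1.
  by apply: le_lt_trans (nrmD _ _) _; rewrite nrm_e1 ger0_norm ?mulr_ge0.
have t01 : 0 <= (1 / 2 : R) <= 1 by apply/andP; split; lra.
have := ss_conv ss x2n xn t01.
have -> : (1 / 2) *: (x + (2 * h) *: e1) + (1 - 1 / 2) *: x = x + h *: e1.
  by apply: injective_projections; rewrite /= /GRing.scale/=; field.
lra.
Qed.

Lemma green_u T T1 T2 T11 T22 : test_fun (Om k) T T1 T2 T11 T22 ->
  I2 (fun x => u x * (T11 x + T22 x)) = I2 T.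
Proof.
move=> tf; rewrite (@green _ (Om k) u u1 u2 1 (2 * L + L) _ _ _ _ _ tf) ?mul1r//.
- by move=> x [_ /(ss_d ss)].
- move=> x [_ xn]; have L0 := ss_L ss; have [h1 h2 h3] := u_bounds xn.
  by split; lra.
- move=> x y [_ xn] [_ yn]; have [h1 h2] := ss_lip ss xn yn; have L0 := ss_L ss.
  have : 0 <= 2 * L * `|x - y| by rewrite !mulr_ge0// ltW.
  by rewrite mulrDl; split; lra.
- exact: ss_lap ss.
Qed.

Lemma green_sqr T T1 T2 T11 T22 : test_fun (Om k) T T1 T2 T11 T22 ->
  I2 (fun x => x.2 ^+ 2 * (T11 x + T22 x)) = 2 * I2 T.
Proof.
move=> tf.
have n1 x : Om k x -> `|x.2| <= 1 by move=> [_ xn]; apply: le_trans (nrm_ge2 x) (ltW xn).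
have cs : continuous (fun x : R * R => x.2) by move=> x; exact: cvg_snd.
rewrite (@green _ (Om k) (fun x => x.2 ^+ 2) (cst 0) (fun x => 2 * x.2) 2 2 _ _ _ _ _ tf)//.
- move=> x Ox; have s1 := is_derive_snd1 x; have s2 := is_derive_snd2 x; split.
  + by apply: is_derive_eq; rewrite /GRing.scale/=; ring.
  + by apply: is_derive_eq; rewrite /GRing.scale/=; ring.
  + split; [|exact: cvg_cst|by apply: cvgM; [exact: cvg_cst|exact: cs]].
    by apply: (@continuous_comp _ _ _ snd (fun t : R => t ^+ 2)); [exact: cvg_snd|exact: exprn_continuous].
- move=> x /n1 xn; have x2 : `|x.2| ^+ 2 <= 1 by rewrite exprn_ile1.
  split; first by rewrite normrX; lra.
    by rewrite normr0.
  by rewrite normrM (ger0_norm (_ : 0 <= 2))//; lra.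
- move=> x y _ _; rewrite subrr normr0 -mulrBr normrM (ger0_norm (_ : 0 <= 2))//.
  by split; [rewrite mulr_ge0|apply: ler_wpM2l => //; exact: (norm_snd (x - y))].
- apply: aeW => x _; exists 0, 2; split; last by rewrite add0r.
  + exact: is_derive_cst.
  + by have s2 := is_derive_snd2 x; apply: is_derive_eq; rewrite /GRing.scale/=; ring.
Qed.
End Facts.
End SlitSolution.

(** * Horizontal differences *)

Section Differences.
Context {R : realType}.
Local Notation e1 := ((1, 0) : R * R).
Implicit Types x y v : R * R.

Lemma is_derive_translate (f : R * R -> R) x v e (d : R) :
  is_derive (x + v) e f d -> is_derive x e (fun y => f (y + v)) d.
Proof.
move=> fd; apply: is_derive_of_line.
have -> : (fun s : R => f (x + s *: e + v)) = (fun s : R => f (x + v + s *: e)).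
  by apply/funext => s; rewrite addrAC.
by apply: is_derive_line; rewrite scale0r addr0.
Qed.

Lemma continuous_translate (f : R * R -> R) x v :
  {for x + v, continuous f} -> {for x, continuous (fun y => f (y + v))}.
Proof.
move=> cf; apply: (@continuous_comp _ _ _ (fun y => y + v) f) => //.
by apply: cvgD => //; exact: cvg_cst.
Qed.

Lemma test_fun_translate (O O' : set (R * R)) v T T1 T2 T11 T22 :
  (forall x, O x -> O' (x - v)) -> test_fun O T T1 T2 T11 T22 ->
  test_fun O' (fun x => T (x + v)) (fun x => T1 (x + v)) (fun x => T2 (x + v))
    (fun x => T11 (x + v)) (fun x => T22 (x + v)).
Proof.
move=> OO [d1 d2 d11 d22 c c1 c2 c11 c22 [S [M [tau [tau0 S0 SO]]]]].
split.
- by move=> x; apply: is_derive_translate.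
- by move=> x; apply: is_derive_translate.
- by move=> x; apply: is_derive_translate.
- by move=> x; apply: is_derive_translate.
- by move=> x; apply: (continuous_translate (c (x + v))).
- by move=> x; apply: (continuous_translate (c1 (x + v))).
- by move=> x; apply: (continuous_translate (c2 (x + v))).
- by move=> x; apply: (continuous_translate (c11 (x + v))).
- by move=> x; apply: (continuous_translate (c22 (x + v))).
exists [set x | S (x + v)], (M + `|v|), tau; split => // x Sx.
  by have [] := S0 _ Sx.
have [xM yO] := SO _ Sx; split.
  by have := ler_normB (x + v) v; rewrite addrK; lra.
move=> y yx; rewrite -(addrK v y); apply: OO; apply: yO.
by rewrite opprD addrACA subrr addr0.
Qed.

Lemma test_fun_sub (O O' : set (R * R)) T T1 T2 T11 T22 :
  (forall x, O x -> O' x) -> test_fun O T T1 T2 T11 T22 -> test_fun O' T T1 T2 T11 T22.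
Proof.
move=> OO [d1 d2 d11 d22 c c1 c2 c11 c22 [S [M [tau [tau0 S0 SO]]]]].
split => //; exists S, M, tau; split => // x /SO[xM yO]; split => // y /yO.
exact: OO.
Qed.

(** The smaller radius leaves room [1 - r] for the horizontal shifts of [u]. *)
Definition Omr (k r : R) : set (R * R) := [set x | - k * nrm x < x.1 /\ nrm x < r].

Section Facts.
Variables (k L : R) (u u1 u2 : R * R -> R).
Hypothesis ss : slit_solution k L u u1 u2.

(* By convexity and [u = 0] on the slit, the slope in direction [e1] is at least
   [- 4 L x.2 ^+ 2]; the last term makes [Vd] nonnegative. *)
Definition Vd (h : R) x := u (x + h *: e1) - u x + h * (4 * L) * x.2 ^+ 2.
Definition Pd (h : R) x := u (x + (2 * h) *: e1) - 2 * u (x + h *: e1) + u x.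

Lemma u_cont x : nrm x < 1 -> {for x, continuous u}.
Proof. by move=> /(ss_d ss)[_ _ []]. Qed.

Lemma u_shift_cont x (h : R) : nrm x + `|h| < 1 -> {for x, continuous (fun y => u (y + h *: e1))}.
Proof.
move=> xh; apply: continuous_translate; apply: u_cont.
by apply: le_lt_trans (nrmD _ _) _; rewrite nrm_e1.
Qed.

(** The shift is moved from [u] to the test function, whose support then moves to the right; the
    sector is stable under such shifts, and [h <= 1 - r] keeps the support in the unit disc. *)
Lemma green_shift (r h : R) T T1 T2 T11 T22 : 0 <= h -> h <= 1 - r ->
  test_fun (Omr k r) T T1 T2 T11 T22 ->
  cc (fun x => u (x + h *: e1) * (T11 x + T22 x)) /\
  I2 (fun x => u (x + h *: e1) * (T11 x + T22 x)) = I2 T.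
Proof.
move=> h0 h4 tf; have [s0 s1 s2 s11 s22] := tf_sptd tf.
have c1 : cc (fun x => u (x + h *: e1) * (T11 x + T22 x)).
  have -> : (fun x => u (x + h *: e1) * (T11 x + T22 x)) =
    (fun x => u (x + h *: e1) * T11 x + u (x + h *: e1) * T22 x).
    by apply/funext => x; rewrite mulrDr.
  have cu x : Omr k r x -> {for x, continuous (fun y => u (y + h *: e1))}.
    by move=> [_ xn]; apply: u_shift_cont; rewrite ger0_norm//; lra.
  by apply: ccD; [exact: (cc_mul cu (tf_c11 tf) s11)|exact: (cc_mul cu (tf_c22 tf) s22)].
split => //.
rewrite -(I2_shift (- (h *: e1)) c1).
under eq_fun do rewrite subrK.
have tf' : test_fun (Om k) (fun x => T (x - h *: e1)) (fun x => T1 (x - h *: e1))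
    (fun x => T2 (x - h *: e1)) (fun x => T11 (x - h *: e1)) (fun x => T22 (x - h *: e1)).
  apply: test_fun_translate tf => x [x1 xn]; rewrite opprK.
  by apply: (Om_shift ss) => //; [split => //|]; lra.
have -> := green_u ss tf'.
exact: (I2_shift (- (h *: e1)) (sptd_cc (tf_c tf) s0)).
Qed.

(** The two copies of [u] contribute the same integral and cancel; [x.2 ^+ 2], of Laplacian [2], has
    coefficient [h * (4 * L)]. *)
Lemma I2_Vd (h : R) T T1 T2 T11 T22 : 0 <= h -> h <= 1 / 4 ->
  test_fun (Omr k (3 / 4)) T T1 T2 T11 T22 ->
  cc (fun x => Vd h x * (T11 x + T22 x)) /\
  I2 (fun x => Vd h x * (T11 x + T22 x)) = 8 * L * h * I2 T.
Proof.
move=> h0 h4 tf.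
have q1 : (0 : R) <= 1 - 3 / 4 by lra.
have q3 : h <= 1 - 3 / 4 by lra.
have [ch Ih] := green_shift h0 q3 tf.
have [c0 I0] := green_shift (lexx 0) q1 tf.
have tf' : test_fun (Om k) T T1 T2 T11 T22.
  by apply: test_fun_sub tf => x [x1 xn]; split => //; lra.
have Is := green_sqr tf'.
have [sT s1 s2 s11 s22] := tf_sptd tf.
have cs : cc (fun x => x.2 ^+ 2 * (T11 x + T22 x)).
  have cT11 := sptd_cc (tf_c11 tf) s11; have cT22 := sptd_cc (tf_c22 tf) s22.
  apply: ccMl; last exact: ccD.
  by move=> x; apply: (@continuous_comp _ _ _ snd (fun t : R => t ^+ 2)); [exact: cvg_snd|exact: exprn_continuous].
have E : (fun x => Vd h x * (T11 x + T22 x)) =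
  (fun x => (u (x + h *: e1) * (T11 x + T22 x) - u (x + 0 *: e1) * (T11 x + T22 x)) +
     h * (4 * L) * (x.2 ^+ 2 * (T11 x + T22 x))).
  by apply/funext => x; rewrite /Vd scale0r addr0; ring.
rewrite E; split; first by apply: ccD; [exact: ccB|exact: ccZ].
rewrite I2D; [|exact: ccB|exact: ccZ].
rewrite I2B// I2Z// Ih I0 Is; ring.
Qed.

(** The coefficients [1, - 2, 1] of the second difference sum to zero. *)
Lemma I2_Pd (r h : R) T T1 T2 T11 T22 : 0 <= h -> 2 * h <= 1 - r ->
  test_fun (Omr k r) T T1 T2 T11 T22 ->
  cc (fun x => Pd h x * (T11 x + T22 x)) /\
  I2 (fun x => Pd h x * (T11 x + T22 x)) = 0.
Proof.
move=> h0 h4 tf.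
have q1 : (0 : R) <= 1 - r by lra.
have q2 : 0 <= 2 * h by lra. have q4 : h <= 1 - r by lra.
have [ch Ih] := green_shift h0 q4 tf.
have [c0 I0] := green_shift (lexx 0) q1 tf.
have [c2 Ih2] := green_shift q2 h4 tf.
have E : (fun x => Pd h x * (T11 x + T22 x)) =
  (fun x => (u (x + (2 * h) *: e1) * (T11 x + T22 x) - 2 * (u (x + h *: e1) * (T11 x + T22 x))) +
      u (x + 0 *: e1) * (T11 x + T22 x)).
  by apply/funext => x; rewrite /Pd scale0r addr0; ring.
rewrite E; split; first by apply: ccD => //; apply: ccB => //; exact: ccZ.
rewrite I2D//; last by apply: ccB => //; exact: ccZ.
rewrite I2B//; last exact: ccZ.
rewrite I2Z// Ih I0 Ih2; ring.
Qed.

Lemma Vd_ge0 x (h : R) : nrm x < 1 / 2 -> 0 < h < 1 / 4 -> 0 <= Vd h x.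
Proof. exact: (u_slope_ge ss). Qed.

Lemma Pd_ge0 x (h : R) : 0 <= h -> nrm x + 2 * h < 1 -> 0 <= Pd h x.
Proof. exact: (u_second_diff_ge0 ss). Qed.

Lemma Vd_cont x (h : R) : nrm x + `|h| < 1 -> {for x, continuous (Vd h)}.
Proof.
move=> xh; apply: cvgD.
  by apply: cvgB; [exact: u_shift_cont|apply: u_cont; have := normr_ge0 h; lra].
apply: cvgM; first exact: cvg_cst.
by apply: (@continuous_comp _ _ _ snd (fun t : R => t ^+ 2)); [exact: cvg_snd|exact: exprn_continuous].
Qed.

Lemma Pd_cont x (h : R) : nrm x + 2 * `|h| < 1 -> {for x, continuous (Pd h)}.
Proof.
move=> xh; have h0 := normr_ge0 h; apply: cvgD; last by apply: u_cont; lra.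
apply: cvgB; first by apply: u_shift_cont; rewrite normrM (ger0_norm (_ : 0 <= 2)).
by apply: cvgM; [exact: cvg_cst|apply: u_shift_cont; lra].
Qed.

Lemma cc_disc_mul (F g : R * R -> R) :
  (forall x, nrm x < 1 / 2 -> {for x, continuous F}) -> cc g ->
  (forall x, g x != 0 -> nrm x < 1 / 4) -> cc (fun x => F x * g x).
Proof.
move=> cF cg gs; apply: (@cc_mul _ [set x | nrm x < 1 / 2]) => //; first exact: cc_cont.
exists (1 / 4), (1 / 8); split => //.
move=> x /gs xR; split; first by apply: le_trans (norm_le_nrm x) (ltW xR).
move=> y yx /=; have := nrm_lip x y; rewrite ler_norml => /andP[_].
by move: xR yx; clear -ss; lra.
Qed.

Lemma cc_Vd_mul (h : R) (g : R * R -> R) : 0 < h < 1 / 8 -> cc g ->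
  (forall x, g x != 0 -> nrm x < 1 / 4) -> cc (fun x => Vd h x * g x).
Proof.
move=> /andP[h0 h8]; apply: cc_disc_mul => x xn; apply: Vd_cont; rewrite gtr0_norm//.
by move: xn h8; clear -ss; lra.
Qed.

Lemma cc_Pd_mul (h : R) (g : R * R -> R) : 0 < h < 1 / 8 -> cc g ->
  (forall x, g x != 0 -> nrm x < 1 / 4) -> cc (fun x => Pd h x * g x).
Proof.
move=> /andP[h0 h8]; apply: cc_disc_mul => x xn; apply: Pd_cont; rewrite gtr0_norm//.
by move: xn h8; clear -ss; lra.
Qed.

Lemma Vd_le x (h : R) : 0 < h -> nrm x + h < 1 ->
  Vd h x <= h * L * (nrm x + h) + h * (4 * L) * nrm x.
Proof.
move=> h0 xh; have L0 := ss_L ss; rewrite /Vd; apply: lerD.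
  apply: le_trans (ler_norm _) _; apply: le_trans (u_slope_le ss h0 xh) _.
  apply: ler_wpM2l; first by rewrite mulr_ge0 ?(ltW h0) ?(ltW L0).
  by have := norm_le_nrm x; lra.
apply: ler_wpM2l; first by rewrite !mulr_ge0 ?(ltW h0) ?(ltW L0).
rewrite -[x.2 ^+ 2]real_normK ?num_real// expr2.
have h2 := nrm_ge2 x; have x1 : `|x.2| <= 1 by apply: le_trans h2 _; lra.
by apply: le_trans h2; rewrite ler_piMr.
Qed.
End Facts.
End Differences.

(** * Integral bound for the first difference at scale [rho] *)

Section SlopeBound.
Context {R : realType}.
Implicit Types x y v : R * R.

(** A displacement below [dl / 4] lowers [x.1] by less than [dl / 4] and [k * nrm x] by less than
    [dl / 2], which the strict excess [dl] tolerates. *)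
Lemma Om_margin (k ep dl r : R) x y : 0 < k <= 1 -> ep <= k ->
  dl < x.1 + ep * nrm x -> nrm x < r -> `|y - x| < dl / 4 -> Omr k (r + dl / 2) y.
Proof.
move=> /andP[k0 k1] epk dx xr yx.
have h1 := nrm_lip x y; have h2 := ler_norm (- (y - x).1).
have h3 := norm_fst (y - x).
rewrite normrN /= in h2.
have h4 : - (2 * `|y - x|) <= nrm y - nrm x.
  by move: h1; rewrite ler_norml => /andP[].
have h5 : nrm y - nrm x <= 2 * `|y - x|.
  by move: h1; rewrite ler_norml => /andP[].
split; last lra.
have h6 : ep * nrm x <= k * nrm x by rewrite ler_wpM2r ?nrm_ge0.
have h7 : k * (nrm x - 2 * `|y - x|) <= k * nrm y by rewrite ler_wpM2l ?(ltW k0)//; lra.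
have h8 : k * (2 * `|y - x|) <= 1 * (2 * `|y - x|) by rewrite ler_wpM2r ?mulr_ge0.
move: h2 h3; rewrite /= => h2 h3; lra.
Qed.

(** One exponent serves both barriers, with [ep = k] for the first difference and [ep = k / 2] for
    the second; [1 - k / 8 <= b ^+ 2] is all that enters. *)
Lemma barrier_exponent (k : R) : 0 < k < 1 ->
  let b := 1 - k / 16 in [/\ 15 / 16 <= b < 1, 1 + k / 4 <= b ^+ 2 * (1 + k) &
    1 + (k / 2) / 4 <= b ^+ 2 * (1 + k / 2)].
Proof.
move=> /andP[k0 k1] b.
have bE : b ^+ 2 = 1 - k / 8 + (k / 16) ^+ 2 by rewrite /b; field.
have b2 : 1 - k / 8 <= b ^+ 2 by rewrite bE lerDl sqr_ge0.
split; first by rewrite /b; apply/andP; split; lra.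
- apply: (@le_trans _ _ ((1 - k / 8) * (1 + k))); last by apply: ler_wpM2r => //; lra.
  by have : k * k <= k * 1 by [apply: ler_wpM2l; exact: ltW]; lra.
- apply: (@le_trans _ _ ((1 - k / 8) * (1 + k / 2))); last by apply: ler_wpM2r => //; lra.
  by have : k * k <= k * 1 by [apply: ler_wpM2l; exact: ltW]; lra.
Qed.

Lemma ex_min3 (a b c : R) : 0 < a -> 0 < b -> 0 < c ->
  exists2 d, 0 < d & [/\ d <= a, d <= b & d <= c].
Proof.
move=> a0 b0 c0; exists (Num.min a (Num.min b c)); first by rewrite !lt_min a0 b0.
by rewrite !ge_min !lexx !orbT.
Qed.

Lemma half_powRN (c : R) : 2^-1 `^ (- c) = 2 `^ c.
Proof. by rewrite -powR_inv1// -powRrM mulN1r opprK. Qed.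

Lemma nrm_pow_le (b s : R) x : 0 <= b <= 1 -> 0 < s -> s <= nrm x ->
  nrm x `^ (- b) <= 2 * (x.1 ^+ 2 + s ^+ 2) `^ (- (b / 2)).
Proof.
move=> /andP[b0 b1] s0 sx.
have r0 : 0 < nrm x by exact: lt_le_trans sx.
have q0 : 0 < x.1 ^+ 2 + s ^+ 2 by rewrite ltr_wpDl ?sqr_ge0// exprn_gt0.
rewrite -(@sqn_pow _ _ (- (b / 2))); last by field.
have q2 : (x.1 ^+ 2 + s ^+ 2) / 2 <= sqn x.
  have : s ^+ 2 <= sqn x by rewrite -nrm_sqr ler_pXn2r ?nnegrE ?nrm_ge0 ?(ltW s0).
  by have := sqr_ge0 x.2; have := sqr_ge0 x.1; rewrite /sqn; lra.
apply: (@le_trans _ _ (((x.1 ^+ 2 + s ^+ 2) / 2) `^ (- (b / 2)))).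
  rewrite !powRN lef_pV2 ?posrE ?powR_gt0 ?divr_gt0 -?nrm_gt0//.
  by apply: ge0_ler_powR => //; rewrite ?nnegrE ?sqn_ge0//; lra.
rewrite powRM ?invr_ge0 ?(ltW q0)// mulrC ler_wpM2r ?powR_ge0//.
rewrite half_powRN -[leRHS](@powRr1 _ 2)//.
by apply: ler_powR; lra.
Qed.

Lemma half_powR_le (b h : R) : 15 / 16 <= b < 1 -> 0 < h ->
  (h / 2) `^ (- (3 + b)) <= 16 * h `^ (- (3 + b)).
Proof.
move=> /andP[b0 b1] h0.
rewrite powRM ?(ltW h0)// mulrC half_powRN; apply: ler_wpM2r; first exact: powR_ge0.
apply: (@le_trans _ _ (2 `^ 4%:R)); first by apply: ler_powR; lra.
by rewrite powR_mulrn// !exprS expr0; lra.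
Qed.

(** The three factors on the left are the size of [Vd] in the core [r <= M h], the deficit of the
    barrier Laplacian and the area of the core. Counting powers of [h] leaves [h * h^(1 - b)], and
    this is where [b < 1] is decisive. *)
Lemma inner_cost (b h A M L : R) : 15 / 16 <= b < 1 -> 0 < h -> 0 < A -> 0 < M -> 0 < L ->
  6 * M * L * h ^+ 2 * (24 * A * h * (h / 2) `^ (- (3 + b))) * (2 * (M * h)) ^+ 2 <=
  6 * M * L * (24 * 16) * (2 * M) ^+ 2 * h * (A * h `^ (1 - b)).
Proof.
move=> b01 h0 A0 M0 L0; have hp := half_powR_le b01 h0.
have hE : h `^ (- (3 + b)) = h `^ (1 - b) / h ^+ 4.
  by rewrite -powR_invn ?(ltW h0)// -powR_split//; congr (_ `^ _); ring.
have P0 : 0 <= 6 * M * L * h ^+ 2 * (24 * A * h) * (2 * (M * h)) ^+ 2.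
  apply: mulr_ge0; last exact: sqr_ge0.
  apply: mulr_ge0; last by apply: mulr_ge0; [apply: mulr_ge0|]; rewrite ?ltW.
  apply: mulr_ge0; last exact: sqr_ge0.
  by apply: mulr_ge0; [apply: mulr_ge0|]; rewrite ?ltW.
rewrite [leLHS](_ : _ = 6 * M * L * h ^+ 2 * (24 * A * h) * (2 * (M * h)) ^+ 2 *
  (h / 2) `^ (- (3 + b))); last by ring.
apply: le_trans (ler_wpM2l P0 hp) _; rewrite hE le_eqVlt; apply/orP; left; apply/eqP.
by field; rewrite gt_eqF.
Qed.

Variables (k L : R) (u u1 u2 : R * R -> R).
Hypothesis ss : slit_solution k L u u1 u2.

(** The barrier with [dl = h] and [ep = k]. In the narrower sector [x.1 >= - (k / 2) * nrm x] the
    factor [x.1 + k * nrm x - h] is at least [k * nrm x / 4], so [A = 8 s^b / k] is the choice that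
    gives [w >= 1] up to radius [s], and there the Laplacian is at least [3 / s ^+ 2]. The integral
    bound uses [2 A <= R0^b] against the pointwise bound [12 A r^(- b)]. *)
Lemma slope_barrier (b h s A R0 : R) : 15 / 16 <= b < 1 -> 1 + k / 4 <= b ^+ 2 * (1 + k) ->
  0 < h < 1 / 8 -> 0 < s -> A = 8 * s `^ b / k -> 0 < R0 < 1 / 4 -> 2 * A <= R0 `^ b ->
  exists F, [/\ cc (fun x => Vd L u h x * F x),
    I2 (fun x => Vd L u h x * F x) <= 8 * L * h * (48 / (1 - b) * R0 ^+ 2),
    forall x, R0 <= nrm x -> F x = 0,
    forall x, 32 * h / k <= nrm x -> 0 <= F x &
   (forall x, - (24 * A * h * (h / 2) `^ (- (3 + b))) <= F x) /\
   forall x, 32 * h / k <= nrm x -> - (k / 2) * nrm x <= x.1 -> nrm x <= s ->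
     4 * h <= k * nrm x -> 3 / s ^+ 2 <= F x].
Proof.
move=> b01 bep /andP[h0 h8] s0 AE /andP[R00 R04] AR.
have kk := ss_k ss; have L0 := ss_L ss; have [k0 k1] := andP kk.
have [b0 b1] := andP b01.
have A0 : 0 < A by rewrite AE; apply: divr_gt0 => //; apply: mulr_gt0 => //; exact: powR_gt0.
have kle : 0 < k <= 1 by rewrite k0 ltW.
have tau0 : 0 < h / 4 by rewrite divr_gt0.
have [|T [T1 [T2 [T11 [T22 [tf TB Wge0 Wge Wlow]]]]]] :=
    @barrier R k b h A kle b01 bep h0 A0 (Omr k (3 / 4)) R0 (h / 4) R00 tau0 AR.
  move=> x hx xR y yx; have [y1 y2] := Om_margin kle (lexx k) hx xR yx.
  by clear AE AR; split => //; lra.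
exists (fun x => T11 x + T22 x).
have [cVW IVW] : cc (fun x => Vd L u h x * (T11 x + T22 x)) /\
    I2 (fun x => Vd L u h x * (T11 x + T22 x)) = 8 * L * h * I2 T.
  by apply: (I2_Vd ss _ _ tf); clear AE AR; lra.
have cT : cc T by have [sT _ _ _ _] := tf_sptd tf; exact: (sptd_cc (tf_c tf) sT).
have far x : ~ (h < x.1 + k * nrm x /\ nrm x < R0) -> T x = 0 /\ T11 x + T22 x = 0.
  by have [_ _ h'] := TB x; move=> /h'[].
have {}TB x : T x <= 12 * A * nrm x `^ (- b) by have [] := TB x.
have A24 : 0 <= 24 * A by rewrite mulr_ge0// ltW.
split => //; last split => //.
- rewrite IVW; apply: ler_wpM2l; first by rewrite !mulr_ge0// ltW.
  have q1 : 0 < h / 2 by rewrite divr_gt0.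
  have q2 : 0 <= b < 1 by rewrite b1 andbT; lra.
  have IP := @I2_le_pow R T b (24 * A) (h / 2) R0 cT R00 q1 q2 A24.
  apply: le_trans (IP _ _) _; clear IP.
  + move=> x _; have [hx|/far[-> _]] := pselect (h < x.1 + k * nrm x /\ nrm x < R0); last first.
      by rewrite !mulr_ge0 ?powR_ge0// ltW.
    apply: le_trans (TB x) _.
    have xh : h / 2 <= nrm x.
      have [hx1 _] := hx; have h3 := fst_le_nrm x.
      have : k * nrm x <= 1 * nrm x by rewrite ler_wpM2r ?nrm_ge0// ltW.
      move: hx1 h3; clear -ss; lra.
    have b01' : 0 <= b <= 1 by rewrite (ltW b1) andbT; case/andP: q2.
    have := nrm_pow_le b01' q1 xh => np.
    rewrite [leRHS](_ : _ = 12 * A * (2 * (x.1 ^+ 2 + (h / 2) ^+ 2) `^ (- (b / 2)))); last by ring.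
    by apply: ler_wpM2l => //; rewrite mulr_ge0// ltW.
  + move=> x xR; rewrite (far x _).1// => -[_ xR'].
    by move: (norm_le_nrm x); rewrite leNgt (lt_trans xR' xR).
  rewrite -(@powR_mulrn _ R0 2) ?(ltW R00)// -[X in _ * X <= _]powRrM.
  rewrite (_ : 2%:R * - (b / 2) = - b); last by field.
  have Rb : A * R0 `^ (- b) <= 1 / 2.
    by rewrite powRN ler_pdivrMr ?powR_gt0//; move: AR; clear -ss; lra.
  have W0 : 0 <= R0 `^ 2%:R / (1 - b) by rewrite divr_ge0 ?powR_ge0// subr_ge0 ltW.
  by have := ler_wpM2l W0 Rb; clear -ss; lra.
- by move=> x xR; apply: (far x _).2 => -[_]; rewrite ltNge xR.
- move=> x xM x1 xs hk.
  have r0 : 0 < nrm x by apply: lt_le_trans xM; apply: divr_gt0 => //; rewrite mulr_gt0.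
  have Ap : 2 <= A * nrm x `^ (- (1 + b)) * (x.1 + k * nrm x - h).
    have p1 : k * nrm x / 4 <= x.1 + k * nrm x - h by move: x1 hk; clear -ss; lra.
    have X0 : 0 <= A * nrm x `^ (- (1 + b)) by rewrite mulr_ge0 ?powR_ge0 ?(ltW A0).
    apply: le_trans (ler_wpM2l X0 p1).
    rewrite [leRHS](_ : _ = A * k / 4 * (nrm x `^ (- (1 + b)) * nrm x `^ 1)); last first.
      by rewrite powRr1 ?nrm_ge0//; ring.
    rewrite -powR_split// (_ : - (1 + b) + 1 = - b); last by ring.
    apply: (@le_trans _ _ (A * k / 4 * s `^ (- b))).
      rewrite AE [leRHS](_ : _ = 2 * (s `^ b * s `^ (- b))); last by field; rewrite gt_eqF.
      by rewrite -powR_split// subrr powRr0 mulr1.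
    apply: ler_wpM2l; first by rewrite !mulr_ge0// ltW.
    rewrite !powRN lef_pV2 ?posrE ?powR_gt0//.
    by apply: ge0_ler_powR; rewrite ?nnegrE ?nrm_ge0 ?(ltW s0)//; move: b0; clear -ss; lra.
  apply: le_trans (Wlow x xM Ap).
  apply: (@le_trans _ _ (3 / 8 * k * A * s `^ (- (2 + b)))).
    rewrite AE [leRHS](_ : _ = 3 * (s `^ b * s `^ (- (2 + b)))); last by field; rewrite gt_eqF.
    rewrite -powR_split// (_ : b - (2 + b) = - 2%:R); last by ring.
    by rewrite powR_invn ?(ltW s0).
  apply: ler_wpM2l; first by rewrite !mulr_ge0// ltW.
  rewrite !powRN lef_pV2 ?posrE ?powR_gt0//.
  by apply: ge0_ler_powR; rewrite ?nnegrE ?nrm_ge0 ?(ltW s0)//; move: b0; clear -ss; lra.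
Qed.

(** Off the core [c * f <= F] and [Vd] is nonnegative on the support; in the core [f] vanishes and
    the negative part of [F] is charged to the last term, through [Vd <= 6 * M * L * h ^+ 2]. *)
Lemma slope_test_bound (h s c c' M R0 : R) (F f : R * R -> R) :
  0 < h < 1 / 8 -> 0 <= c -> 0 <= c' -> 1 <= M -> R0 < 1 / 4 -> M * h < 1 / 4 ->
  cc (fun x => Vd L u h x * F x) -> cc (fun x => Vd L u h x * f x) ->
  (forall x, R0 <= nrm x -> F x = 0) ->
  (forall x, M * h <= nrm x -> 0 <= F x) ->
  (forall x, - c' <= F x) ->
  (forall x, 0 <= f x <= 1) ->
  (forall x, f x != 0 -> [/\ M * h <= nrm x, nrm x < 1 / 4 & c <= F x]) ->
  c * I2 (fun x => Vd L u h x * f x) <=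
    I2 (fun x => Vd L u h x * F x) + 6 * M * L * h ^+ 2 * c' * (2 * (M * h)) ^+ 2.
Proof.
move=> /andP[h0 h8] c0 c'0 M1 R04 Mh4 cVF cVf Ffar F0 Fc' f01 fK.
have L0 := ss_L ss; have M0 : 0 <= M by apply: le_trans M1.
have h4 : 0 < h < 1 / 4 by rewrite h0; move: h8; clear -ss; lra.
rewrite -I2Z// addrC -lerBlDr -I2B//; last exact: ccZ.
have VR x : nrm x < 1 / 4 -> 0 <= Vd L u h x.
  by move=> xR; apply: (Vd_ge0 ss) => //; move: xR; clear -ss; lra.
have outside x : M * h <= nrm x -> c * (Vd L u h x * f x) - Vd L u h x * F x <= 0.
  move=> xM; have W0 := F0 x xM.
  have [fx|fx] := eqVneq (f x) 0.
    rewrite fx !mulr0 sub0r oppr_le0.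
    have [xR|xR] := ltP (nrm x) R0; last by rewrite Ffar// mulr0.
    by apply: mulr_ge0 => //; apply: VR; exact: lt_trans R04.
  have [xr xs cF] := fK x fx.
  have V0 := VR x xs; have /andP[f0 f1] := f01 x.
  rewrite subr_le0 mulrCA; apply: ler_wpM2l => //.
  by apply: le_trans cF; rewrite ler_piMr.
apply: I2_le_box => //.
- by apply: ccB => //; exact: ccZ.
- by apply: mulr_ge0 => //; exact: ltW.
- move=> x _.
  have D0 : 0 <= 6 * M * L * h ^+ 2 * c'.
    apply: mulr_ge0 => //; apply: mulr_ge0; last exact: sqr_ge0.
    by apply: mulr_ge0; [exact: mulr_ge0|exact: ltW].
  have [/outside o|xM] := leP (M * h) (nrm x); first exact: le_trans o _.
  have fx : f x = 0 by apply/eqP; apply: contraT => /fK[]; rewrite leNgt xM.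
  rewrite fx !mulr0 sub0r.
  have x14 : nrm x < 1 / 4 by exact: lt_trans Mh4.
  have V0 := VR x x14.
  have Vl : Vd L u h x <= 6 * M * L * h ^+ 2.
    have xh1 : nrm x + h < 1 by move: x14 h8; clear -ss; lra.
    apply: le_trans (Vd_le ss h0 xh1) _.
    rewrite [leRHS](_ : _ = h * L * (6 * (M * h))); last by ring.
    rewrite [leLHS](_ : _ = h * L * (nrm x + h + 4 * nrm x)); last by ring.
    apply: ler_wpM2l; first by rewrite mulr_ge0 ?(ltW h0) ?(ltW L0).
    have : 1 * h <= M * h by apply: ler_wpM2r => //; exact: ltW.
    by move: xM; clear -ss; lra.
  rewrite -mulrN; apply: (@le_trans _ _ (Vd L u h x * c')).
    by apply: ler_wpM2l => //; rewrite lerNl.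
  by apply: ler_wpM2r.
- by move=> x xM; apply: outside; apply: le_trans (ltW xM) (norm_le_nrm x).
Qed.
(** With [s] comparable to [rho], both terms of [slope_test_bound] are [O(h s^2)]; dividing by
    [3 / s ^+ 2] gives [h s^4]. *)
Lemma Vd_integral_bound : exists C r1 : R, [/\ 0 < C, 0 < r1 & forall rho, 0 < rho < r1 ->
  exists2 h1, 0 < h1 & forall h, 0 < h < h1 -> forall f, cc f ->
    (forall x, 0 <= f x <= 1) ->
    (forall x, f x != 0 -> [/\ - (k / 2) * nrm x <= x.1, rho / 8 <= nrm x &
       nrm x <= 192 / k * rho]) ->
    [/\ cc (fun x => Vd L u h x * f x), forall x, f x != 0 -> 0 <= Vd L u h x &
    I2 (fun x => Vd L u h x * f x) <= C * h * rho ^+ 4]].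
Proof.
have kk := ss_k ss; have L0 := ss_L ss; have [k0 k1] := andP kk.
have [b [b01 bep]] : exists b, 15 / 16 <= b < 1 /\ 1 + k / 4 <= b ^+ 2 * (1 + k).
  by exists (1 - k / 16); have [] := barrier_exponent kk.
have [b0 b1] := andP b01.
(* [N] is the outer radius of the support of [f] in units of [rho]; [M] is the core radius of the
   barrier in units of [h]. *)
have [N NE] : exists N, N = 192 / k by exists (192 / k).
have [M ME] : exists M, M = 32 / k by exists (32 / k).
(* The square ensures [B^b >= 16 / k], as [2 * b >= 1]; with [R0 = B * s] this gives
   [2 * A <= R0^b]. The threshold for [rho] below means [R0 < 1 / 4]. *)
have [B BE] : exists B, B = (16 / k) ^+ 2 by exists ((16 / k) ^+ 2).
have N0 : 1 <= N by rewrite NE ler_pdivlMr//; move: k1; clear -ss; lra.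
have M32 : 32 <= M by rewrite ME ler_pdivlMr//; move: k1; clear -ss; lra.
have kB : 16 <= 16 / k by rewrite ler_pdivlMr//; move: k1; clear -ss; lra.
have B1 : 1 <= B by rewrite BE exprn_ege1//; move: kB; clear -ss; lra.
have [Np Mp Bp] : [/\ 0 < N, 0 < M & 0 < B] by move: N0 M32 B1; clear -ss; split; lra.
have [C1 C1E] : exists C1, C1 = 6 * M * L * (24 * 16) * (2 * M) ^+ 2 by eexists.
have [C2 C2E] : exists C2, C2 = 8 * L * (48 / (1 - b)) * B ^+ 2 by eexists.
have C10 : 0 < C1.
  rewrite C1E; apply: mulr_gt0; last by apply: exprn_gt0; exact: mulr_gt0.
  by apply: mulr_gt0 => //; apply: mulr_gt0 => //; exact: mulr_gt0.
have C20 : 0 < C2.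
  rewrite C2E; apply: mulr_gt0; last exact: exprn_gt0.
  by apply: mulr_gt0; [exact: mulr_gt0|apply: divr_gt0 => //; rewrite subr_gt0].
have BN0 : 0 < 4 * B * N by apply: mulr_gt0 => //; exact: mulr_gt0.
exists ((C1 + C2) * N ^+ 4), (1 / (4 * B * N)); split.
- by apply: mulr_gt0; [exact: addr_gt0|exact: exprn_gt0].
- exact: divr_gt0.
move=> rho /andP[rho0 rhor].
have [s sE] : exists s, s = N * rho by eexists.
have [A AE] : exists A, A = 8 * s `^ b / k by eexists.
have [R0 R0E] : exists R0, R0 = B * s by eexists.
have s0 : 0 < s by rewrite sE; exact: mulr_gt0.
have A0 : 0 < A.
  by rewrite AE; apply: divr_gt0 => //; apply: mulr_gt0 => //; exact: powR_gt0.
have R00 : 0 < R0 by rewrite R0E; exact: mulr_gt0.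
have R04 : R0 < 1 / 4.
  by move: rhor; rewrite ltr_pdivlMr// R0E sE; clear -ss; lra.
have AR : 2 * A <= R0 `^ b.
  rewrite R0E powRM ?(ltW Bp) ?(ltW s0)//.
  rewrite [leLHS](_ : _ = 16 / k * s `^ b); last by rewrite AE; field; rewrite gt_eqF.
  apply: ler_wpM2r; first exact: powR_ge0.
  have kB0 : 0 <= 16 / k by apply: le_trans kB.
  rewrite BE -(@powR_mulrn _ _ 2)//.
  rewrite -powRrM -[leLHS](@powRr1 _ (16 / k))//.
  by apply: ler_powR; [move: kB|move: b0]; clear -ss; lra.
have sR : s <= R0.
  by rewrite R0E -[leLHS]mul1r; apply: ler_wpM2r => //; exact: ltW.
(* [h < h2] amounts to [A h^(1 - b) < s ^+ 2]: the core must not cost more than the main term. *)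
have [h2 h2E] : exists h2, h2 = (s ^+ 2 / A) `^ (1 / (1 - b)) by eexists.
have sA0 : 0 < s ^+ 2 / A by apply: divr_gt0 => //; exact: exprn_gt0.
have h20 : 0 < h2 by rewrite h2E; exact: powR_gt0.
have krho : 0 < k * rho / 256 by apply: divr_gt0 => //; exact: mulr_gt0.
have e8 : 0 < 1 / 8 :> R by exact: divr_gt0.
have [h1 h10 [h1h2 h1k h18]] := ex_min3 h20 krho e8.
exists h1 => // h /andP[h0 hh1] f cf f01 fK.
have hh2 : h < h2 by exact: lt_le_trans h1h2.
have hrho : h < k * rho / 256 by exact: lt_le_trans h1k.
have h8 : h < 1 / 8 by exact: lt_le_trans h18.
have hA : A * h `^ (1 - b) <= s ^+ 2.
  rewrite mulrC -ler_pdivlMr//.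
  apply: (@le_trans _ _ (h2 `^ (1 - b))).
    by apply: ge0_ler_powR; rewrite ?nnegrE ?(ltW h0) ?(ltW h20) ?(ltW hh2) ?subr_ge0 ?(ltW b1).
  have nb : 1 - b != 0 by rewrite gt_eqF// subr_gt0.
  by rewrite h2E -powRrM divfK// powRr1// ltW.
have h08 : 0 < h < 1 / 8 by rewrite h0.
have R004 : 0 < R0 < 1 / 4 by rewrite R00.
have [F [cVF IVF Ffar F0 [Fl FK]]] := slope_barrier b01 bep h08 s0 AE R004 AR.
have MhE : 32 * h / k = M * h by rewrite ME; ring.
have Mhrho : M * h < rho / 8 by rewrite -MhE ltr_pdivrMr//; move: hrho; clear -ss; lra.
have fs x : f x != 0 -> nrm x < 1 / 4.
  by move=> /fK[_ _]; rewrite -NE -sE => xs; apply: le_lt_trans xs (le_lt_trans sR R04).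
have V0 x : f x != 0 -> 0 <= Vd L u h x.
  move=> /fs xn; apply: (Vd_ge0 ss); first by move: xn; clear -ss; lra.
  by rewrite h0; move: h8; clear -ss; lra.
have cVf : cc (fun x => Vd L u h x * f x) := cc_Vd_mul ss h08 cf fs.
split => //.
have := @slope_test_bound h s (3 / s ^+ 2) (24 * A * h * (h / 2) `^ (- (3 + b)))
  M R0 F f h08 _ _ _ R04 _ cVF cVf Ffar _ Fl f01 _.
have s20 : 0 < s ^+ 2 by exact: exprn_gt0.
have d1 : 0 <= 3 / s ^+ 2 by apply: divr_ge0 => //; exact: ltW.
have d2 : 0 <= 24 * A * h * (h / 2) `^ (- (3 + b)).
  by apply: mulr_ge0; [|exact: powR_ge0]; apply: mulr_ge0; [apply: mulr_ge0|]; rewrite // ltW.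
have d3 : 1 <= M by move: M32; clear -ss; lra.
have rhoN : rho <= s by rewrite sE -[leLHS]mul1r; apply: ler_wpM2r => //; exact: ltW.
have d4 : M * h < 1 / 4 by move: rhoN Mhrho sR R04 rho0; clear -ss; lra.
have d5 x : M * h <= nrm x -> 0 <= F x by rewrite -MhE; exact: F0.
have d6 x : f x != 0 -> [/\ M * h <= nrm x, nrm x < 1 / 4 & 3 / s ^+ 2 <= F x].
  move=> fx; have [x1 xr xs] := fK x fx.
  have xM : M * h <= nrm x by apply: le_trans xr; exact: ltW.
  split => //; first exact: fs.
  apply: FK => //; first by rewrite MhE.
    by rewrite sE NE.
  have : k * (rho / 8) <= k * nrm x by apply: ler_wpM2l => //; exact: ltW.
  by move: hrho (mulr_gt0 k0 rho0); clear -ss; lra.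
move=> /(_ d1 d2 d3 d4 d5 d6) main.
have cost := inner_cost b01 h0 A0 Mp L0.
have c1 : C1 * h * (A * h `^ (1 - b)) <= C1 * h * s ^+ 2.
  by apply: ler_wpM2l => //; apply: mulr_ge0; exact: ltW.
rewrite -C1E in cost.
have fin : 3 / s ^+ 2 * I2 (fun x => Vd L u h x * f x) <= (C1 + C2) * h * s ^+ 2.
  rewrite (_ : 8 * L * h * (48 / (1 - b) * R0 ^+ 2) = C2 * h * s ^+ 2) in IVF; last first.
    by rewrite C2E R0E; ring.
  by move: main IVF cost c1; clear -ss; lra.
have := ler_wpM2l (ltW s20) fin.
rewrite mulrA (_ : s ^+ 2 * (3 / s ^+ 2) = 3); last by field; rewrite gt_eqF.
have p1 : 0 <= (C1 + C2) * h * s ^+ 4.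
  apply: mulr_ge0; last by apply: exprn_ge0; exact: ltW.
  by apply: mulr_ge0; [apply: addr_ge0|]; exact: ltW.
rewrite (_ : s ^+ 2 * ((C1 + C2) * h * s ^+ 2) = (C1 + C2) * h * s ^+ 4); last by ring.
rewrite (_ : _ * N ^+ 4 * h * rho ^+ 4 = (C1 + C2) * h * s ^+ 4); last by rewrite sE; ring.
by move: p1; clear -ss; lra.
Qed.
End SlopeBound.

(** * Integral bound for the second difference at scale [rho] *)

Section SecondDifferenceBound.
Context {R : realType}.
Local Notation e1 := ((1, 0) : R * R).
Implicit Types x y v : R * R.

Definition clip (t : R) : R := Num.min 1 (Num.max 0 t).

Lemma clip01 t : 0 <= clip t <= 1.
Proof. by rewrite /clip le_min ler01 le_max lexx ge_min lexx. Qed.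
Lemma clip_ge1 t : 1 <= t -> clip t = 1.
Proof. by move=> t1; rewrite /clip max_r ?(le_trans ler01)// min_l. Qed.
Lemma clip_le0 t : t <= 0 -> clip t = 0.
Proof. by move=> t0; rewrite /clip max_l// min_r. Qed.
Lemma clip_id t : 0 <= t <= 1 -> clip t = t.
Proof. by move=> /andP[t0 t1]; rewrite /clip max_r// min_r. Qed.

Lemma clip_lip s t : `|clip s - clip t| <= `|s - t|.
Proof.
wlog st : s t / s <= t.
  move=> H; have [st|/ltW ts] := leP s t; first exact: H.
  by rewrite distrC [leRHS]distrC; exact: H.
have -> : `|s - t| = t - s by rewrite distrC ger0_norm// subr_ge0.
rewrite ler_norml; apply/andP.
have [t0|t0] := leP t 0; first by rewrite !clip_le0//; [split; lra|lra].
have [s1|s1] := leP 1 s; first by rewrite !clip_ge1//; [split; lra|lra].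
have [s0|s0] := leP s 0.
  rewrite (clip_le0 s0); have [t1|t1] := leP 1 t; first by rewrite clip_ge1//; split; lra.
  by rewrite clip_id; [split; lra|apply/andP; split; lra].
rewrite (@clip_id s); last by apply/andP; split; lra.
have [t1|t1] := leP 1 t; first by rewrite clip_ge1//; split; lra.
by rewrite clip_id; [split; lra|apply/andP; split; lra].
Qed.

Lemma clip_cont : continuous clip.
Proof.
move=> t; apply: continuous_min; first exact: cvg_cst.
by apply: continuous_max; [exact: cvg_cst|exact: cvg_id].
Qed.

Lemma nrm_e1_lip x (h : R) : `|nrm (x + h *: e1) - nrm x| <= `|h|.
Proof.
rewrite ler_norml; apply/andP; split.
  have := nrmD (x + h *: e1) (- (h *: e1)); rewrite addrK nrmN nrm_e1; lra.
by have := nrmD x (h *: e1); rewrite nrm_e1; lra.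
Qed.

Variables (k L : R) (u u1 u2 : R * R -> R).
Hypothesis ss : slit_solution k L u u1 u2.

(** The quadratic correction in [Vd] does not see horizontal shifts, so [Pd] is a plain difference
    of [Vd]. *)
Lemma PdE (h : R) x : Pd u h x = Vd L u h (x + h *: e1) - Vd L u h x.
Proof.
have E : x + h *: e1 + h *: e1 = x + (2 * h) *: e1.
  by rewrite -addrA -scalerDl; congr (_ + _ *: _); ring.
rewrite /Pd /Vd E.
have -> : (x + h *: e1).2 = x.2 by rewrite /= /GRing.scale/= mulr0 addr0.
by ring.
Qed.

(** Adapted to the second barrier ([dl = rho], [ep = k / 2]): equal to [1] on the part of its
    support with [k * nrm x <= 64 * rho], which contains its core, and varying at rate [1 / rho]. *)
Definition cutoff (rho : R) x : R :=
  clip (1 + 2 * (x.1 + k / 2 * nrm x - rho) / rho) * clip (2 - k * nrm x / (64 * rho)).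

Lemma cutoff_props (rho : R) : 0 < rho ->
  [/\ cc (cutoff rho), forall x, 0 <= cutoff rho x <= 1,
    forall x, rho < x.1 + k / 2 * nrm x -> k * nrm x <= 64 * rho -> cutoff rho x = 1,
    forall x, cutoff rho x != 0 -> rho / 2 < x.1 + k / 2 * nrm x /\ k * nrm x < 128 * rho &
    forall x h, `|cutoff rho (x + h *: e1) - cutoff rho x| <= 4 / rho * `|h|].
Proof.
move=> r0; have [k0 k1] := andP (ss_k ss).
have supp x : cutoff rho x != 0 -> rho / 2 < x.1 + k / 2 * nrm x /\ k * nrm x < 128 * rho.
  rewrite /cutoff => cx; split; rewrite ltNge; apply/negP => h.
    move: cx; rewrite clip_le0 ?mul0r ?eqxx//.
    have : 2 * (x.1 + k / 2 * nrm x - rho) / rho <= - 1; last by clear -ss; lra.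
    by rewrite ler_pdivrMr//; move: h; clear -ss; lra.
  move: cx; rewrite (@clip_le0 (2 - _)) ?mulr0 ?eqxx//.
  have : 2 <= k * nrm x / (64 * rho); last by clear -ss; lra.
  by rewrite ler_pdivlMr ?mulr_gt0//; move: h; clear -ss; lra.
have cn : continuous (@nrm R) := @nrm_cont R.
split => //.
- split; last first.
    exists (128 * rho / k) => x xb; apply/eqP; apply: contraT => /supp[_].
    rewrite mulrC -ltr_pdivlMr// => xr; have := norm_le_nrm x.
    by rewrite leNgt (lt_trans xr xb).
  move=> x; apply: cvgM.
    apply: (@continuous_comp _ _ _ (fun x : R * R => 1 + 2 * (x.1 + k / 2 * nrm x - rho) / rho) clip);
      last exact: clip_cont.
    apply: cvgD; first exact: cvg_cst.
    apply: cvgM; last exact: cvg_cst.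
    apply: cvgM; first exact: cvg_cst.
    apply: cvgB; last exact: cvg_cst.
    by apply: cvgD; [exact: cvg_fst|apply: cvgM; [exact: cvg_cst|exact: cn]].
  apply: (@continuous_comp _ _ _ (fun x : R * R => 2 - k * nrm x / (64 * rho)) clip);
    last exact: clip_cont.
  apply: cvgB; first exact: cvg_cst.
  apply: cvgM; last exact: cvg_cst.
  by apply: cvgM; [exact: cvg_cst|exact: cn].
- move=> x; rewrite /cutoff.
  have /andP[a0 a1] := clip01 (1 + 2 * (x.1 + k / 2 * nrm x - rho) / rho).
  have /andP[c0 c1] := clip01 (2 - k * nrm x / (64 * rho)).
  by rewrite mulr_ge0//= mulr_ile1.
- move=> x x1 xk; rewrite /cutoff !clip_ge1 ?mulr1//.
    have : k * nrm x / (64 * rho) <= 1; last by clear -ss; lra.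
    by rewrite ler_pdivrMr ?mulr_gt0// mul1r.
  rewrite lerDl; apply: divr_ge0; last exact: ltW.
  by move: x1; clear -ss; lra.
- move=> x h; rewrite /cutoff.
  set a' := clip _; set c' := clip _; set a := clip _; set c := clip _.
  have /andP[a0 a1] : 0 <= a <= 1 := clip01 _.
  have /andP[c'0 c'1] : 0 <= c' <= 1 := clip01 _.
  have rV : 0 < rho^-1 by rewrite invr_gt0.
  have nl := nrm_e1_lip x h.
  have l1 : `|a' - a| <= 3 / rho * `|h|.
    apply: le_trans (clip_lip _ _) _.
    rewrite (_ : _ - _ = (2 * h + k * (nrm (x + h *: e1) - nrm x)) / rho); last first.
      by rewrite /= /GRing.scale/=; field; rewrite gt_eqF.
    rewrite normrM (gtr0_norm rV) [leRHS]mulrAC; apply: ler_wpM2r; first exact: ltW.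
    apply: le_trans (ler_normD _ _) _; rewrite !normrM (gtr0_norm k0) (ger0_norm (_ : 0 <= 2))//.
    have : k * `|nrm (x + h *: e1) - nrm x| <= 1 * `|h| by apply: ler_pM => //; exact: ltW.
    by clear -ss; lra.
  have l2 : `|c' - c| <= 1 / rho * `|h|.
    apply: le_trans (clip_lip _ _) _.
    rewrite (_ : _ - _ = - (k / 64 * (nrm (x + h *: e1) - nrm x)) / rho); last first.
      by field; rewrite gt_eqF.
    rewrite normrM (gtr0_norm rV) [leRHS]mulrAC; apply: ler_wpM2r; first exact: ltW.
    rewrite normrN normrM (ger0_norm (_ : 0 <= k / 64)); last by apply: divr_ge0 => //; exact: ltW.
    by apply: ler_pM => //; [apply: divr_ge0 => //; exact: ltW|move: k1; clear -ss; lra].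
  rewrite (_ : a' * c' - a * c = (a' - a) * c' + a * (c' - c)); last by ring.
  apply: le_trans (ler_normD _ _) _; rewrite !normrM (ger0_norm c'0) (ger0_norm a0).
  have m1 : `|a' - a| * c' <= `|a' - a| by rewrite ler_piMr.
  have m2 : a * `|c' - c| <= `|c' - c| by rewrite ler_piMl.
  by move: l1 l2 m1 m2; clear -ss; lra.
Qed.

(** Summation by parts: the horizontal difference of [Vd] passes to the cutoff, which changes by at
    most [4 * h / rho]. The bound for [Vd] thus gains a factor of order [h / rho]. *)
Lemma Pd_cutoff_bound : exists C r1 : R, [/\ 0 < C, 0 < r1 & forall rho, 0 < rho < r1 ->
  exists2 h1, 0 < h1 & forall h, 0 < h < h1 ->
    cc (fun x => Pd u h x * cutoff rho x) /\
    I2 (fun x => Pd u h x * cutoff rho x) <= C * h ^+ 2 * rho ^+ 3].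
Proof.
have [k0 k1] := andP (ss_k ss).
have [C [r1 [C0 r10 main]]] := Vd_integral_bound ss.
have k10 : 0 < k / 1000 by move: k0; clear -ss; lra.
have [r2 r20 [r2r1 r2k _]] := ex_min3 r10 k10 k10.
exists (4 * C), r2; split => //; first exact: mulr_gt0.
move=> rho /andP[rho0 rhor2].
have rhor1 : 0 < rho < r1 by rewrite rho0 (lt_le_trans rhor2).
have rhok : rho < k / 1000 by exact: lt_le_trans r2k.
have [h1 h10 {}main] := main rho rhor1.
have rho8 : 0 < rho / 8 by exact: divr_gt0.
have e16 : 0 < 1 / 16 :> R by exact: divr_gt0.
have [h2 h20 [h2h1 h2r h28]] := ex_min3 h10 rho8 e16.
exists h2 => // h /andP[h0 hh2].
have hh1 : 0 < h < h1 by rewrite h0 (lt_le_trans hh2).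
have hr : h < rho / 8 by exact: lt_le_trans h2r.
have h8 : 0 < h < 1 / 8 by rewrite h0; move: hh2 h28; clear -ss; lra.
have [cX X01 _ Xs Xl] := cutoff_props rho0.
have kr x : k * nrm x < 200 * rho -> nrm x < 1 / 4.
  move=> kx; have : k * nrm x < k * (1 / 4) by move: kx rhok k0; clear -ss; lra.
  by rewrite ltr_pM2l.
have Xn x : cutoff rho x != 0 -> nrm x < 1 / 4.
  by move=> /Xs[_ kx]; apply: kr; move: kx rho0; clear -ss; lra.
have cX' : cc (fun x => cutoff rho (x - h *: e1)) := cc_shift _ cX.
(* A shift by [h < rho / 8] costs little: the bounds [rho / 2] and [128 * rho] of the cutoff support
   relax to [rho / 4] and [192 * rho]. *)
have X'n x : cutoff rho (x - h *: e1) != 0 ->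
    [/\ rho / 4 <= x.1 + k / 2 * nrm x & k * nrm x <= 192 * rho].
  move=> /Xs[]; have := nrm_e1_lip x (- h); rewrite scaleNr normrN (gtr0_norm h0).
  rewrite ler_norml => /andP[n1 n2].
  have -> : (x - h *: e1).1 = x.1 - h by rewrite /= /GRing.scale/= mulr1.
  have m1 : k * (nrm (x - h *: e1) - nrm x) <= k * h by apply: ler_wpM2l => //; exact: ltW.
  have m2 : k * (nrm x - h) <= k * nrm (x - h *: e1).
    by apply: ler_wpM2l; [exact: ltW|move: n1; clear -ss; lra].
  have m3 : k * h <= 1 * h by apply: ler_wpM2r; exact: ltW.
  by move: m1 m2 m3 hr; clear -ss; split; lra.
(* The absolute difference of the cutoffs, normalised to values in [[0, 1]] so that
   [Vd_integral_bound] applies. *)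
pose f x := `|cutoff rho (x - h *: e1) - cutoff rho x| * (rho / (4 * h)).
have q0 : 0 < rho / (4 * h) by apply: divr_gt0 => //; exact: mulr_gt0.
have cf : cc f.
  split.
    move=> x; apply: cvgM; last exact: cvg_cst.
    apply: (@continuous_comp _ _ _ (fun x => cutoff rho (x - h *: e1) - cutoff rho x) (fun t : R => `|t|)).
      exact: (cc_cont (ccB cX' cX)).
    exact: norm_continuous.
  have [M M0 XM] := cc_pos (ccB cX' cX); exists M => x /XM.
  by rewrite /f => ->; rewrite normr0 mul0r.
have f01 x : 0 <= f x <= 1.
  apply/andP; split; first by apply: mulr_ge0 => //; exact: ltW.
  rewrite /f -scaleNr; apply: (@le_trans _ _ (4 / rho * `|- h| * (rho / (4 * h)))).
    by apply: ler_wpM2r; [exact: ltW|exact: Xl].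
  rewrite normrN (gtr0_norm h0) le_eqVlt; apply/orP; left; apply/eqP.
  by field; rewrite !gt_eqF.
have fK x : f x != 0 -> [/\ - (k / 2) * nrm x <= x.1, rho / 8 <= nrm x & nrm x <= 192 / k * rho].
  have [x0 /= |x0 _] := eqVneq (cutoff rho (x - h *: e1)) 0; last first.
    have [a1 a2] := X'n x x0.
    have a3 := fst_le_nrm x.
    have a4 : k * nrm x <= 1 * nrm x by apply: ler_wpM2r; [exact: nrm_ge0|exact: ltW].
    split; [move: a1 rho0; clear -ss; lra|move: a1 a3 a4 rho0; clear -ss; lra|].
    by rewrite mulrAC ler_pdivlMr// mulrC.
  have [x1|x1 _] := eqVneq (cutoff rho x) 0.
    by rewrite /f x0 x1 subr0 normr0 mul0r eqxx.
  have [a1 a2] := Xs x x1.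
  have a3 := fst_le_nrm x.
  have a4 : k * nrm x <= 1 * nrm x by apply: ler_wpM2r; [exact: nrm_ge0|exact: ltW].
  split; [move: a1 rho0; clear -ss; lra|move: a1 a3 a4 rho0; clear -ss; lra|].
  by rewrite mulrAC ler_pdivlMr// mulrC; move: a2 rho0; clear -ss; lra.
have [cVf V0 IVf] := main h hh1 f cf f01 fK.
have cVX : cc (fun x => Vd L u h x * cutoff rho x) by exact: (cc_Vd_mul ss).
have cVX' : cc (fun x => Vd L u h x * cutoff rho (x - h *: e1)).
  by apply: (cc_Vd_mul ss) => // x /X'n[_ kx]; apply: kr; move: kx rho0; clear -ss; lra.
have E : (fun x => Pd u h x * cutoff rho x) =
  (fun x => Vd L u h (x + h *: e1) * cutoff rho (x + h *: e1 - h *: e1) -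
            Vd L u h x * cutoff rho x).
  by apply/funext => x; rewrite PdE addrK mulrBl.
have cs := cc_shift (h *: e1) cVX'.
split; first by rewrite E; exact: ccB.
rewrite E I2B// (I2_shift (h *: e1) cVX') -I2B//.
apply: (@le_trans _ _ (I2 (fun x => 4 * h / rho * (Vd L u h x * f x)))).
  apply: le_I2; [exact: ccB|exact: ccZ|] => x.
  rewrite -mulrBr.
  have -> : 4 * h / rho * (Vd L u h x * f x) =
     Vd L u h x * `|cutoff rho (x - h *: e1) - cutoff rho x|.
    by rewrite /f; field; rewrite !gt_eqF.
  have [fx|fx] := eqVneq (f x) 0.
    have -> : cutoff rho (x - h *: e1) - cutoff rho x = 0.
      by apply/eqP; rewrite -normr_eq0; move/eqP: fx; rewrite /f mulf_eq0 (gt_eqF q0) orbF.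
    by rewrite normr0.
  by apply: ler_wpM2l; [exact: V0|exact: ler_norm].
rewrite I2Z//.
have p0 : 0 <= 4 * h / rho by apply: divr_ge0; [apply: mulr_ge0|] => //; exact: ltW.
apply: le_trans (ler_wpM2l p0 IVf) _; rewrite le_eqVlt; apply/orP; left; apply/eqP.
by field; rewrite gt_eqF.
Qed.
End SecondDifferenceBound.

(** * Integral bound for the second difference near a fixed axis point *)

Section SecondDifferenceVanishes.
Context {R : realType}.
Local Notation e1 := ((1, 0) : R * R).
Implicit Types x y v : R * R.

(** The constant comes from the second barrier: near [s0 *: e1] its main factor is at least
    [1 / 8 * 1 / 16 * s0^(- b)], which must reach [2]. *)
Lemma small_scale (b : R) : 1 / 2 <= b ->
  exists s0 : R, [/\ 0 < s0, s0 <= 1 / 16 & 256 <= s0 `^ (- b)].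
Proof.
move=> b0; have [c cE] : exists c : R, c = 256 by eexists.
have c1 : 1 <= c by rewrite cE; lra.
exists (c `^ (- (2))); split; first by apply: powR_gt0; lra.
  apply: (@le_trans _ _ (c `^ (- 1))); first by apply: ler_powR => //; lra.
  by rewrite powR_inv1 ?cE; lra.
rewrite -powRrM -cE -[leLHS]powRr1; last by lra.
by apply: ler_powR => //; lra.
Qed.

Variables (k L : R) (u u1 u2 : R * R -> R).
Hypothesis ss : slit_solution k L u u1 u2.

Lemma near_axis_point (s0 : R) x : 0 < s0 <= 1 / 16 -> `|x - s0 *: e1| <= s0 / 2 ->
  [/\ s0 / 2 <= x.1, s0 / 2 <= nrm x, nrm x <= 2 * s0 & nrm x < 1 / 4].
Proof.
move=> /andP[s00 s01] xs; have := norm_fst (x - s0 *: e1).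
have -> : (x - s0 *: e1).1 = x.1 - s0 by rewrite /= /GRing.scale/= mulr1.
move=> h; have h1 := le_trans h xs; have {}h1 : s0 / 2 <= x.1.
  by move: h1; rewrite ler_norml => /andP[]; clear -ss; lra.
have h2 := fst_le_nrm x.
have := nrm_lip (s0 *: e1) x; rewrite nrm_e1 (gtr0_norm s00) ler_norml => /andP[_ h3].
by split; move: h1 h2 h3 xs s01; clear -ss; lra.
Qed.

(** The barrier with [dl = rho], fixed height and fixed outer radius. Its Laplacian integrates to
    zero against [Pd], so the mass near [s0 *: e1], where the Laplacian is bounded below, is paid
    for by the core at scale [rho], where [Pd_cutoff_bound] applies. *)
Lemma Pd_integral_bound : exists C s0 r1 : R,
  [/\ 0 < C, 0 < s0 <= 1 / 16, 0 < r1 & forall rho, 0 < rho < r1 ->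
  exists2 h1, 0 < h1 & forall h, 0 < h < h1 -> forall f, cc f ->
    (forall x, 0 <= f x <= 1) -> (forall x, f x != 0 -> `|x - s0 *: e1| <= s0 / 2) ->
    I2 (fun x => Pd u h x * f x) <= C * h ^+ 2 * rho `^ (k / 16)].
Proof.
have kk := ss_k ss; have L0 := ss_L ss; have [k0 k1] := andP kk.
have [b [b01 bep bE]] : exists b, [/\ 15 / 16 <= b < 1,
    1 + (k / 2) / 4 <= b ^+ 2 * (1 + k / 2) & 1 - b = k / 16].
  exists (1 - k / 16); have [? _ ?] := barrier_exponent kk; split => //.
  by rewrite opprB addrC subrK.
have [b0 b1] := andP b01.
have bh : 1 / 2 <= b by move: b0; clear -ss; lra.
have [s0 [s00 s016 s0b]] := small_scale bh.
have s0P : 0 < s0 <= 1 / 16 by rewrite s00.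
have [C [r1 [C0 r10 main]]] := Pd_cutoff_bound ss.
have ks0 : 0 < k * s0 / 256 by move: (mulr_gt0 k0 s00); clear -ss; lra.
have s04 : 0 < s0 / 4 by move: s00; clear -ss; lra.
have [r2 r20 [r2r1 r2k r2s]] := ex_min3 r10 ks0 s04.
exists (128 / (3 * k) * (48 * C)), s0, r2; split => //.
  have : 0 < k^-1 * C by apply: mulr_gt0 => //; rewrite invr_gt0.
  rewrite (_ : 128 / (3 * k) * (48 * C) = 128 / 3 * 48 * (k^-1 * C)); last first.
    by field; rewrite gt_eqF.
  by clear -ss; lra.
move=> rho /andP[rho0 rhor2].
have rhor1 : 0 < rho < r1 by rewrite rho0 (lt_le_trans rhor2).
have rhok : rho < k * s0 / 256 by exact: lt_le_trans r2k.
have rhos : rho < s0 / 4 by exact: lt_le_trans r2s.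
have [h1 h10 {}main] := main rho rhor1.
have e8 : 0 < 1 / 8 :> R by clear -ss; lra.
have [h2 h20 [h2h1 h28 _]] := ex_min3 h10 e8 e8.
exists h2 => // h /andP[h0 hh2] f cf f01 fK.
have hh1 : 0 < h < h1 by rewrite h0 (lt_le_trans hh2).
have h8 : h < 1 / 8 by exact: lt_le_trans h28.
have h08 : 0 < h < 1 / 8 by rewrite h0.
have [cPX IPX] := main h hh1.
have ep01 : 0 < k / 2 <= 1 by move: k0 k1; clear -ss; lra.
have A0 : 0 < 1 / 8 :> R by clear -ss; lra.
have R00 : 0 < 1 / 2 :> R by clear -ss; lra.
have tau0 : 0 < rho / 4 by move: rho0; clear -ss; lra.
have AR : 2 * (1 / 8) <= (1 / 2) `^ b :> R.
  rewrite !div1r -[b]opprK half_powRN.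
  apply: (@le_trans _ _ (2 `^ (- 2%:R))); last by apply: ler_powR; move: b1; clear -ss; lra.
  by rewrite powR_invn// !expr2; clear -ss; lra.
have [|T [T1 [T2 [T11 [T22 [tf TB Wge0 Wge Wlow]]]]]] :=
    @barrier R (k / 2) b rho (1 / 8) ep01 b01 bep rho0 A0 (Omr k (3 / 4)) (1 / 2) (rho / 4)
      R00 tau0 AR.
  have kle : 0 < k <= 1 by rewrite k0 ltW.
  have k2 : k / 2 <= k by move: k0; clear -ss; lra.
  move=> x hx xR y yx; have [y1 y2] := Om_margin kle k2 hx xR yx.
  by split => //; move: y2 rhos s016; clear -ss; lra.
have [cPW IPW] : cc (fun x => Pd u h x * (T11 x + T22 x)) /\
    I2 (fun x => Pd u h x * (T11 x + T22 x)) = 0.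
  by apply: (I2_Pd ss _ _ tf); [exact: ltW|move: h8; clear -ss; lra].
have far x : ~ (rho < x.1 + k / 2 * nrm x /\ nrm x < 1 / 2) -> T11 x + T22 x = 0.
  by have [_ _ h'] := TB x; move=> /h'[].
have cPf : cc (fun x => Pd u h x * f x).
  by apply: (cc_Pd_mul ss) => // x /fK /(near_axis_point s0P)[].
have [cX X01 X1 Xs _] := cutoff_props ss rho0.
have [c' c'E] : exists c', c' = 24 * (1 / 8) * rho * (rho / 2) `^ (- (3 + b)) by eexists.
rewrite -c'E in Wge.
have c'0 : 0 <= c'.
  rewrite c'E; apply: mulr_ge0; last exact: powR_ge0.
  by move: rho0; clear -ss; lra.
have R64 x : 32 * rho / (k / 2) <= nrm x <-> 64 * rho <= k * nrm x.
  rewrite ler_pdivrMr; last by case/andP: ep01.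
  by split; clear -ss; lra.
(* Three regions: outside radius [1 / 2] everything vanishes; in the core the cutoff is [1] on the
   support and [c'] absorbs the negative Laplacian; elsewhere the Laplacian is nonnegative, and at
   least [3 * k / 128] near [s0 *: e1]. *)
have point x : 3 * k / 128 * (Pd u h x * f x) <=
    Pd u h x * (T11 x + T22 x) + c' * (Pd u h x * cutoff k rho x).
  have [xR|xR] := ltP (nrm x) (1 / 2); last first.
    have -> : f x = 0.
      apply/eqP; apply: contraT => /fK /(near_axis_point s0P)[_ _ _].
      by move: xR; clear -ss; lra.
    rewrite (far x); last by move=> [_]; rewrite ltNge xR.
    have -> : cutoff k rho x = 0; last by rewrite !mulr0 addr0.
    apply/eqP; apply: contraT => /Xs[_ kx].
    have : k * (1 / 2) <= k * nrm x by apply: ler_wpM2l => //; exact: ltW.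
    have : k * s0 <= k * (1 / 16) by apply: ler_wpM2l => //; exact: ltW.
    by move: kx rhok k0; clear -ss; lra.
  have P0 : 0 <= Pd u h x.
    by apply: (Pd_ge0 ss); [exact: ltW|move: xR h8; clear -ss; lra].
  have /andP[x0 x1] := X01 x.
  have [/R64 xf|xf] := leP (64 * rho) (k * nrm x); last first.
    have -> : f x = 0.
      apply/eqP; apply: contraT => /fK /(near_axis_point s0P)[_ a _ _].
      have : k * (s0 / 2) <= k * nrm x by apply: ler_wpM2l => //; exact: ltW.
      by move: xf rhok (mulr_gt0 k0 s00); clear -ss; lra.
    rewrite !mulr0.
    have [[a1 a2]|nx] := pselect (rho < x.1 + k / 2 * nrm x /\ nrm x < 1 / 2); last first.
      by rewrite (far x nx) mulr0 add0r mulr_ge0// mulr_ge0.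
    rewrite (X1 x a1 (ltW xf)) mulr1 [c' * _]mulrC -mulrDr; apply: mulr_ge0 => //.
    by have := Wge x; clear -ss; lra.
  have W0 := Wge0 x xf.
  have B0 : 0 <= c' * (Pd u h x * cutoff k rho x) by rewrite mulr_ge0// mulr_ge0.
  have [->|fx] := eqVneq (f x) 0; first by rewrite !mulr0 addr_ge0// mulr_ge0.
  have [a1 a2 a3 a4] := near_axis_point s0P (fK x fx).
  have /andP[f0 f1] := f01 x.
  suff cW : 3 * k / 128 <= T11 x + T22 x.
    rewrite mulrCA -[leLHS]addr0; apply: lerD => //; apply: ler_wpM2l => //.
    by apply: le_trans cW; rewrite ler_piMr//; move: k0; clear -ss; lra.
  have r0 : 0 < nrm x by move: a2 s00; clear -ss; lra.
  have np (t : R) : 0 <= t -> nrm x `^ t <= (2 * s0) `^ t.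
    by move=> t0; apply: ge0_ler_powR => //; rewrite nnegrE ?(ltW r0)//; move: s00; clear -ss; lra.
  have s20 : 0 < 2 * s0 by exact: mulr_gt0.
  apply: le_trans (Wlow x xf _).
    have : 1 <= nrm x `^ (- (2 + b)).
      rewrite powRN invf_ge1 ?powR_gt0//.
      have b2 : 0 <= 2 + b by move: b0; clear -ss; lra.
      apply: (@le_trans _ _ (1 `^ (2 + b))); last by rewrite powR1.
      by apply: ge0_ler_powR => //; rewrite ?nnegrE ?(ltW r0)//; move: a4; clear -ss; lra.
    move=> n1; have : 3 * k / 128 * 1 <= 3 * k / 128 * nrm x `^ (- (2 + b)).
      by apply: ler_wpM2l => //; move: k0; clear -ss; lra.
    by clear -ss; lra.
  have n1 : 1 / 4 * s0 `^ (- (1 + b)) <= nrm x `^ (- (1 + b)).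
    apply: (@le_trans _ _ ((2 * s0) `^ (- (1 + b)))).
      rewrite powRM ?(ltW s00)//; apply: ler_wpM2r; first exact: powR_ge0.
      apply: (@le_trans _ _ (2 `^ (- 2%:R))).
        by rewrite powR_invn// !expr2; clear -ss; lra.
      by apply: ler_powR; move: b1; clear -ss; lra.
    rewrite !powRN lef_pV2 ?posrE ?powR_gt0//; apply: np.
    by move: b0; clear -ss; lra.
  have p1 : s0 / 4 <= x.1 + k / 2 * nrm x - rho.
    by move: a1 rhos (mulr_gt0 k0 r0); clear -ss; lra.
  have q0 : 0 <= 1 / 4 * s0 `^ (- (1 + b)).
    by apply: mulr_ge0; [clear -ss; lra|exact: powR_ge0].
  have q1 : 0 <= s0 / 4 by exact: ltW.
  have := ler_pM q0 q1 n1 p1.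
  rewrite (_ : 1 / 4 * s0 `^ (- (1 + b)) * (s0 / 4) = 1 / 16 * s0 `^ (- b)); last first.
    rewrite (_ : - b = - (1 + b) + 1); last by ring.
    by rewrite powR_split// (powRr1 (ltW s00)); field.
  by move: s0b; clear -ss; lra.
have le1 : 3 * k / 128 * I2 (fun x => Pd u h x * f x) <= c' * (C * h ^+ 2 * rho ^+ 3).
  rewrite -I2Z//.
  apply: (@le_trans _ _ (I2 (fun x => Pd u h x * (T11 x + T22 x) + c' * (Pd u h x * cutoff k rho x)))).
    by apply: le_I2 => //; [exact: ccZ|apply: ccD => //; exact: ccZ].
  rewrite I2D//; last exact: ccZ.
  by rewrite IPW add0r I2Z//; apply: ler_wpM2l.
(* The deficit [c'] is of order [rho^(- 2 - b)]; against [rho ^+ 3] it leaves the positive power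
   [1 - b]. *)
have le2 : c' * rho ^+ 3 <= 48 * rho `^ (k / 16).
  rewrite c'E -bE.
  have -> : rho `^ (1 - b) = rho ^+ 4 * rho `^ (- (3 + b)).
    by rewrite -powR_mulrn ?(ltW rho0)// -powR_split//; congr (_ `^ _); ring.
  have P0 : 0 <= 3 * rho ^+ 4.
    by apply: mulr_ge0 => //; apply: exprn_ge0; exact: ltW.
  have := ler_wpM2l P0 (half_powR_le b01 rho0).
  by clear -ss; lra.
have Ch : 0 <= C * h ^+ 2 by apply: mulr_ge0; [exact: ltW|exact: sqr_ge0].
have le3 := ler_wpM2l Ch le2.
have k3 : 0 < 3 * k / 128 by move: k0; clear -ss; lra.
have {}le1 : 3 * k / 128 * I2 (fun x => Pd u h x * f x) <= C * h ^+ 2 * (48 * rho `^ (k / 16)).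
  apply: le_trans le3; apply: le_trans le1 _.
  by rewrite le_eqVlt; apply/orP; left; apply/eqP; ring.
move: le1; rewrite mulrC -ler_pdivlMr// => le1; apply: le_trans le1 _.
rewrite le_eqVlt; apply/orP; left; apply/eqP.
by field; rewrite gt_eqF.
Qed.
End SecondDifferenceVanishes.

(** * Passage from small steps to all steps *)

Section SecondDifferenceZeroSomewhere.
Context {R : realType}.
Local Notation e1 := ((1, 0) : R * R).
Implicit Types x y v : R * R.

(** With [S] the shift by [h], this is [(S^2 - 1)^2 = (S - 1)^2 (S + 1)^2]. The weights [1, 2, 1]
    add up to [4], the factor by which the square of the step grows. *)
Lemma PdD (u : R * R -> R) (h : R) x :
  Pd u (2 * h) x = Pd u h x + 2 * Pd u h (x + h *: e1) + Pd u h (x + (2 * h) *: e1).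
Proof.
have E (a c : R) : x + a *: e1 + c *: e1 = x + (a + c) *: e1 by rewrite -addrA -scalerDl.
rewrite /Pd !E.
have -> : h + 2 * h = 3 * h by ring.
have -> : 2 * h + 2 * h = 2 * (2 * h) by ring.
have -> : h + h = 2 * h by ring.
have -> : 2 * h + h = 3 * h by ring.
ring.
Qed.

Lemma powR_small (a e r1 : R) : 0 < a -> 0 < e -> 0 < r1 ->
  exists2 r, 0 < r < r1 & r `^ a <= e.
Proof.
move=> a0 e0 r10; pose r := Num.min (r1 / 2) (e `^ a^-1).
have ea : 0 < e `^ a^-1 by exact: powR_gt0.
have r0 : 0 < r by rewrite lt_min ea divr_gt0.
exists r.
  rewrite r0/=; apply: (@le_lt_trans _ _ (r1 / 2)); first by rewrite ge_min lexx.
  by clear -r10; lra.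
rewrite -[leRHS]powRr1 ?(ltW e0)// -(@mulVf _ a) ?gt_eqF// powRrM.
apply: ge0_ler_powR; rewrite ?nnegrE ?(ltW a0) ?(ltW r0) ?(ltW ea)//.
by rewrite ge_min lexx orbT.
Qed.

Variables (k L : R) (u u1 u2 : R * R -> R).
Hypothesis ss : slit_solution k L u u1 u2.

(** The admissible support shrinks by [2 * h], the largest shift in [PdD]: a function admissible for
    [2 * h] has all its shifts admissible for [h]. *)
Let bounded_at (s0 K h : R) := forall f, cc f -> (forall x, 0 <= f x <= 1) ->
  (forall x, f x != 0 -> `|x - s0 *: e1| <= s0 / 2 - 2 * h) ->
  I2 (fun x => Pd u h x * f x) <= K * h ^+ 2.

(* Iterating, a bound for small steps holds for all steps with the same constant. *)
Lemma Pd_bound_double (s0 K h : R) : 0 < s0 <= 1 / 16 -> 0 < h < 1 / 16 ->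
  bounded_at s0 K h -> bounded_at s0 K (2 * h).
Proof.
move=> s01 /andP[h0 h1] H f cf f01 fs.
have inq x : `|x - s0 *: e1| <= s0 / 2 - 2 * h -> nrm x < 1 / 4.
  move=> xs; have [|_ _ _ //] := @near_axis_point _ s0 x s01.
  by move: xs h0; clear -ss; lra.
have h8 : 0 < h < 1 / 8 by rewrite h0; move: h1; clear -ss; lra.
have sh (c : R) (x : R * R) : 0 <= c <= 2 * h -> f (x - c *: e1) != 0 -> `|x - s0 *: e1| <= s0 / 2 - 2 * h.
  move=> /andP[c0 c2] /fs xs.
  have -> : x - s0 *: e1 = x - c *: e1 - s0 *: e1 + c *: e1 by rewrite [x - c *: _ - _]addrAC subrK.
  apply: le_trans (norm_e1D _ _) _; rewrite (ger0_norm c0).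
  by move: xs c2; clear -ss; lra.
have B c : 0 <= c <= 2 * h -> cc (fun x => Pd u h (x + c *: e1) * f x) /\
    I2 (fun x => Pd u h (x + c *: e1) * f x) <= K * h ^+ 2.
  move=> c2; have cfc : cc (fun x => f (x - c *: e1)) := cc_shift _ cf.
  have cP : cc (fun x => Pd u h x * f (x - c *: e1)).
    by apply: (cc_Pd_mul ss) => // x /(sh _ _ c2)/inq.
  have E : (fun x => Pd u h (x + c *: e1) * f x) =
      (fun x => Pd u h (x + c *: e1) * f (x + c *: e1 - c *: e1)).
    by apply/funext => x; rewrite addrK.
  rewrite E; split; first exact: (cc_shift (c *: e1) cP).
  rewrite (I2_shift (c *: e1) cP); apply: H => // x; exact: sh.
have [c0 B0] : cc (fun x => Pd u h (x + 0 *: e1) * f x) /\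
    I2 (fun x => Pd u h (x + 0 *: e1) * f x) <= K * h ^+ 2.
  by apply: B; rewrite lexx; move: h0; clear -ss; lra.
have [c1 B1] : cc (fun x => Pd u h (x + h *: e1) * f x) /\
    I2 (fun x => Pd u h (x + h *: e1) * f x) <= K * h ^+ 2.
  by apply: B; rewrite (ltW h0)/=; move: h0; clear -ss; lra.
have [c2 B2] : cc (fun x => Pd u h (x + (2 * h) *: e1) * f x) /\
    I2 (fun x => Pd u h (x + (2 * h) *: e1) * f x) <= K * h ^+ 2.
  by apply: B; rewrite lexx andbT; move: h0; clear -ss; lra.
have -> : (fun x => Pd u (2 * h) x * f x) = (fun x =>
   (Pd u h (x + 0 *: e1) * f x + 2 * (Pd u h (x + h *: e1) * f x)) +
    Pd u h (x + (2 * h) *: e1) * f x).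
  by apply/funext => x; rewrite PdD scale0r addr0; ring.
rewrite I2D//; last by apply: ccD => //; exact: ccZ.
rewrite I2D//; last exact: ccZ.
rewrite I2Z// (_ : (2 * h) ^+ 2 = 4 * h ^+ 2); last by ring.
by move: B0 B1 B2; clear -ss; lra.
Qed.

(** For each [rho] the step [t / 2 ^+ n] is small enough for [Pd_integral_bound], and [n] doublings
    return to [t] with an unchanged constant. That constant tends to [0] with [rho], while the
    integrand is continuous and nonnegative. *)
Lemma Pd_zero_somewhere : exists s0 : R, 0 < s0 <= 1 / 16 /\
  forall t y, 0 < t < s0 / 8 -> `|y - s0 *: e1| < s0 / 8 -> Pd u t y = 0.
Proof.
have [C [s0 [r1 [C0 s01 r10 main]]]] := Pd_integral_bound ss.
exists s0; split => // t y /andP[t0 ts] ys; have [s00 s016] := andP s01.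
have [k0 k1] := andP (ss_k ss).
pose f x : R := clip (2 - 8 * `|x - s0 *: e1| / s0).
have fE x : f x != 0 -> `|x - s0 *: e1| <= s0 / 4.
  move=> fx; rewrite leNgt; apply/negP => xs; move: fx; rewrite /f clip_le0 ?eqxx//.
  have : 2 <= 8 * `|x - s0 *: e1| / s0; last by clear -ss; lra.
  by rewrite ler_pdivlMr//; move: xs; clear -ss; lra.
have cf : cc f.
  split.
    move=> x; apply: (@continuous_comp _ _ _ (fun x => 2 - 8 * `|x - s0 *: e1| / s0) clip);
      last exact: clip_cont.
    apply: cvgB; first exact: cvg_cst.
    apply: cvgM; last exact: cvg_cst.
    apply: cvgM; first exact: cvg_cst.
    apply: (@continuous_comp _ _ _ (fun x : R * R => x - s0 *: e1) (fun x => `|x|)).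
      by apply: cvgB; [exact: cvg_id|exact: cvg_cst].
    exact: norm_continuous.
  exists (2 * s0) => x xs; apply/eqP; apply: contraT => /fE.
  have := ler_normD (x - s0 *: e1) (s0 *: e1).
  rewrite subrK normrZ norm_e1 mulr1 (gtr0_norm s00).
  by move: xs s00; clear -ss; lra.
have f01 x : 0 <= f x <= 1 by exact: clip01.
have t16 : t < 1 / 64 by move: ts s016; clear -ss; lra.
have bnd rho : 0 < rho < r1 -> I2 (fun x => Pd u t x * f x) <= C * rho `^ (k / 16) * t ^+ 2.
  move=> rhor; have [h1 h10 {}main] := main rho rhor.
  have [n nP] : exists n, t / 2 ^+ n < h1.
    pose n := Num.truncn (t / h1).
    exists n.+1; rewrite ltr_pdivrMr ?exprn_gt0// mulrC -ltr_pdivrMr//.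
    apply: lt_le_trans (truncnS_gt _) _.
    by rewrite -natrX ler_nat ltnW// ltn_expl.
  have step m : (m <= n)%N -> bounded_at s0 (C * rho `^ (k / 16)) (t / 2 ^+ n * 2 ^+ m).
    elim: m => [_|m IH mn].
      rewrite expr0 mulr1 => g cg g01 gs.
      apply: le_trans (main _ _ g cg g01 _) _; last by rewrite mulrAC.
        by rewrite nP andbT; apply: divr_gt0 => //; exact: exprn_gt0.
      move=> x /gs xs; apply: le_trans xs _.
      by rewrite gerBl; apply: mulr_ge0 => //; apply: divr_ge0; [exact: ltW|exact: exprn_ge0].
    rewrite exprS mulrCA; apply: Pd_bound_double => //; last by apply: IH; exact: ltnW.
    apply/andP; split.
      by apply: mulr_gt0; [apply: divr_gt0 => //|]; exact: exprn_gt0.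
    apply: (@le_lt_trans _ _ t); last by move: t16; clear -ss; lra.
    rewrite mulrAC ler_pdivrMr ?exprn_gt0//; apply: ler_wpM2l; first exact: ltW.
    by rewrite ler_weXn2l ?ler1n// ltnW.
  have := step n (leqnn n); rewrite divfK ?gt_eqF ?exprn_gt0//; apply => //.
  by move=> x /fE xs; apply: le_trans xs _; move: ts; clear -ss; lra.
have supp x : f x != 0 -> nrm x < 1 / 4.
  move=> /fE xs; have [|_ _ _ //] := @near_axis_point _ s0 x s01.
  by apply: le_trans xs _; move: s00; clear -ss; lra.
have cPf : cc (fun x => Pd u t x * f x).
  by apply: (cc_Pd_mul ss) => //; rewrite t0; move: t16; clear -ss; lra.
have I0 : I2 (fun x => Pd u t x * f x) <= 0.
  rewrite leNgt; apply/negP => Ipos.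
  have B0 : 0 < C * t ^+ 2 by apply: mulr_gt0 => //; exact: exprn_gt0.
  have [|||r rr rP] := @powR_small (k / 16) (I2 (fun x => Pd u t x * f x) / (2 * (C * t ^+ 2))) r1.
  - by move: k0; clear -ss; lra.
  - by apply: divr_gt0 => //; apply: mulr_gt0.
  - by [].
  have := bnd r rr; rewrite mulrAC; apply/negP; rewrite -ltNge.
  move: rP; rewrite ler_pdivlMr; last exact: mulr_gt0.
  by move: Ipos; clear -ss; lra.
have P0 x : 0 <= Pd u t x * f x.
  have [->|fx] := eqVneq (f x) 0; first by rewrite mulr0.
  apply: mulr_ge0; last by have /andP[] := f01 x.
  apply: (Pd_ge0 ss); first exact: ltW.
  by have := supp _ fx; move: t16; clear -ss; lra.
have := I2_eq0 cPf P0 I0 y; rewrite /f clip_ge1 ?mulr1//.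
have : 8 * `|y - s0 *: e1| / s0 <= 1; last by clear -ss; lra.
by rewrite ler_pdivrMr// mul1r; move: ys; clear -ss; lra.
Qed.
End SecondDifferenceZeroSomewhere.

(** * Propagation through the sector *)

Section Propagation.
Context {R : realType}.
Implicit Types x y v : R * R.

Section RadialTest.
Variables (s A : R).
Hypotheses (s0 : 0 < s).

Let V x := (sqn x + s)^-1.
Let w x := A * V x - 1.
Let w1 x := - A * (V x * V x * (2 * x.1)).
Let w2 x := - A * (V x * V x * (2 * x.2)).
Let w11 x := - A * (V x * V x * 2 - 2 * (V x * V x * V x) * (2 * x.1) * (2 * x.1)).
Let w22 x := - A * (V x * V x * 2 - 2 * (V x * V x * V x) * (2 * x.2) * (2 * x.2)).

Let qs x : 0 < sqn x + s. Proof. by apply: ltr_wpDl; [exact: sqn_ge0|]. Qed.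

Lemma radial_derivs x :
  C2_at w w1 w2 w11 w22 x.
Proof.
have f1 := is_derive_fst1 x; have s2 := is_derive_snd2 x.
have q0 : sqn x + s != 0 by rewrite gt_eqF.
have dV e (d : R) : is_derive x e sqn d -> is_derive x e V (- (V x * V x * d)).
  move=> dq.
  have dq' : is_derive x e (fun y => sqn y + s) d.
    by have h := is_derive_cst s x e; apply: is_derive_eq; rewrite addr0.
  have iV : is_derive (sqn x + s) (1 : R) (fun t : R => t^-1) (- (V x * V x)).
    have h := is_derive_id (sqn x + s) (1 : R).
    have := @is_deriveV R id _ 1 1 q0 h.
    by rewrite /V /GRing.scale/= mulr1 expr2 invfM.
  have := is_derive_plane_comp iV dq'; by rewrite mulNr.
have V1 := dV _ _ (is_derive_sqn1 x); have V2 := dV _ _ (is_derive_sqn2 x).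
have conts : [/\ {for x, continuous w}, {for x, continuous w1}, {for x, continuous w2},
         {for x, continuous w11} & {for x, continuous w22}].
  pose C (f : R * R -> R) : Prop := {for x, continuous f}.
  have cV : C V.
    apply: (@continuous_comp _ _ _ (fun y => sqn y + s) (fun t : R => t^-1)).
      by apply: cvgD; [exact: sqn_cont|exact: cvg_cst].
    exact: inv_continuous.
  have cf : C (fun y : R * R => y.1) by exact: cvg_fst.
  have cs : C (fun y : R * R => y.2) by exact: cvg_snd.
  have ck (k : R) : C (fun y : R * R => k) by exact: cvg_cst.
  have cM (f g : R * R -> R) : C f -> C g -> C (fun y => f y * g y) by exact: cvgM.
  have cD (f g : R * R -> R) : C f -> C g -> C (fun y => f y + g y) by exact: cvgD.
  have cN (f : R * R -> R) : C f -> C (fun y => - f y) by exact: cvgN.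
  have CE f : C f -> {for x, continuous f} by [].
  split; apply: CE; move: C cV cf cs ck cM cD cN => C cV cf cs ck cM cD cN;
    rewrite /w /w1 /w2 /w11 /w22;
    repeat first [apply ck | apply cf | apply cs | apply cV | apply cD | apply cM | apply cN].
split.
- by apply: is_derive_eq; rewrite /w1 /GRing.scale/=; ring.
- by apply: is_derive_eq; rewrite /w2 /GRing.scale/=; ring.
- by apply: is_derive_eq; rewrite /w11 /GRing.scale/=; ring.
- by apply: is_derive_eq; rewrite /w22 /GRing.scale/=; ring.
- exact: conts.
Qed.

Lemma radial_laplacian x : w11 x + w22 x = 4 * A * V x ^+ 3 * (sqn x - s).
Proof.
have -> : s = (V x)^-1 - sqn x by rewrite /V invrK addrAC subrr add0r.
have : V x != 0 by rewrite invr_eq0 gt_eqF.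
by rewrite /w11 /w22 /sqn => V0; field.
Qed.
End RadialTest.

(** The profile [A / (|x|^2 + s) - 1] is smooth at the centre and its Laplacian has the sign of
    [|x|^2 - s]. The choice [A = R1 ^+ 2 + s] makes it positive exactly on the disc of radius
    [R1]. *)
Lemma radial_test (s R1 : R) (O : set (R * R)) (tau : R) :
  0 < s -> 0 < R1 -> 0 < tau -> (forall x, nrm x < R1 -> forall y, `|y - x| < tau -> O y) ->
  exists T T1 T2 T11 T22, [/\ test_fun O T T1 T2 T11 T22,
    forall x, T11 x + T22 x != 0 -> O x,
    forall x, s <= sqn x -> 0 <= T11 x + T22 x &
    forall x, s < sqn x -> nrm x < R1 -> 0 < T11 x + T22 x].
Proof.
move=> s0 R10 tau0 SO; have [A AE] : exists A : R, A = R1 ^+ 2 + s by eexists.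
have A0 : 0 < A by rewrite AE; apply: addr_gt0 => //; exact: exprn_gt0.
have qs x : 0 < sqn x + s by apply: ltr_wpDl; [exact: sqn_ge0|].
have wE x : (0 < A * (sqn x + s)^-1 - 1) = (nrm x < R1).
  rewrite subr_gt0 ltr_pdivlMr// mul1r AE ltrD2r -nrm_sqr.
  by rewrite ltr_pXn2r// nnegrE ?nrm_ge0 ?(ltW R10).
have dw := radial_derivs A s0.
have tf := compose_test_fun tau0 (fun x => or_intror (dw x)).
have {tf} := tf O R1; set T11 := (X in test_fun _ _ _ _ X _); set T22 := (X in test_fun _ _ _ _ _ X).
move=> tf.
have lap x : G1 (A * (sqn x + s)^-1 - 1) * (4 * A * (sqn x + s)^-1 ^+ 3 * (sqn x - s)) <= T11 x + T22 x.
  rewrite -radial_laplacian// /T11 /T22.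
  have [_ _ _ g2] := G_bounds (A * (sqn x + s)^-1 - 1).
  set a := G2 _ * _; set b := G2 _ * _.
  have a0 : 0 <= a by apply: mulr_ge0 => //; exact: sqr_ge0.
  have b0 : 0 <= b by apply: mulr_ge0 => //; exact: sqr_ge0.
  by rewrite mulrDr addrACA -[leLHS]add0r; apply: lerD => //; exact: addr_ge0.
have c0 x : 0 < 4 * A * (sqn x + s)^-1 ^+ 3.
  by apply: mulr_gt0; [exact: mulr_gt0|rewrite exprn_gt0// invr_gt0].
do 5 eexists; split; first apply: tf.
- move=> x; rewrite wE => xR; split; last exact: SO.
  by apply: le_trans (norm_le_nrm x) (ltW xR).
- move=> x; have [xR _|xR] := ltP (nrm x) R1.
    by apply: (SO x xR); rewrite subrr normr0.
  have wx : A * (sqn x + s)^-1 - 1 <= 0 by rewrite leNgt wE -leNgt.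
  by rewrite /T11 /T22; have [_ -> ->] := G_le0 wx; rewrite !mul0r !addr0 eqxx.
- move=> x sx; apply: le_trans (lap x); have [_ _ /andP[g1 _] _] := G_bounds (A * (sqn x + s)^-1 - 1).
  by apply: mulr_ge0 => //; apply: mulr_ge0; [exact: ltW|rewrite subr_ge0].
- move=> x sx xR; apply: lt_le_trans (lap x); apply: mulr_gt0; first by apply: G1_gt0; rewrite wE.
  by apply: mulr_gt0 => //; rewrite subr_gt0.
Qed.

Variables (k L : R) (u u1 u2 : R * R -> R).
Hypothesis ss : slit_solution k L u u1 u2.

(** The radial test function can have negative Laplacian only on the small disc, where [Pd] already
    vanishes. The integrand is therefore nonnegative with integral zero, hence identically zero, and
    the Laplacian is positive in the rest of the large disc. *)
Lemma Pd_propagate (r h s R1 : R) x0 : 0 < h -> 2 * h <= 1 - r -> 0 < s -> 0 < R1 ->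
  (forall y, nrm (y - x0) <= 2 * R1 -> Omr k r y) ->
  (forall y, sqn (y - x0) <= s -> Pd u h y = 0) ->
  forall y, nrm (y - x0) < R1 -> Pd u h y = 0.
Proof.
move=> h0 hr s0 R10 inO Pz.
have tau0 : 0 < R1 / 2 by exact: divr_gt0.
have [x xR y yx|T [T1 [T2 [T11 [T22 [tf TO T0 Tp]]]]]] :=
  @radial_test s R1 [set x | nrm x <= 2 * R1] (R1 / 2) s0 R10 tau0.
  have := nrm_lip x y; rewrite ler_norml => /andP[_] /=.
  by move: xR yx; clear -ss; lra.
have tf' := @test_fun_translate _ _ (Omr k r) (- x0) _ _ _ _ _ _ tf.
have {tf'} [|cP IP] := I2_Pd ss (ltW h0) hr (tf' _).
  by move=> x xR; apply: inO; rewrite opprK addrK.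
have Pge y : T11 (y - x0) + T22 (y - x0) != 0 -> 0 <= Pd u h y.
  move=> /TO /= /inO[_ yr]; apply: (Pd_ge0 ss); first exact: ltW.
  by move: hr yr; clear -ss; lra.
have pos y : 0 <= Pd u h y * (T11 (y - x0) + T22 (y - x0)).
  have [ys|ys] := leP (sqn (y - x0)) s; first by rewrite Pz// mul0r.
  have [->|/Pge Py] := eqVneq (T11 (y - x0) + T22 (y - x0)) 0; first by rewrite mulr0.
  by apply: mulr_ge0 => //; apply/T0/ltW.
have z := I2_eq0 cP pos; rewrite IP lexx in z.
move=> y yR; have [ys|ys] := leP (sqn (y - x0)) s; first exact: Pz.
have := z erefl y; move/eqP; rewrite mulf_eq0 => /orP[/eqP//|].
by rewrite gt_eqF// Tp.
Qed.
End Propagation.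

(** * Propagation along segments of the sector *)

Section Connectedness.
Context {R : realType}.
Local Notation e1 := ((1, 0) : R * R).
Implicit Types x y p v : R * R.

(** The hypothesis makes the set where [P] holds both open and closed in the connected interval
    [[0, 1]]. *)
Lemma segment_locally_constant (P : R -> Prop) :
  (forall t, 0 <= t <= 1 -> exists2 e, 0 < e &
     forall s s', `|s - t| < e -> `|s' - t| < e -> P s -> P s') ->
  P 0 -> P 1.
Proof.
move=> H P0; pose A : set R := `[0, 1]%classic.
have inA t : A t -> 0 <= t <= 1 by rewrite /A /= in_itv.
suff E : A `&` P = A.
  by have : A 1; [rewrite /A /= in_itv/= lexx ler01|rewrite -E => -[]].
apply: (@segment_connected R 0 1 (A `&` P)) => //.
- by exists 0; split => //; rewrite /A /= in_itv/= lexx ler01.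
- exists (interior P); first exact: open_interior.
  apply/seteqP; split => t [At Pt]; split => //; last exact: interior_subset.
  have [e e0 He] := H t (inA t At).
  apply/nbhs_ballP; exists e => //= s; rewrite -ball_normE/= distrC => st.
  by apply: He st Pt; rewrite subrr normr0.
- exists (closure P); first exact: closed_closure.
  apply/seteqP; split => t [At Pt]; split => //; first exact: subset_closure.
  have [e e0 He] := H t (inA t At).
  have [s [Ps]] := Pt _ (nbhsx_ballx t e e0).
  rewrite -ball_normE/= distrC => st.
  by apply: He st _ Ps; rewrite subrr normr0.
Qed.

Lemma Om_ball (k : R) p : 0 < k < 1 -> Om k p ->
  exists d r, [/\ 0 < d, r < 1 & forall y, nrm (y - p) <= d -> Omr k r y].
Proof.
move=> /andP[k0 k1] [p1 pn].
have a0 : 0 < p.1 + k * nrm p by move: p1; rewrite mulNr; clear -k0; lra.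
have b0 : 0 < 1 - nrm p by rewrite subr_gt0.
have [m m0 [ma mb _]] := ex_min3 a0 b0 b0.
have kk : 0 < k <= 1 by rewrite k0 ltW.
have h1 : m / 2 < p.1 + k * nrm p by move: m0 ma; clear -k0; lra.
have h2 : nrm p < nrm p + m / 4 by move: m0; clear -k0; lra.
exists (m / 16), (nrm p + m / 4 + m / 2 / 2); split.
- exact: divr_gt0.
- by move: m0 mb; clear -k0; lra.
- move=> y yp; apply: (Om_margin kk (lexx k) h1 h2).
  by apply: le_lt_trans (norm_le_nrm _) _; move: yp m0; clear -k0; lra.
Qed.

(** The sector is not convex but is star-shaped about its axis: adding a positive axis vector of
    length [c] raises [x.1] by [c] and lowers [k * nrm x] by at most [k * c]. *)
Lemma Om_star (k t : R) p x : 0 < k < 1 -> 0 <= t <= 1 ->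
  0 < p.1 -> p.2 = 0 -> nrm p < 1 -> Om k x -> Om k (p + t *: (x - p)).
Proof.
move=> /andP[k0 k1] /andP[t0 t1] p1 p2 pn [x1 xn].
have E : p + t *: (x - p) = (1 - t) *: p + t *: x.
  by apply: injective_projections; rewrite /= /GRing.scale/=; ring.
have t10 : 0 <= 1 - t by rewrite subr_ge0.
have np : nrm p = p.1 by rewrite /nrm /sqn p2 expr0n addr0 sqrtr_sqr gtr0_norm.
have n1 : nrm ((1 - t) *: p) = (1 - t) * p.1 by rewrite nrmZ np ger0_norm.
have n2 : nrm (t *: x) = t * nrm x by rewrite nrmZ ger0_norm.
rewrite E; split; last first.
  apply: le_lt_trans (nrmD _ _) _; rewrite n1 n2.
  have [->|tn] := eqVneq t 0; first by rewrite subr0 mul1r mul0r addr0 -np.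
  have tp : 0 < t by rewrite lt_neqAle eq_sym tn.
  have h1 : (1 - t) * p.1 <= (1 - t) * 1 by apply: ler_wpM2l => //; rewrite -np ltW.
  have h2 : t * nrm x < t * 1 by rewrite ltr_pM2l.
  by move: h1 h2; clear -k0; lra.
have := nrmD ((1 - t) *: p + t *: x) (- ((1 - t) *: p)).
rewrite addrAC subrr add0r nrmN n1 n2.
set q := nrm (_ + _) => nq.
rewrite (_ : (_ + _).1 = (1 - t) * p.1 + t * x.1)//.
have h1 : k * (t * nrm x) <= k * (q + (1 - t) * p.1) by apply: ler_wpM2l => //; exact: ltW.
have h2 : k * ((1 - t) * p.1) <= 1 * ((1 - t) * p.1).
  by apply: ler_wpM2r; [apply: mulr_ge0 => //; exact: ltW|exact: ltW].
have [t00|tn] := eqVneq t 0.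
  move: h1 h2; rewrite t00 => h1 h2.
  have : k * (1 * p.1) < 1 * (1 * p.1) by rewrite !mul1r gtr_pMl.
  have : q <= (1 - t) * p.1 + t * nrm x by rewrite -n1 -n2; exact: nrmD.
  rewrite t00 => h3 h4.
  have h5 : k * q >= 0 by apply: mulr_ge0; [exact: ltW|exact: nrm_ge0].
  by move: h5 p1; clear -k0; lra.
have tp : 0 < t by rewrite lt_neqAle eq_sym tn.
have h3 : t * (- k * nrm x) < t * x.1 by rewrite ltr_pM2l.
by move: h1 h2 h3; clear -k0; lra.
Qed.

Lemma Om_locally_constant (k : R) (P : R * R -> Prop) p : 0 < k < 1 ->
  0 < p.1 -> p.2 = 0 -> nrm p < 1 ->
  (forall x, Om k x -> exists2 e, 0 < e &
     forall y y', `|y - x| < e -> `|y' - x| < e -> P y -> P y') ->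
  P p -> forall x, Om k x -> P x.
Proof.
move=> k01 p1 p2 pn H Pp x Ox.
have -> : x = p + 1 *: (x - p) by rewrite scale1r addrC subrK.
apply: (@segment_locally_constant (fun t => P (p + t *: (x - p)))); last first.
  by rewrite scale0r addr0.
move=> t t01; have [e e0 He] := H _ (Om_star k01 t01 p1 p2 pn Ox).
have d0 : 0 < `|x - p| + 1 by apply: ltr_wpDl.
exists (e / (`|x - p| + 1)); first exact: divr_gt0.
have close (s : R) : `|s - t| < e / (`|x - p| + 1) ->
    `|p + s *: (x - p) - (p + t *: (x - p))| < e.
  rewrite ltr_pdivlMr// => st; rewrite opprD addrACA subrr add0r -scalerBl normrZ.
  by apply: le_lt_trans st; apply: ler_wpM2l => //; rewrite lerDl.
by move=> s s' /close h /close h'; exact: He h h'.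
Qed.

Variables (k L : R) (u u1 u2 : R * R -> R).
Hypothesis ss : slit_solution k L u u1 u2.

Let Z x := exists2 e, 0 < e & forall y h, `|y - x| < e -> 0 < h < e -> Pd u h y = 0.

Lemma Pd_zero_spread (r R1 : R) x0 : r < 1 -> 0 < R1 ->
  (forall y, nrm (y - x0) <= 2 * R1 -> Omr k r y) -> Z x0 ->
  forall y, nrm (y - x0) < R1 -> Z y.
Proof.
move=> r1 R10 inO [e e0 He] y yR.
have a0 : 0 < (1 - r) / 2 by rewrite divr_gt0 ?subr_gt0.
have b0 : 0 < (R1 - nrm (y - x0)) / 2 by rewrite divr_gt0 ?subr_gt0.
have [d d0 [de da db]] := ex_min3 e0 a0 b0.
exists d => // z h zy /andP[h0 hd].
apply: (@Pd_propagate _ _ _ _ _ _ ss r h ((e / 2) ^+ 2) R1 x0) => //.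
- by move: hd da; clear -ss; lra.
- by rewrite exprn_gt0// divr_gt0.
- move=> w; rewrite -nrm_le; last by rewrite ltW// divr_gt0.
  move=> wx; apply: He; last by rewrite h0; exact: lt_le_trans hd de.
  by apply: le_lt_trans (norm_le_nrm _) _; move: wx e0; clear -ss; lra.
- have := nrmD (z - y) (y - x0); rewrite addrA subrK.
  by have := nrm_le_norm (z - y); move: zy db; clear -ss; lra.
Qed.

Lemma Pd_locally_zero x : Om k x -> Z x.
Proof.
have k01 := ss_k ss; have [s0 [/andP[s00 s016] s0P]] := Pd_zero_somewhere ss.
apply: (@Om_locally_constant k Z (s0 *: e1)) => //.
- by rewrite /= /GRing.scale/= mulr1.
- by rewrite /= /GRing.scale/= mulr0.
- by rewrite nrm_e1 gtr0_norm//; move: s016; clear -ss; lra.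
- move=> p Op; have [d [r [d0 r1 dP]]] := Om_ball k01 Op.
  (* Sup distance [d / 16] is Euclidean distance at most [d / 8]: the disc of radius [2 * (d / 3)]
     about [y] stays in the disc of radius [d] about [p], and [y'] is within [d / 3] of [y]. *)
  exists (d / 16); first exact: divr_gt0.
  move=> y y' yp y'p Zy.
  have n1 := nrm_le_norm (y - p); have n2 := nrm_le_norm (y' - p).
  apply: (@Pd_zero_spread r (d / 3) y) => //; first exact: divr_gt0.
    move=> z zy; apply: dP; have := nrmD (z - y) (y - p); rewrite addrA subrK.
    by move: zy n1 yp d0; clear -ss; lra.
  have := nrmD (y' - p) (- (y - p)); rewrite nrmN opprB addrA subrK.
  by move: n1 n2 yp y'p d0; clear -ss; lra.
- by exists (s0 / 8) => [|y h yx h8]; [exact: divr_gt0|exact: s0P].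
Qed.
End Connectedness.

(** * Rigidity *)

Section FirstDerivativeVanishes.
Context {R : realType}.
Local Notation e1 := ((1, 0) : R * R).
Local Notation e2 := ((0, 1) : R * R).
Implicit Types x y p v : R * R.

Lemma is_derive0_of_quadratic (f : R * R -> R) x v (K tau : R) : 0 < tau ->
  (forall s, `|s| < tau -> `|f (x + s *: v) - f x| <= K * s ^+ 2) -> is_derive x v f 0.
Proof.
move=> tau0 fK.
have K0 : 0 <= K.
  have t2 : `|tau / 2| < tau by rewrite gtr0_norm ?divr_gt0//; clear -tau0; lra.
  have t20 : 0 < (tau / 2) ^+ 2 by rewrite exprn_gt0// divr_gt0.
  by rewrite -(pmulr_lge0 _ t20); apply: le_trans (fK _ t2).
have cv : (fun h : R => h^-1 *: ((f \o shift x) (h *: v) - f x)) @ 0^' --> (0 : R).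
  apply/cvgr0Pnorm_lt => e e0.
  have m0 : 0 < Num.min tau (e / (K + 1)).
    by rewrite lt_min tau0 divr_gt0// ltr_wpDl.
  exists (Num.min tau (e / (K + 1))) => //= h; rewrite /ball_/= sub0r normrN lt_min => /andP[ht he] h0.
  have hp : 0 < `|h| by rewrite normr_gt0.
  rewrite /GRing.scale/= normrM normfV mulrC ltr_pdivrMr// [h *: v + x]addrC.
  apply: le_lt_trans (fK _ ht) _; rewrite -[h ^+ 2]real_normK ?num_real// expr2 mulrA.
  rewrite ltr_pM2r//.
  move: he; rewrite ltr_pdivlMr; last by rewrite ltr_wpDl.
  by move: hp; clear -K0; lra.
apply: DeriveDef; first by apply/cvg_ex; exists 0.
exact: cvg_lim cv.
Qed.

Variables (k L : R) (u u1 u2 : R * R -> R).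
Hypothesis ss : slit_solution k L u u1 u2.

(** Differentiating [Pd u h y = 0] in [h] gives [u1 (y + (2 * h) *: e1) = u1 (y + h *: e1)];
    recentring at [y - h *: e1] makes [u1] constant on short horizontal segments. *)
Lemma u1_horizontal x : Om k x -> exists2 e, 0 < e &
  forall y h, `|y - x| < e -> `|h| < e ->
   [/\ nrm y < 1, u1 (y + h *: e1) = u1 y & u (y + h *: e1) = u y + h * u1 y].
Proof.
move=> Ox; have [e e0 He] := Pd_locally_zero ss Ox; have [_ xn] := Ox.
have a0 : 0 < (1 - nrm x) / 8 by rewrite divr_gt0// subr_gt0.
have [d d0 [de da _]] := ex_min3 e0 a0 e0.
have inB y (h : R) : `|y - x| < d -> `|h| <= 2 * d -> nrm (y + h *: e1) < 1.
  move=> yx hd; apply: le_lt_trans (nrmD _ _) _; rewrite nrm_e1.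
  have := nrm_lip x y; rewrite ler_norml => /andP[_].
  by move: yx hd da d0; clear -ss; lra.
have st y (h : R) : `|y - x| < d -> 0 < h < d -> u1 (y + (2 * h) *: e1) = u1 (y + h *: e1).
  move=> yx /andP[h0 hd].
  have d1 : is_derive h (1 : R) (fun s => u (y + s *: e1)) (u1 (y + h *: e1)).
    apply: is_derive_line; have [|//] := ss_d ss (_ : nrm (y + h *: e1) < 1).
    by apply: inB => //; rewrite gtr0_norm//; move: h0 hd; clear -ss; lra.
  have d2 : is_derive h (1 : R) (fun s => u (y + (2 * s) *: e1)) (2 * u1 (y + (2 * h) *: e1)).
    have dl : is_derive (2 * h) (1 : R) (fun s => u (y + s *: e1)) (u1 (y + (2 * h) *: e1)).
      apply: is_derive_line; have [|//] := ss_d ss (_ : nrm (y + (2 * h) *: e1) < 1).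
      by apply: inB => //; rewrite gtr0_norm ?mulr_gt0//; move: hd; clear -ss; lra.
    have dm : is_derive h (1 : R) (fun s : R => 2 * s) 2.
      by have hi := is_derive_id h (1 : R); apply: is_derive_eq; rewrite /GRing.scale/= mulr1.
    by have := @is_derive1_comp R _ _ h _ _ dl dm; rewrite mulrC.
  have dP : is_derive h (1 : R) (fun s => Pd u s y) (2 * u1 (y + (2 * h) *: e1) - 2 * u1 (y + h *: e1)).
    by rewrite /Pd; apply: is_derive_eq; rewrite /GRing.scale/=; ring.
  have d0' : is_derive h (1 : R) (fun s => Pd u s y) 0.
    have : is_derive h (1 : R) (cst 0 : R -> R) 0 by exact: is_derive_cst.
    have [n0 n1] := (lt_nbhsr h0, lt_nbhsl (lt_le_trans hd de)).
    apply: near_eq_is_derive => //; apply: filterS2 n0 n1 => s s0 se.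
    by rewrite He ?s0//; exact: lt_le_trans de.
  have := @derive_val _ _ _ _ _ _ _ dP; rewrite (@derive_val _ _ _ _ _ _ _ d0').
  by clear -ss; lra.
have d4 : 0 < d / 4 by exact: divr_gt0.
have pos y (h : R) : `|y - x| < d / 2 -> 0 <= h < d / 2 -> u1 (y + h *: e1) = u1 y.
  move=> yx /andP[]; rewrite le_eqVlt => /orP[/eqP <- _|h0 hd].
    by rewrite scale0r addr0.
  have := st (y - h *: e1) h; rewrite subrK.
  have -> : y - h *: e1 + (2 * h) *: e1 = y + h *: e1.
    by apply: injective_projections; rewrite /= /GRing.scale/=; ring.
  apply; last by rewrite h0; move: hd d0; clear -ss; lra.
  rewrite addrAC; apply: le_lt_trans (ler_normB _ _) _; rewrite normrZ norm_e1 mulr1 gtr0_norm//.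
  by move: yx hd; clear -ss; lra.
have hor y (h : R) : `|y - x| < d / 4 -> `|h| < d / 4 -> u1 (y + h *: e1) = u1 y.
  move=> yx hd; have [h0|h0] := leP 0 h.
    apply: pos; first by move: yx d0; clear -ss; lra.
    by rewrite h0 -(ger0_norm h0); move: hd d0; clear -ss; lra.
  move: hd; rewrite (ltr0_norm h0) => hd.
  rewrite -(pos (y + h *: e1) (- h)); first by rewrite scaleNr addrK.
    rewrite addrAC; apply: le_lt_trans (norm_e1D _ _) _; rewrite ltr0_norm//.
    by move: yx hd; clear -ss; lra.
  by apply/andP; split; move: h0 hd d0; clear -ss; lra.
exists (d / 4) => // y h yx hd.
have inB4 (s : R) : `|s| < d / 4 -> nrm (y + s *: e1) < 1.
  by move=> sd; apply: inB; move: yx sd d0; clear -ss; lra.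
split; [|exact: hor|].
  by have := @inB4 0; rewrite scale0r addr0 normr0; apply.
have [s sh|c ch] := @dir_MVT R u u1 y e1 h.
  by have [] := ss_d ss (inB4 s (le_lt_trans sh hd)).
by rewrite hor ?(le_lt_trans ch hd)//; clear -ss; lra.
Qed.

(** Convexity at the midpoint [p] of [p + s *: e2 + h *: e1] and [p - s *: e2 - h *: e1], with [u]
    affine horizontally, bounds [h (u1 (p - s *: e2) - u1 (p + s *: e2))] by a vertical second
    difference, hence by [2 L s^2]. With [h] fixed and both signs of [s], the vertical variation of
    [u1] is quadratic in [s]. *)
Lemma u1_vertical x : Om k x -> exists2 e, 0 < e &
  forall y s, `|y - x| < e -> `|s| < e -> u1 (y + s *: e2) = u1 y.
Proof.
move=> Ox; have [e e0 He] := u1_horizontal Ox; have L0 := ss_L ss.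
have [h hE] : exists h : R, h = e / 4 by eexists.
have h0 : 0 < h by rewrite hE divr_gt0.
have near p (s t : R) : `|p - x| < h -> `|s| < h -> `|t| <= h -> `|p + s *: e2 + t *: e1 - x| < e.
  move=> px sh th; rewrite addrAC [p + _ - x]addrAC.
  apply: le_lt_trans (norm_e1D _ _) _; have := norm_e2D s (p - x).
  by move: px sh th h0; rewrite hE; clear -ss; lra.
have he : `|h| < e by rewrite gtr0_norm//; move: e0; rewrite hE; clear -ss; lra.
have heN : `|- h| < e by rewrite normrN.
have half p (s : R) : `|p - x| < h -> `|s| < h ->
    u1 (p - s *: e2) - u1 (p + s *: e2) <= 2 * L / h * s ^+ 2.
  move=> px sh; have sNh : `|- s| < h by rewrite normrN.
  have h00 : `|0 : R| <= h by rewrite normr0 ltW.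
  have n0 (t : R) : `|t| < h -> nrm (p + t *: e2) < 1.
    move=> /near th; have := th p 0 px h00; rewrite scale0r addr0 => th0.
    by have [] := He _ h th0 he.
  have hh : `|h| <= h by rewrite gtr0_norm.
  have hNh : `|- h| <= h by rewrite normrN gtr0_norm.
  have a1 := near p s 0 px sh h00; rewrite scale0r addr0 in a1.
  have a2 := near p (- s) 0 px sNh h00; rewrite scale0r addr0 scaleNr in a2.
  have [_ _ b1] := He _ h a1 he.
  have [_ _ b2] := He _ (- h) a2 heN.
  have n1 : nrm (p + s *: e2 + h *: e1) < 1 by have [] := He _ h (near p s h px sh hh) he.
  have n2 : nrm (p - s *: e2 + (- h) *: e1) < 1.
    by rewrite -scaleNr; have [] := He _ h (near p (- s) (- h) px sNh hNh) he.
  have t01 : 0 <= (1 / 2 : R) <= 1 by apply/andP; split; clear -ss; lra.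
  have := ss_conv ss n1 n2 t01.
  have -> : (1 / 2) *: (p + s *: e2 + h *: e1) + (1 - 1 / 2) *: (p - s *: e2 + (- h) *: e1) = p.
    by apply: injective_projections; rewrite /= /GRing.scale/=; field.
  rewrite b1 b2 => cv.
  have dd (t r : R) : `|t| < h -> `|r| <= `|t| -> is_derive (p + r *: e2) e2 u (u2 (p + r *: e2)).
    by move=> th rt; have [] := ss_d ss (n0 r (le_lt_trans rt th)).
  have [c cs uc] := @dir_MVT R u u2 p e2 s (fun r => @dd s r sh).
  have [c' cs' uc'] := @dir_MVT R u u2 p e2 (- s) (fun r => @dd (- s) r sNh).
  rewrite scaleNr in uc'; rewrite normrN in cs'.
  have [_ l2] := ss_lip ss (n0 c (le_lt_trans cs sh)) (n0 c' (le_lt_trans cs' sh)).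
  have cc' : `|p + c *: e2 - (p + c' *: e2)| <= 2 * `|s|.
    rewrite opprD addrACA subrr add0r -scalerBl normrZ norm_e2 mulr1.
    by apply: le_trans (ler_normB _ _) _; move: cs cs'; clear -ss; lra.
  have m1 : `|u2 (p + c *: e2) - u2 (p + c' *: e2)| <= 2 * L * `|s|.
    by apply: le_trans l2 _; rewrite [2 * L]mulrC -mulrA ler_wpM2l// ltW.
  have m2 : (u2 (p + c *: e2) - u2 (p + c' *: e2)) * s <= 2 * L * s ^+ 2.
    apply: le_trans (ler_norm _) _; rewrite normrM -[s ^+ 2]real_normK ?num_real// expr2 mulrA.
    exact: ler_wpM2r.
  rewrite mulrAC ler_pdivlMr// mulrC.
  by move: cv m2 uc uc'; clear -ss; lra.
have quad p (s : R) : `|p - x| < h -> `|s| < h ->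
    `|u1 (p + s *: e2) - u1 (p - s *: e2)| <= 2 * L / h * s ^+ 2.
  move=> px sh; rewrite ler_norml; apply/andP; split.
    by have := half p s px sh; clear -ss; lra.
  have sN : `|- s| < h by rewrite normrN.
  by have := half p (- s) px sN; rewrite scaleNr opprK sqrrN; clear -ss; lra.
(* The symmetric estimate is recentred at the midpoint [p + (s / 2) *: e2] to obtain a one-sided
   increment. *)
have dz p : `|p - x| < h / 2 -> is_derive p e2 u1 0.
  move=> px; apply: (@is_derive0_of_quadratic _ _ _ (2 * L / h / 4) h h0) => s sh.
  have s2 : `|s / 2| < h.
    by rewrite normrM (ger0_norm (_ : 0 <= 2^-1))//; have := normr_ge0 s; move: sh; clear -ss; lra.
  have := quad (p + (s / 2) *: e2) (s / 2) _ s2.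
  have -> : p + (s / 2) *: e2 + (s / 2) *: e2 = p + s *: e2.
    by apply: injective_projections; rewrite /= /GRing.scale/=; field.
  rewrite addrK => q; apply: le_trans (q _) _.
    rewrite addrAC; apply: le_lt_trans (norm_e2D _ _) _.
    rewrite normrM (ger0_norm (_ : 0 <= 2^-1))//; move: px sh; clear -ss; lra.
  by rewrite le_eqVlt; apply/orP; left; apply/eqP; field; rewrite gt_eqF.
exists (h / 4); first exact: divr_gt0.
move=> y s yx sh.
have [r rs|c _] := @dir_MVT R u1 (fun=> 0) y e2 s.
  apply: dz; rewrite addrAC; apply: le_lt_trans (norm_e2D _ _) _.
  by move: yx sh rs; clear -ss; lra.
by rewrite mul0r => /eqP; rewrite subr_eq0 => /eqP.
Qed.

Lemma u1_locally_constant x : Om k x -> exists2 e, 0 < e &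
  forall y y', `|y - x| < e -> `|y' - x| < e -> u1 y = u1 y'.
Proof.
move=> Ox; have [a a0 Ha] := u1_horizontal Ox; have [b b0 Hb] := u1_vertical Ox.
have a2 : 0 < a / 2 by exact: divr_gt0.
have b2 : 0 < b / 2 by exact: divr_gt0.
have [e e0 [ea eb _]] := ex_min3 a2 b2 b2.
have aux y : `|y - x| < e -> u1 y = u1 x.
  move=> yx; have y1 := norm_fst (y - x); have y2 := norm_snd (y - x).
  have -> : y = x + (y - x).1 *: e1 + (y - x).2 *: e2.
    by apply: injective_projections; rewrite /= /GRing.scale/=; ring.
  rewrite Hb.
  - have [|//|//] := Ha x (y - x).1; first by rewrite subrr normr0.
    by move: y1 yx ea a0; clear -ss; lra.
  - rewrite addrC addKr normrZ norm_e1 mulr1.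
    by move: y1 yx eb b0; clear -ss; lra.
  - by move: y2 yx eb b0; clear -ss; lra.
by exists e => // y y' /aux -> /aux ->.
Qed.

(** The locally constant [u1] has one value on the sector, which is compared with [t *: e1] for
    small [t], where the gradient is at most [L * t]. *)
Lemma u1_eq0 x : Om k x -> u1 x = 0.
Proof.
move=> Ox; have L0 := ss_L ss; apply/eqP; rewrite -normr_le0; apply/ler_addgt0Pr => e e0; rewrite add0r.
have q0 : 0 < e / L by exact: divr_gt0.
have h0 : 0 < 1 / 2 :> R by exact: divr_gt0.
have [t t0 [te t1 _]] := ex_min3 q0 h0 h0.
have tn : nrm (t *: e1) < 1 by rewrite nrm_e1 gtr0_norm//; move: t1; clear -ss; lra.
have <- : u1 (t *: e1) = u1 x.
  apply: (@Om_locally_constant R k (fun y => u1 (t *: e1) = u1 y) (t *: e1) (ss_k ss)) => //.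
  - by rewrite /= /GRing.scale/= mulr1.
  - by rewrite /= /GRing.scale/= mulr0.
  - move=> p /u1_locally_constant[d d0 Hd]; exists d => // y y' yp y'p ->.
    exact: Hd.
have [g _] := u_grad_le ss tn; apply: le_trans g _.
by rewrite normrZ norm_e1 mulr1 gtr0_norm// mulrC -ler_pdivlMr.
Qed.

Lemma u_axis (t : R) : 0 < t < 1 -> u (t *: e1) = 0.
Proof.
move=> /andP[t0 t1].
have inB (s : R) : 0 <= s <= t -> nrm (s *: e1) < 1.
  by move=> /andP[s0 st]; rewrite nrm_e1 ger0_norm//; exact: le_lt_trans st t1.
have [s st|c /andP[c0 ct]] := @dir_MVT_ge0 R u u1 0 e1 t (ltW t0).
  by rewrite add0r; have [] := ss_d ss (inB s st).
rewrite !add0r (u_at0 ss) subr0 => ->.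
move: c0; rewrite le_eqVlt => /orP[/eqP <-|c0].
  have [|z _] := u_zero_grad ss (_ : nrm (0 : R * R) < 1) (u_at0 ss); first by rewrite nrm0.
  by rewrite scale0r z mul0r.
rewrite u1_eq0 ?mul0r//; split; last by apply: inB; rewrite (ltW c0).
rewrite /= /GRing.scale/= mulr1; apply: le_lt_trans c0; rewrite mulNr oppr_le0.
by apply: mulr_ge0 (nrm_ge0 _); case/andP: (ss_k ss) => /ltW.
Qed.
End FirstDerivativeVanishes.

(** * Functions whose vertical derivative vanishes almost everywhere *)

Section OneDimensional.
Context {R : realType}.
Local Notation mu2 := (@lebesgue_measure R \x @lebesgue_measure R)%E.
Local Notation e2 := ((0, 1) : R * R).
Implicit Types x y p v : R * R.

(** The derivatives of the spline [G0] are reused: [hat] is a bump of half-width [e] at [a], and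
    [ramp] an antiderivative of [hat / e] rising from [0] to [6]. *)
Let hat (a e t : R) : R := G2 ((t - a) / e + 1).
Let ramp (a e t : R) : R := G1 ((t - a) / e + 1).

Lemma G2_supp (s : R) : G2 s != 0 -> 0 < s < 2.
Proof.
move=> g; apply/andP; split; rewrite ltNge; apply/negP => h; move: g.
  by have [_ _ ->] := G_le0 h; rewrite eqxx.
rewrite /G2 !pos_id; last by clear -h; lra.
- by rewrite (_ : 6 * _ = 0) ?eqxx//; ring.
- by clear -h; lra.
- by clear -h; lra.
Qed.

Lemma G1_const (s : R) : 2 <= s -> G1 s = 6.
Proof.
by move=> h; rewrite /G1 !pos_id; [ring|clear -h; lra..].
Qed.

Lemma G2_at1 : 0 < G2 (1 : R).
Proof.
by rewrite /G2 subrr (pos_id ler01) (pos_eq0 (lexx 0)) pos_eq0//; clear; lra.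
Qed.

Lemma hat_props (a e : R) : 0 < e ->
  [/\ continuous (hat a e), forall t, 0 <= hat a e t, 0 < hat a e a &
    forall t, hat a e t != 0 -> `|t - a| < e].
Proof.
move=> e0; split.
- move=> t; apply: (@continuous_comp _ _ _ (fun t => (t - a) / e + 1) G2); last exact: G2_cont.
  apply: cvgD; last exact: cvg_cst.
  by apply: cvgM; [apply: cvgB; [exact: cvg_id|exact: cvg_cst]|exact: cvg_cst].
- by move=> t; have [_ _ _] := G_bounds ((t - a) / e + 1).
- by rewrite /hat subrr mul0r add0r G2_at1.
- move=> t /G2_supp/andP[h1 h2]; rewrite ltr_norml; apply/andP; split.
    have : - 1 < (t - a) / e by move: h1; clear -e0; lra.
    by rewrite ltr_pdivlMr// mulN1r.
  have : (t - a) / e < 1 by move: h2; clear -e0; lra.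
  by rewrite ltr_pdivrMr// mul1r.
Qed.

Lemma ramp_props (a e : R) : 0 < e ->
  [/\ forall t, is_derive t (1 : R) (ramp a e) (hat a e t / e),
    forall t, t <= a - e -> ramp a e t = 0 & forall t, a + e <= t -> ramp a e t = 6].
Proof.
move=> e0; split.
- move=> t; have d1 := is_derive_G1 ((t - a) / e + 1).
  have d2 : is_derive t (1 : R) (fun t : R => (t - a) / e + 1) e^-1.
    have hi := is_derive_id t (1 : R).
    by apply: is_derive_eq; rewrite /GRing.scale/=; ring.
  exact: (@is_derive1_comp R G1 (fun t : R => (t - a) / e + 1) t _ _ d1 d2).
- move=> t ta; have h : (t - a) / e + 1 <= 0.
    have : (t - a) / e <= - 1; last by clear -e0; lra.
    by rewrite ler_pdivrMr// mulN1r; move: ta; clear -e0; lra.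
  by have [_ ? _] := G_le0 h.
- move=> t ta; apply: G1_const.
  have : 1 <= (t - a) / e; last by clear -e0; lra.
  by rewrite ler_pdivlMr// mul1r; move: ta; clear -e0; lra.
Qed.

(* Testing with the vertical antiderivative [T] of [B - B (_ - d *: e2)], [B] a bump
   at [x], shows that [f - f (_ + d *: e2)] has integral zero against [B]. *)
Lemma vertical_constant (O : set (R * R)) (f : R * R -> R) (K r d : R) x :
  0 < r -> 0 < d ->
  (forall y, `|y.1 - x.1| < r -> x.2 - r < y.2 < x.2 + d + r -> O y) ->
  (forall y, O y -> {for y, continuous f}) -> (forall y, O y -> `|f y| <= K) ->
  (forall y z, O y -> O z -> `|f y - f z| <= K * `|y - z|) ->
  {ae mu2, forall y, O y -> is_derive y e2 f 0} ->
  f x = f (x + d *: e2).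
Proof.
move=> r0 d0 inO fc fK flip fae.
have Ox : O x by apply: inO; [rewrite subrr normr0|apply/andP; split; move: r0 d0; clear; lra].
have K0 : 0 <= K by apply: le_trans (fK x Ox).
have strip (e : R) y : `|y.1 - x.1| < e -> x.2 - e < y.2 < x.2 + d + e ->
    2 * e <= r -> forall z, `|z - y| < e -> `|z.1 - x.1| < 2 * e /\ x.2 - 2 * e < z.2 < x.2 + d + 2 * e.
  move=> y1 /andP[y2 y3] er z zy.
  have z1 := le_lt_trans (norm_fst (z - y)) zy; have z2 := le_lt_trans (norm_snd (z - y)) zy.
  move: z1 z2 y1; rewrite /= !ltr_norml => /andP[a1 a2] /andP[b1 b2] /andP[c1 c2].
  by split; apply/andP; split; move: a1 a2 b1 b2 c1 c2 y2 y3; clear; lra.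
have stripO (e : R) y : `|y.1 - x.1| < e -> x.2 - e < y.2 < x.2 + d + e -> 2 * e <= r ->
    forall z, `|z - y| < e -> O z.
  move=> y1 y2 er z zy; have [z1 /andP[z2 z3]] := strip e y y1 y2 er z zy.
  apply: inO; first exact: lt_le_trans z1 er.
  by apply/andP; split; move: z2 z3 er; clear; lra.
pose F y := f y - f (y + d *: e2).
apply/eqP; rewrite -subr_eq0; apply/eqP; rewrite -/(F x).
apply: contrapT => /eqP Fx.
have cF : {for x, continuous F}.
  apply: cvgB; first exact: fc.
  apply: continuous_translate; apply: fc.
  apply: inO; rewrite /= /GRing.scale/= ?mulr0 ?mulr1 ?addr0 ?subrr ?normr0//.
  by apply/andP; split; move: r0 d0; clear; lra.
(* If [F x] were nonzero, [F] would keep its sign near [x], and its integral against a bump there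
   could not vanish. *)
have [e0 e00 Fpos] : exists2 e, 0 < e & forall y, `|y - x| < e -> 0 <= F x * F y.
  have F2 : 0 < F x * F x by rewrite -expr2 exprn_even_gt0.
  have cFF : {for x, continuous (fun y => F x * F y)} by apply: cvgM => //; exact: cvg_cst.
  have : \forall y \near x, 0 < F x * F y by move/cvgr_gt: cFF; apply.
  move=> /nbhs_ballP[e /= e0 He]; exists e => // y yx.
  by apply: ltW; apply: He; rewrite -ball_normE/= distrC.
have r4 : 0 < r / 4 by exact: divr_gt0.
have e4 : 0 < e0 / 2 by exact: divr_gt0.
have [e ep [er ee _]] := ex_min3 r4 e4 e4.
have [ch h_ge0 h1 hs] := hat_props x.1 ep.
have [cg g_ge0 g1 gs] := hat_props x.2 ep.
have [dr r_0 r_6] := ramp_props x.2 ep.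
pose B y := hat x.1 e y.1 * (hat x.2 e y.2 / e).
pose T y := hat x.1 e y.1 * (ramp x.2 e y.2 - ramp x.2 e (y.2 - d)).
pose T2 y := B y - B (y - d *: e2).
have cfst (g : R -> R) : continuous g -> continuous (fun y : R * R => g y.1).
  by move=> cg' y; apply: (@continuous_comp _ _ _ fst g); [exact: cvg_fst|exact: cg'].
have csnd (g : R -> R) : continuous g -> continuous (fun y : R * R => g y.2).
  by move=> cg' y; apply: (@continuous_comp _ _ _ snd g); [exact: cvg_snd|exact: cg'].
have cB : continuous B.
  move=> y; apply: cvgM; first exact: (cfst _ ch).
  by apply: cvgM; [exact: (csnd _ cg)|exact: cvg_cst].
have cT : continuous T.
  have cr := derive_cont dr.
  move=> y; apply: cvgM; first exact: (cfst _ ch).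
  apply: cvgB; first exact: (csnd _ cr).
  apply: (csnd (fun t => ramp x.2 e (t - d))) => t.
  apply: (@continuous_comp _ _ _ (fun t => t - d) (ramp x.2 e)); last exact: cr.
  by apply: cvgB; [exact: cvg_id|exact: cvg_cst].
have Bs y : B y != 0 -> `|y.1 - x.1| < e /\ `|y.2 - x.2| < e.
  rewrite /B mulf_eq0 negb_or => /andP[/hs y1].
  by rewrite mulf_eq0 negb_or => /andP[/gs y2 _].
have Ts y : T y != 0 -> `|y.1 - x.1| < e /\ x.2 - e < y.2 < x.2 + d + e.
  rewrite /T mulf_eq0 negb_or => /andP[/hs y1 yr]; split => //.
  apply/andP; split; rewrite ltNge; apply/negP => y2; move: yr.
    rewrite r_0; last by move: y2; clear; lra.
    by rewrite r_0 ?subrr ?eqxx//; move: y2 d0; clear; lra.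
  rewrite r_6; last by move: y2 d0; clear; lra.
  by rewrite r_6 ?subrr ?eqxx//; move: y2; clear; lra.
have T2s y : T2 y != 0 -> `|y.1 - x.1| < e /\ x.2 - e < y.2 < x.2 + d + e.
  rewrite /T2; have [->|/Bs[y1 y2] _] := eqVneq (B y) 0; last first.
    split => //; move: y2; rewrite ltr_norml => /andP[a1 a2].
    by apply/andP; split; move: a1 a2 d0; clear; lra.
  rewrite sub0r oppr_eq0 => /Bs; rewrite /= /GRing.scale/= mulr0 mulr1 subr0 => -[y1 y2].
  split => //; move: y2; rewrite ltr_norml => /andP[a1 a2].
  by apply/andP; split; move: a1 a2 d0; clear; lra.
have er2 : 2 * e <= r by move: er r0; clear; lra.
have bnd y : `|y.1 - x.1| < e -> x.2 - e < y.2 < x.2 + d + e ->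
   `|y| <= `|x| + d + e /\ forall z, `|z - y| < e -> O z.
  move=> y1 y2; split; last exact: stripO y1 y2 er2.
  rewrite plane_norm_le; apply/andP; split.
    have := ler_normD (y.1 - x.1) x.1; rewrite subrK.
    by have := norm_fst x; move: y1 d0; clear; lra.
  have := norm_snd x; rewrite !ler_norml => /andP[a1 a2].
  by case/andP: y2 => b1 b2; apply/andP; split; move: a1 a2 b1 b2 d0 ep; clear; lra.
have sT : sptd O T by exists (`|x| + d + e), e; split => // y /Ts[y1 y2]; exact: bnd.
have sT2 : sptd O T2 by exists (`|x| + d + e), e; split => // y /T2s[y1 y2]; exact: bnd.
have sB : sptd (fun y => O y /\ O (y + d *: e2)) B.
  exists (`|x| + d + e), e; split => // y /Bs[y1 y2].
  have y2' : x.2 - e < y.2 < x.2 + d + e.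
    by move: y2; rewrite ltr_norml => /andP[a1 a2]; apply/andP; split; move: a1 a2 d0; clear; lra.
  have [yb yO] := bnd y y1 y2'; split => // z zy; split; first exact: yO.
  have yd1 : `|(y + d *: e2).1 - x.1| < e by rewrite /= /GRing.scale/= mulr0 addr0.
  have yd2 : x.2 - e < (y + d *: e2).2 < x.2 + d + e.
    rewrite /= /GRing.scale/= mulr1.
    by move: y2; rewrite ltr_norml => /andP[a1 a2]; apply/andP; split; move: a1 a2 d0; clear; lra.
  have [_] := bnd _ yd1 yd2; apply.
  by rewrite opprD addrACA subrr addr0.
have cT2 : continuous T2.
  move=> y; apply: cvgB; first exact: cB.
  apply: (continuous_translate (v := - (d *: e2))); exact: cB.
have cfT : cc (fun y => f y * T y) by apply: (cc_mul fc cT sT).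
have cfT2 : cc (fun y => f y * T2 y) by apply: (cc_mul fc cT2 sT2).
have sB1 : sptd O B.
  by have [M [t [t0 BO]]] := sB; exists M, t; split => // y /BO[yM yO]; split => // z /yO[].
have cfB : cc (fun y => f y * B y) by apply: (cc_mul fc cB sB1).
have cfBd : cc (fun y => f (y + d *: e2) * B y).
  apply: (cc_mul (O := fun y => O (y + d *: e2))) => //.
    by move=> y Oy; apply: continuous_translate; exact: fc.
  by have [M [t [t0 BO]]] := sB; exists M, t; split => // y /BO[yM yO]; split => // z /yO[].
have dT y : is_derive y e2 T (T2 y).
  have s2 := is_derive_snd2 y; have f2 := is_derive_fst2 y.
  have da := is_derive_plane_comp (dr y.2) s2.
  have db : is_derive y e2 (fun y => ramp x.2 e (y.2 - d)) (hat x.2 e (y.2 - d) / e * 1).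
    apply: (is_derive_plane_comp (dr (y.2 - d))).
    by have hc := is_derive_cst d y e2; apply: is_derive_eq; rewrite subr0.
  have dh : is_derive y e2 (fun y => hat x.1 e y.1) 0.
    apply: is_derive_of_line.
    rewrite (_ : (fun _ => _) = cst (hat x.1 e y.1)); first exact: is_derive_cst.
    by apply/funext => s; rewrite /= /GRing.scale/= mulr0 addr0.
  have -> : T2 y = hat x.1 e y.1 *: (hat x.2 e y.2 / e * 1 - hat x.2 e (y.2 - d) / e * 1) +
      (ramp x.2 e y.2 - ramp x.2 e (y.2 - d)) *: (0 : R).
    rewrite /T2 /B; have -> : (y - d *: e2).1 = y.1 by rewrite /= /GRing.scale/= mulr0 subr0.
    have -> : (y - d *: e2).2 = y.2 - d by rewrite /= /GRing.scale/= mulr1.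
    by rewrite /GRing.scale/=; move: (hat _ _ _) (hat _ _ _) (hat _ _ _) => a1 a2 a3; ring.
  exact: (is_deriveM dh (is_deriveB da db)).
have ccT := sptd_cc cT sT; have ccT2 := sptd_cc cT2 sT2.
have [KT KT0 TK] := cc_bounded ccT; have [KT2 KT20 T2K] := cc_bounded ccT2.
have Tlip y t : `|T (y + t *: e2) - T y| <= KT2 * `|t|.
  by apply: (@dir_lip R T T2) => s _; split; [exact: dT|exact: T2K].
(* The field [(0, f T)] has divergence [f T2] almost everywhere, as [f] has zero vertical derivative
   there. *)
have I0 : I2 (fun y => f y * T2 y) = 0.
  apply: (@I2_divergence R (cst 0) (fun y => f y * T y) _ (K * KT + K * KT2) e) => //.
  - by split; [exact: cst_continuous|exists 0].
  - move=> y t _; rewrite subrr normr0 mulr_ge0//; by apply: addr_ge0; apply: mulr_ge0.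
  - move=> y t te.
    have ty : `|y + t *: e2 - y| = `|t| by rewrite addrC addKr normrZ norm_e2 mulr1.
    have ty' : `|y - (y + t *: e2)| < e by rewrite distrC ty.
    have key : O y -> O (y + t *: e2) ->
        `|f (y + t *: e2) * T (y + t *: e2) - f y * T y| <= (K * KT + K * KT2) * `|t|.
      move=> Oy Oyt.
      rewrite (_ : _ - _ = (f (y + t *: e2) - f y) * T (y + t *: e2) +
                           f y * (T (y + t *: e2) - T y)); last by ring.
      apply: le_trans (ler_normD _ _) _; rewrite [X in X + _]normrM [X in _ + X]normrM [leRHS]mulrDl; apply: lerD.
        rewrite [leRHS]mulrAC; apply: ler_pM => //.
        by have := flip _ _ Oyt Oy; rewrite ty.
      by rewrite -[leRHS]mulrA; apply: ler_pM => //; exact: fK.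
    have [Ty|/Ts[y1 y2]] := eqVneq (T y) 0; last first.
      have [_ yO] := bnd y y1 y2; apply: key; apply: yO; rewrite ?ty//.
      by rewrite subrr normr0.
    have [Tyt|/Ts[y1 y2]] := eqVneq (T (y + t *: e2)) 0; last first.
      have [_ yO] := bnd _ y1 y2; apply: key; apply: yO => //.
      by rewrite subrr normr0.
    rewrite Ty Tyt !mulr0 subrr normr0 mulr_ge0//; by apply: addr_ge0; apply: mulr_ge0.
  - apply: ae_mono fae => y fy; exists 0, (f y * T2 y); split; last by rewrite add0r.
      exact: is_derive_cst.
    have [Oy|nOy] := pselect (O y).
      have d1 := fy Oy; have d2 := dT y.
      by apply: is_derive_eq; rewrite /GRing.scale/= mulr0 addr0.
    have [M [t [t0 sO]]] := sT.
    have -> : T2 y = 0.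
      have [M' [t' [t'0 sO']]] := sT2.
      apply/eqP; apply: contraT => /sO'[_ yO]; exfalso; apply: nOy; apply: yO.
      by rewrite subrr normr0.
    rewrite mulr0; apply: (@is_derive_near0 R (fun y => f y * T y) y e2 t t0) => z zy.
    have [->|/sO[_ zO]] := eqVneq (T z) 0; first by rewrite mulr0.
    by exfalso; apply: nOy; apply: zO; rewrite distrC.
have cBs : cc (fun y => f y * B (y - d *: e2)).
  have := cc_shift (- (d *: e2)) cfBd.
  by congr cc; apply/funext => y /=; rewrite subrK.
have IF : I2 (fun y => F y * B y) = 0.
  have -> : (fun y => F y * B y) = (fun y => f y * B y - f (y + d *: e2) * B y).
    by apply/funext => y; rewrite /F mulrBl.
  rewrite I2B// -(I2_shift (- (d *: e2)) cfBd).
  under [X in _ - I2 X]eq_fun do rewrite subrK.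
  rewrite -I2B//; transitivity (I2 (fun y => f y * T2 y)); last exact: I0.
  by congr I2; apply/funext => y; rewrite /T2 mulrBr.
have cFB : cc (fun y => F y * B y).
  have := ccB cfB cfBd.
  by congr cc; apply/funext => y; rewrite /F mulrBl.
have B_ge0 y : 0 <= B y.
  by apply: mulr_ge0 => //; apply: divr_ge0 => //; exact: ltW.
have z : F x * (F x * B x) = 0.
  apply: (I2_eq0 (ccZ (F x) cFB)); last by rewrite I2Z// IF mulr0.
  move=> y; have [->|/Bs[y1 y2]] := eqVneq (B y) 0; first by rewrite !mulr0.
  rewrite mulrA; apply: mulr_ge0 => //; apply: Fpos.
  apply: (@le_lt_trans _ _ e); last by move: ee e00; clear; lra.
  by rewrite plane_norm_le /= !ltW.
have B0 : 0 < B x by apply: mulr_gt0 => //; exact: divr_gt0.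
by move/eqP: z; rewrite mulf_eq0 (negPf Fx) mulf_eq0 (negPf Fx) (gt_eqF B0).
Qed.
End OneDimensional.

(** * Identification of the solution *)

Section Rigidity.
Context {R : realType}.
Local Notation mu2 := (@lebesgue_measure R \x @lebesgue_measure R)%E.
Local Notation e1 := ((1, 0) : R * R).
Local Notation e2 := ((0, 1) : R * R).
Implicit Types x y p v : R * R.

Variables (k L : R) (u u1 u2 : R * R -> R).
Hypothesis ss : slit_solution k L u u1 u2.

Let H : set (R * R) := [set x | 0 < x.1 /\ nrm x < 1].

Lemma half_disc_Om x : H x -> Om k x.
Proof.
move=> [x1 xn]; split => //; apply: le_lt_trans x1.
by rewrite mulNr oppr_le0 mulr_ge0 ?nrm_ge0//; case/andP: (ss_k ss) => /ltW.
Qed.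

(** In the right half disc vertical segments reach the positive axis without leaving the domain.
    There [u] and its gradient vanish, while [u1 = 0] on the sector turns the equation into vertical
    derivative [1] for [u2] almost everywhere. *)
Lemma u2_half_disc x : H x -> u2 x = x.2.
Proof.
move=> [x10 xn]; have L0 := ss_L ss.
have [p pE] : exists p, p = x.1 *: e1 by eexists.
have xE : x = p + x.2 *: e2.
  by rewrite pE; apply: injective_projections; rewrite /= /GRing.scale/=; ring.
have p1 : p.1 = x.1 by rewrite pE /= /GRing.scale/= mulr1.
have p2 : p.2 = 0 by rewrite pE /= /GRing.scale/= mulr0.
have pn : nrm p < 1.
  by apply: le_lt_trans xn; apply: nrm_mono; rewrite ?p1// p2 normr0.
have u2p : u2 p = 0.
  have [|//] := u_zero_grad ss pn _; rewrite pE (u_axis ss)// x10.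
  by exact: le_lt_trans (fst_le_nrm x) xn.
have a0 : 0 < (1 - nrm x) / 4 by rewrite divr_gt0// subr_gt0.
have [r r0 [r1 rn _]] := ex_min3 x10 a0 a0.
have inH y : `|y.1 - x.1| < r -> `|y.2| < `|x.2| + r -> H y.
  move=> y1 y2; have y10 : 0 < y.1.
    by move: y1; rewrite ltr_norml => /andP[y1 _]; move: y1 r1; clear -ss; lra.
  split => //; have q : nrm (x.1, `|x.2|) = nrm x by rewrite /nrm /sqn /= real_normK ?num_real.
  apply: (@le_lt_trans _ _ (nrm ((x.1, `|x.2|) + (r, r)))).
    apply: nrm_mono => /=.
      rewrite gtr0_norm// gtr0_norm ?addr_gt0//.
      by move: y1; rewrite ltr_norml => /andP[_]; clear -ss; lra.
    by rewrite [leRHS]ger0_norm ?addr_ge0 ?(ltW r0)// ltW.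
  apply: le_lt_trans (nrmD _ _) _; rewrite q.
  have : nrm (r, r) <= 2 * r.
    by apply: le_trans (nrm_le_norm _) _; rewrite ler_wpM2l// plane_norm_le/= gtr0_norm// lexx.
  by move: rn r0; clear -ss; lra.
pose f y := u2 y - y.2.
have Hn y : H y -> nrm y < 1 by case.
have fc y : H y -> {for y, continuous f}.
  by move=> /Hn/(ss_d ss)[_ _ [_ _ c2]]; apply: cvgB => //; exact: cvg_snd.
have fK y : H y -> `|f y| <= 2 * L + 1.
  move=> [_ yn]; apply: le_trans (ler_normB _ _) _; apply: lerD.
    by have [] := u_bounds ss yn.
  by apply: le_trans (nrm_ge2 y) (ltW yn).
have flip y z : H y -> H z -> `|f y - f z| <= (2 * L + 1) * `|y - z|.
  move=> [_ yn] [_ zn]; rewrite (_ : _ - _ = (u2 y - u2 z) - (y - z).2); last by rewrite /f /=; ring.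
  apply: le_trans (ler_normB _ _) _; have [_ l2] := ss_lip ss yn zn.
  have := norm_snd (y - z); have := mulr_ge0 (ltW L0) (normr_ge0 (y - z)).
  by move: l2; clear -ss; lra.
have fae : {ae mu2, forall y, H y -> is_derive y e2 f 0}.
  apply: ae_mono (ss_lap ss) => y Py Hy.
  have [d1 [d2 [D1 D2 D12]]] := Py (half_disc_Om Hy).
  have d10 : d1 = 0.
    have [d [s [d0 s1 dP]]] := Om_ball (ss_k ss) (half_disc_Om Hy).
    have D0 : is_derive y e1 u1 0.
      apply: (@is_derive_near0 _ _ _ _ (d / 2)); first exact: divr_gt0.
      move=> z zy; apply: (u1_eq0 ss).
      have [] := dP z; first by have := nrm_le_norm (z - y); move: zy; clear -ss; lra.
      by move=> z1 zs; split => //; exact: lt_trans s1.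
    by rewrite -(@derive_val _ _ _ _ _ _ _ D1) (@derive_val _ _ _ _ _ _ _ D0).
  have d21 : d2 = 1 by move: D12; rewrite d10 add0r.
  have := is_deriveB D2 (is_derive_snd2 y); rewrite d21 subrr; exact.
have fp : f p = 0 by rewrite /f u2p p2 subr0.
suff : f x = 0 by move/eqP; rewrite subr_eq0 => /eqP.
have [x20|x20|x20] := ltgtP 0 x.2.
- transitivity (f p) => //; rewrite xE; apply/esym.
  apply: (@vertical_constant R H f (2 * L + 1) r x.2 p) => // y; rewrite p1 p2 => y1 /andP[y2 y3].
  apply: inH => //; rewrite (gtr0_norm x20) ltr_norml; apply/andP.
  by split; move: y2 y3 x20; clear -ss; lra.
- transitivity (f p) => //.
  have -> : p = x + (- x.2) *: e2 by rewrite {1}xE scaleNr addrK.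
  apply: (@vertical_constant R H f (2 * L + 1) r (- x.2) x) => //; first by rewrite oppr_gt0.
  move=> y y1 /andP[y2 y3].
  apply: inH => //; rewrite (ltr0_norm x20) ltr_norml; apply/andP.
  by split; move: y2 y3 x20; clear -ss; lra.
- by rewrite xE -x20 scale0r addr0.
Qed.

Lemma u_half_disc x : H x -> u x = x.2 ^+ 2 / 2.
Proof.
move=> [x10 xn].
have [p pE] : exists p, p = x.1 *: e1 by eexists.
have xE : x = p + x.2 *: e2.
  by rewrite pE; apply: injective_projections; rewrite /= /GRing.scale/=; ring.
have ps (s : R) : `|s| <= `|x.2| -> H (p + s *: e2).
  move=> sx; have E1 : (p + s *: e2).1 = x.1 by rewrite pE /= /GRing.scale/=; ring.
  have E2 : (p + s *: e2).2 = s by rewrite pE /= /GRing.scale/=; ring.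
  split; first by rewrite E1.
  by apply: le_lt_trans xn; apply: nrm_mono; rewrite ?E1 ?E2.
have up : u p = 0.
  rewrite pE (u_axis ss)// x10.
  by exact: le_lt_trans (fst_le_nrm x) xn.
have [|c cx] := @dir_MVT R (fun y => u y - y.2 ^+ 2 / 2) (fun y => u2 y - y.2) p e2 x.2.
  move=> s /ps Hs; have [_ yn] := Hs; have [_ D _] := ss_d ss yn.
  have s2 := is_derive_snd2 (p + s *: e2).
  by apply: is_derive_eq; rewrite /GRing.scale/=; field.
rewrite (u2_half_disc (ps c cx)) subrr mul0r -xE up.
have -> : p.2 = 0 by rewrite pE /= /GRing.scale/= mulr0.
by rewrite expr0n/= mul0r subr0 subr0 => /eqP; rewrite subr_eq0 => /eqP.
Qed.

(** For [x.1 <= 0] the vertical segment would meet the slit, so the point is first moved to the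
    right into the half disc, along which [u] is constant because [u1 = 0]. *)
Lemma slit_rigidity x : Om k x -> u x = x.2 ^+ 2 / 2.
Proof.
move=> Ox; have [x1 xn] := Ox; have [k0 k1] := andP (ss_k ss).
have [x10|x10] := ltP 0 x.1; first exact: u_half_disc.
have x2n : `|x.2| < 1 by exact: le_lt_trans (nrm_ge2 x) xn.
(* The target abscissa [d] is positive with [d + |x.2| < 1], so the horizontal path ends inside the
   unit disc. *)
pose d := (1 - `|x.2|) / 2; pose t := d - x.1.
have d0 : 0 < d by rewrite divr_gt0// subr_gt0.
have t0 : 0 <= t by rewrite subr_ge0; exact: le_trans x10 (ltW d0).
have in1 (s : R) : (x + s *: e1).1 = x.1 + s by rewrite /= /GRing.scale/= mulr1.
have in2 (s : R) : (x + s *: e1).2 = x.2 by rewrite /= /GRing.scale/= mulr0 addr0.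
have dn : nrm (d, x.2) < 1.
  have -> : (d, x.2) = d *: e1 + x.2 *: e2.
    by apply: injective_projections; rewrite /= /GRing.scale/=; ring.
  apply: le_lt_trans (nrmD _ _) _; rewrite nrm_e1 nrm_e2 gtr0_norm//.
  by move: x2n; rewrite /d; clear -ss; lra.
have inO (s : R) : 0 <= s <= t -> Om k (x + s *: e1).
  move=> /andP[s0 st]; split.
    rewrite in1; have := nrmD (x + s *: e1) (- (s *: e1)).
    rewrite addrK nrmN nrm_e1 (ger0_norm s0) => hn.
    have h1 : k * nrm x <= k * (nrm (x + s *: e1) + s) by apply: ler_wpM2l => //; exact: ltW.
    have h2 : k * s <= 1 * s by apply: ler_wpM2r => //; exact: ltW.
    by move: h1 h2 x1; clear -ss; lra.
  have [s1|s1] := leP (x.1 + s) 0.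
    apply: le_lt_trans xn; apply: nrm_mono; rewrite ?in1 ?in2//.
    by rewrite !ler0_norm//; move: s0; clear -ss; lra.
  apply: le_lt_trans dn; apply: nrm_mono; rewrite ?in1 ?in2// [in leRHS]/=.
  by rewrite !gtr0_norm//; move: st; rewrite /t; clear -ss; lra.
have [s st|c ct] := @dir_MVT_ge0 R u u1 x e1 t t0.
  by have [_ sn] := inO s st; have [] := ss_d ss sn.
rewrite (u1_eq0 ss (inO c ct)) mul0r => /eqP; rewrite subr_eq0 => /eqP <-.
have [_ tn] : Om k (x + t *: e1) by apply: inO; rewrite t0 lexx.
by rewrite u_half_disc ?in2//; split => //; rewrite in1 /t addrC subrK.
Qed.

Lemma slit_solution_axis (t : R) : 0 < t < 1 -> u (t, 0) = 0.
Proof.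
move=> t01; have -> : (t, 0) = t *: e1; last exact: (u_axis ss t01).
by apply: injective_projections; rewrite /= /GRing.scale/= ?mulr1 ?mulr0.
Qed.
End Rigidity.

(** * From polar coordinates and the C^{1,1} hypotheses to the working form *)

Section Sector.
Context {R : realType}.
Implicit Types x y : R * R.

(** The cosine is even and decreasing on [[0, pi]], so [|theta| < pi - a] means
    [cos theta > - cos a]. Conversely the angle is [acos (x.1 / nrm x)], with the sign of [x.2]. *)
Lemma sector_unit_ball (a : R) : 0 < a -> a < pi / 2 ->
  sector a `&` @unit_ball R = Om (cos a).
Proof.
move=> a0 a2; have pi0 := @pi_gt0 R.
have pia : pi - a \in `[0, pi] by rewrite in_itv/=; apply/andP; split; move: a0 a2; clear; lra.
have cpia : cos (pi - a) = - cos a by rewrite addrC cosDpi cosN.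
apply/seteqP; split => x; rewrite /Om /=.
  move=> [[r [t [r0 t1 t2 ->]]] xn]; split => //=.
  have -> : nrm (r * cos t, r * sin t) = r.
    by rewrite /nrm /sqn /= !exprMn -mulrDr cos2Dsin2 mulr1 sqrtr_sqr gtr0_norm.
  rewrite mulrC ltr_pM2l// -cpia.
  have -> : cos t = cos `|t| by have [|] := ger0P t; rewrite ?cosN.
  have tp : `|t| < pi - a by rewrite ltr_norml; apply/andP; split; move: t1 t2; clear; lra.
  by rewrite ltr_cos// in_itv/= normr_ge0/=; move: tp a0; clear; lra.
move=> [x1 xn]; split => //.
have r0 : 0 < nrm x.
  rewrite lt_neqAle nrm_ge0 andbT eq_sym; apply/eqP => x0.
  have := nrm_ge1 x; rewrite x0 normr_le0 => /eqP x10.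
  by move: x1; rewrite x0 x10 mulr0 ltxx.
pose c := x.1 / nrm x.
have c1 : -1 <= c <= 1 by rewrite -ler_norml normrM normfV (gtr0_norm r0) ler_pdivrMr// mul1r nrm_ge1.
have [/andP[ac0 acpi] cac] := acos_def c1.
have sac : sin (acos c) = `|x.2| / nrm x.
  rewrite sin_acos// -[RHS]ger0_norm; last by apply: divr_ge0; rewrite ?nrm_ge0.
  rewrite -sqrtr_sqr; congr Num.sqrt; rewrite !expr_div_n real_normK ?num_real//.
  rewrite nrm_sqr /sqn; field.
  by rewrite -/(sqn x) gt_eqF// -nrm_gt0.
have acl : acos c < pi - a.
  rewrite -ltr_cos//; last by rewrite in_itv/= ac0.
  by rewrite cpia cac ltr_pdivlMr// mulrC.
have xE : x.1 = nrm x * cos (acos c) by rewrite cac /c mulrC divfK// gt_eqF.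
have x2E : `|x.2| = nrm x * sin (acos c) by rewrite sac mulrC divfK// gt_eqF.
have [x20|x20] := leP 0 x.2.
  exists (nrm x), (acos c); split => //; first by move: ac0 a2 pi0; clear; lra.
  by rewrite -xE -x2E ger0_norm//; case: x {x1 xn r0 c c1 ac0 acpi cac sac acl xE x2E x20}.
exists (nrm x), (- acos c); split => //; [by move: acl; clear; lra|by move: ac0 a2 pi0; clear; lra|].
rewrite cosN sinN mulrN -xE -x2E ltr0_norm// opprK.
by case: x {x1 xn r0 c c1 ac0 acpi cac sac acl xE x2E x20}.
Qed.

Lemma slit_solution_of_C11 (u : R * R -> R) (a : R) :
  C11_on (@unit_ball R) u -> convex_function (@unit_ball R) u ->
  (forall x, unit_ball x -> 0 <= u x) -> (forall x, slit x -> u x = 0) ->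
  0 < a -> a < pi / 2 ->
  laplacian_eq_on (sector a `&` @unit_ball R) u 1 ->
  exists L, slit_solution (cos a) L u (partial1 u) (partial2 u).
Proof.
move=> [[ud ugc] ulip] ucv u0 us a0 a2 ulap; have pi0 := @pi_gt0 R.
have ball x : nrm x < 1 -> x \in @unit_ball R by move=> xn; rewrite inE.
have coord (g : R * R -> R * R) x : {for x, continuous g} ->
    {for x, continuous (fun y => (g y).1)} /\ {for x, continuous (fun y => (g y).2)}.
  move=> cg.
  have c1 : {for g x, continuous (fst : R * R -> R)} by exact: cvg_fst.
  have c2 : {for g x, continuous (snd : R * R -> R)} by exact: cvg_snd.
  by split; [exact: (continuous_comp cg c1)|exact: (continuous_comp cg c2)].
have [L L0 LP] := pinfty_ex_gt0 ulip.
exists L; split => //.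
- apply/andP; split.
    by apply: cos_gt0_pihalf; apply/andP; split => //; move: a0 pi0; clear; lra.
  rewrite -(@cos0 R) ltr_cos// in_itv/= ?lexx ?(ltW pi0)//.
  by apply/andP; split; move: a0 a2 pi0; clear; lra.
- move=> x /ball xn; have dx := ud x xn; split.
  + by apply: derivableP; exact: diff_derivable.
  + by apply: derivableP; exact: diff_derivable.
  + have cg : {for x, continuous (gradient u)} by exact: ugc.
    split; first exact: differentiable_continuous.
      exact: (proj1 (coord _ x cg)).
    exact: (proj2 (coord _ x cg)).
- move=> x y xn yn; have lxy := LP (x, y) (conj xn yn).
  split; first exact: le_trans (norm_fst (gradient u x - gradient u y)) lxy.
  exact: le_trans (norm_snd (gradient u x - gradient u y)) lxy.
- move=> x y t xn yn /andP[t0 t1].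
  have := ucv (Itv01 t0 t1) x y (ball x xn) (ball y yn).
  by [].
- by move=> t t01; apply: us.
- apply: ae_mono ulap => x Px; rewrite -sector_unit_ball// => /Px[d1 d2 l].
  by do 2 eexists; split; [exact: derivableP d1|exact: derivableP d2|].
Qed.
End Sector.

Theorem theorem1p5 (R : realType) (u : R * R -> R) (a : R)
    (u_C11 : C11_on (@unit_ball R) u)
    (u_convex : convex_function (@unit_ball R) u)
    (u_ge0 : forall x, unit_ball x -> 0 <= u x)
    (u_slit : forall x, slit x -> u x = 0)
    (a_gt0 : 0 < a) (a_lt : a < pi / 2)
    (u_lap : laplacian_eq_on (sector a `&` @unit_ball R) u 1) :
  (forall x, (sector a `&` @unit_ball R) x -> u x = x.2 ^+ 2 / 2) /\
  ~ strictly_convex_on (sector a `&` @unit_ball R) u.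
Proof.
have [L ss] := slit_solution_of_C11 u_C11 u_convex u_ge0 u_slit a_gt0 a_lt u_lap.
have uE x : (sector a `&` @unit_ball R) x -> u x = x.2 ^+ 2 / 2.
  by rewrite sector_unit_ball// => /(slit_rigidity ss).
split=> // ustrict.
(* Strict convexity is tested on a segment of the positive axis, where [u] vanishes identically. *)
have comb (t : R) : t *: ((1 / 2, 0) : R * R) + (1 - t) *: (1 / 4, 0) = ((1 + t) / 4, 0).
  by apply: injective_projections; rewrite /= /GRing.scale/=; field.
have u0 (t : R) : 0 < t < 1 -> u (t, 0) = 0 by exact: (slit_solution_axis ss).
have neq : ((1 / 2, 0) : R * R) != (1 / 4, 0) by apply/eqP => -[]; lra.
have inD (t : R) : 0 <= t <= 1 ->
    (sector a `&` @unit_ball R) (t *: ((1 / 2, 0) : R * R) + (1 - t) *: (1 / 4, 0)).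
  move=> /andP[t0 t1]; rewrite comb sector_unit_ball//; apply: (half_disc_Om ss).
  split=> /=; first lra.
  by rewrite /nrm /sqn /= expr0n addr0 sqrtr_sqr ger0_norm; lra.
have h01 : 0 < (1 / 2 : R) < 1 by apply/andP; split; lra.
have := ustrict _ _ neq inD _ h01; rewrite comb !u0; [|apply/andP; split; lra..].
by rewrite !mulr0 addr0 ltxx.
Qed.
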